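(* Let $H$ and $V$ be complex Hilbert spaces such that $V$ is continuously and densely embedded into $H$, and let $a:V\times V\to\mathbb{C}$ be a continuous sesquilinear form. Let $A$ be the operator on $H$ associated with $a$. Assume that $a$ is essentially positive-coercive. Then $-A$ generates a holomorphic $C_0$-semigroup $S$ on $H$, and $S$ is asymptotically compact.
   Context: The operator $A$ associated with $a$ is the operator on $H$ with graph $\{(u,f)\in H\times H: u\in V,\ a(u,v)=\langle f,v\rangle_H \text{ for all } v\in V\}$. The form $a$ is essentially positive-coercive if, for every sequence $(u_n)$ in $V$, the conditions $u_n\rightharpoonup 0$ weakly in $V$ and $\limsup_{n\to\infty}\operatorname{Re} a(u_n,u_n)\le 0$ imply $\|u_n\|_V\to 0$. For a bounded operator $T$ on $H$, $\|T\|_{ess}$ denotes the distance (in operator norm) of $T$ to the space of compact operators on $H$. A $C_0$-semigroup $S$ on $H$ is asymptotically compact if there exist $M\ge 0$ and $\delta>0$ such that $\|S(t)\|_{ess}\le M e^{-\delta t}$ for all $t\ge 0$. *)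

(* Defs.v *)
From mathcomp Require Import all_boot all_order all_algebra.
From mathcomp Require Import complex.
From mathcomp Require Import all_classical all_reals all_analysis.

Set Implicit Arguments.
Unset Strict Implicit.
Unset Printing Implicit Defensive.

Import Order.TTheory GRing.Theory Num.Theory.
Import numFieldNormedType.Exports.

Local Open Scope classical_set_scope.
Local Open Scope ring_scope.
Local Open Scope complex_scope.

(* Complex numbers are R[i] with R : realType. A complex Hilbert space is a
   completeNormedModType R[i] together with a {dot _ for Num.conj} (positive
   definite, linear on the left, conjugate-linear on the right) inducing its
   norm. The topology of the scalar field is carried by R[i]^o. *)
Definition dot_induces_norm (R : realType) (H : completeNormedModType R[i])
    (dot : {dot H for Num.conj}) : Prop :=
  forall x : H, dot x x = `|x| ^+ 2.

(* `|x| is an element of R[i] with zero imaginary part. *)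
Definition rnorm (R : realType) (H : completeNormedModType R[i]) (x : H) : R :=
  complex.Re `|x|.

Definition weakly_to0 (R : realType) (V : completeNormedModType R[i])
    (u : nat -> V) : Prop :=
  forall f : {scalar V}, continuous (f : V -> R[i]^o) ->
    (f (u n) : R[i]^o) @[n --> \oo] --> (0 : R[i]^o).

Definition sesquilinear_form (R : realType) (V : completeNormedModType R[i]) :=
  {bilinear V -> V -> R[i] | *%R & Num.conj \; *%R}.

Definition continuous_form (R : realType) (V : completeNormedModType R[i])
    (a : sesquilinear_form V) : Prop :=
  continuous (fun p : V * V => a p.1 p.2 : R[i]^o).

Definition essentially_positive_coercive (R : realType)
    (V : completeNormedModType R[i]) (a : sesquilinear_form V) : Prop :=
  forall u : nat -> V, weakly_to0 u ->
    (limn_esup (fun n => (complex.Re (a (u n) (u n)))%:E) <= 0)%E ->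
    rnorm (u n) @[n --> \oo] --> (0 : R).

(* Unbounded operators on H are represented by their graphs. The inclusion of V
   into H is an explicit map j. *)
Definition form_operator (R : realType) (H V : completeNormedModType R[i])
    (dot : {dot H for Num.conj}) (j : {linear V -> H})
    (a : sesquilinear_form V) : set (H * H) :=
  [set p | exists2 u : V, p.1 = j u & forall v : V, a u v = dot p.2 (j v)].

Definition opp_operator (R : realType) (H : completeNormedModType R[i])
    (A : set (H * H)) : set (H * H) :=
  [set p | A (p.1, - p.2)].

(* Meaningful when f is linear and continuous: otherwise the sup may be taken
   over an unbounded set. *)
Definition op_norm (R : realType) (H : completeNormedModType R[i])
    (f : H -> H) : R :=
  sup [set rnorm (f x) | x in [set x : H | `|x| <= 1]].

Definition compact_operator (R : realType) (H : completeNormedModType R[i])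
    (K : {linear H -> H}) : Prop :=
  precompact [set K x | x in [set x : H | `|x| <= 1]].

Definition ess_norm (R : realType) (H : completeNormedModType R[i])
    (T : H -> H) : R :=
  inf [set op_norm (fun x => T x - K x) | K in @compact_operator R H].

(* Values S t with t < 0 are irrelevant. *)
Definition C0_semigroup (R : realType) (H : completeNormedModType R[i])
    (S : R -> {linear H -> H}) : Prop :=
  [/\ forall t, 0 <= t -> continuous (S t),
      forall x, S 0 x = x,
      forall s t x, 0 <= s -> 0 <= t -> S (s + t) x = S s (S t x)
    & forall x, S t x @[t --> 0^'+] --> x].

Definition generator (R : realType) (H : completeNormedModType R[i])
    (S : R -> {linear H -> H}) : set (H * H) :=
  [set p | (t^-1)%:C *: (S t p.1 - p.1) @[t --> 0^'+] --> p.2].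

Definition sector (R : realType) (theta : R) : set R[i] :=
  [set z | exists r phi : R, [/\ 0 < r, `|phi| < theta
     & z = (r * cos phi) +i* (r * sin phi)]].

(* Complex differentiability at z with respect to the operator norm. *)
Definition op_differentiable (R : realType) (H : completeNormedModType R[i])
    (T : R[i] -> {linear H -> H}) (z : R[i]) : Prop :=
  exists2 D : {linear H -> H}, continuous D &
    op_norm (fun x => h^-1 *: (T (z + h) x - T z x) - D x)
      @[h --> (0 : R[i]^o)^'] --> (0 : R).

(* Arendt-Batty-Hieber-Neubrander, Vector-valued Laplace Transforms and Cauchy
   Problems, Definition 3.7.1: a C0-semigroup with a holomorphic extension
   T : sector theta -> L(H) which is bounded near 0 on smaller sectors. *)
Definition holomorphic_C0_semigroup (R : realType)
    (H : completeNormedModType R[i]) (S : R -> {linear H -> H}) : Prop :=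
  C0_semigroup S /\
  exists (theta : R) (T : R[i] -> {linear H -> H}),
    [/\ 0 < theta <= pi / 2,
        forall z, sector theta z -> continuous (T z),
        forall z, sector theta z -> op_differentiable T z,
        forall t x, 0 < t -> T t%:C x = S t x
      & forall theta', 0 < theta' < theta -> exists M : R,
          forall z, sector theta' z -> `|z| <= 1 -> op_norm (T z) <= M].

Definition asymptotically_compact (R : realType)
    (H : completeNormedModType R[i]) (S : R -> {linear H -> H}) : Prop :=
  exists M delta : R, [/\ 0 <= M, 0 < delta
    & forall t, 0 <= t -> ess_norm (S t) <= M * expR (- delta * t)].

(* Main.v *)
(* Essential positive-coercivity forces a coercivity estimate
     Re a(u,u) + c sum_(h in l) |<j u, h>|^2 >= al |u|_V^2
   for some finite family [l] in H.  With [om = c sum |h|^2], the form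
   [a1 = a + om <j., j.>] is coercive, and adding a form [k] of finite rank gives
   a form [b1] with [Re b1(u,u) >= (om + de) |j u|^2].

   The resolvents [V(z) = (1 + z A)^-1] of a coercive form are contractions on a
   cone around the positive axis.  A Lyapunov function gives the Ritt estimate
   [|(1 - V(z)) V(z)^k| <= C/(k+1)], and this estimate alone makes the Euler
   approximations [V(z/2^k)^(2^k)] converge in operator norm to a holomorphic
   semigroup, without integrals or Yosida approximations.

   The resolvents of [a1] and [b1] differ by a compact operator, hence so do the
   powers of resolvents and their norm limits [Ta(t)] and [Tb(t)].  As
   [|Tb(t)| <= exp(-(om + de) t)] and the semigroup of [a] is [exp(om t) Ta(t)],
   the latter is asymptotically compact. *)
Require Import Defs.
From HB Require Import structures.
From mathcomp Require Import all_boot all_order all_algebra.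
From mathcomp Require Import complex ring lra zify.
From mathcomp Require Import all_classical all_reals all_analysis.
Set Implicit Arguments.
Unset Strict Implicit.
Unset Printing Implicit Defensive.
Import Order.TTheory GRing.Theory Num.Theory.
Import numFieldNormedType.Exports Normc.
Local Open Scope classical_set_scope.
Local Open Scope ring_scope.
Local Open Scope complex_scope.

(** * Norms and Hilbert space geometry *)

Section ComplexModulus.
Variable R : realType.
Implicit Types (c d : R[i]) (t : R).

(** Compactness survives norm limits but not strong ones, so a strong construction of the semigroups
    would not carry the compact difference of resolvents over to them; hence every estimate is in
    operator norm. Norm convergence comes from errors that are quadratic in
    [D z = 1 - V z = z A V z]: one has [V p V q - V (p + q) = - D p D q V (p + q)]. In a telescoping
    sum of [n] such terms the accompanying powers of resolvents let each [D] decay like [1/n], so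
    the sum is [O(1/n)]. The same count bounds second-order Taylor remainders in the complex
    parameter uniformly in the number of factors, which gives holomorphy.

    The shift [om] has two tasks. It dominates the finite-rank form, because
    [|k(u,u)| <= om |j u|^2], so that [a + om] inherits the coercivity of [a + k]. And
    [b1 = a + k + om] keeps the whole of [om] on top of that coercivity, so that the growth
    [exp(om t)] is cancelled exactly and the rate [de], which comes from the embedding constant, is
    left over. *)

Lemma normcE c : `|c| = (normc c)%:C. Proof. by []. Qed.

Lemma normc_ge0 c : 0 <= normc c.
Proof. by rewrite -lecR -normcE normr_ge0. Qed.

Lemma normc_real t : normc t%:C = `|t|.
Proof. by rewrite /= expr0n addr0 sqrtr_sqr. Qed.

Lemma normc_gt0 c : (0 < normc c) = (c != 0).
Proof. by rewrite -ltcR -normcE normr_gt0. Qed.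

Lemma normcX c n : normc (c ^+ n) = normc c ^+ n.
Proof. by elim: n => [|n IH]; rewrite ?expr0 ?normc1// !exprS normcM IH. Qed.

Lemma normc_conj c : normc (Num.conj c) = normc c.
Proof. by case: c => a b /=; rewrite sqrrN. Qed.

Lemma normc_sqr c : normc c ^+ 2 = complex.Re c ^+ 2 + complex.Im c ^+ 2.
Proof. by case: c => a b /=; rewrite sqr_sqrtr// addr_ge0 ?sqr_ge0. Qed.

Lemma ger_Re_normc c : `|complex.Re c| <= normc c.
Proof. by have := normc_ge_Re c; rewrite normcE lecR. Qed.

Lemma Re_le_normc c : complex.Re c <= normc c.
Proof. exact: le_trans (ler_norm _) (ger_Re_normc c). Qed.

Lemma ger_Im_normc c : `|complex.Im c| <= normc c.
Proof.
by rewrite -[leRHS]ger0_norm ?normc_ge0// -ler_sqr ?nnegrE ?normr_ge0//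
  !real_normK ?num_real// normc_sqr lerDr sqr_ge0.
Qed.

Lemma Re_realM t c : complex.Re (t%:C * c) = t * complex.Re c.
Proof. by case: c => a b /=; rewrite mul0r subr0. Qed.

Lemma Re_mul c d : complex.Re (c * d) =
  complex.Re c * complex.Re d - complex.Im c * complex.Im d.
Proof. by case: c d => a b [a' b']. Qed.

Lemma Im_mul c d : complex.Im (c * d) =
  complex.Re c * complex.Im d + complex.Im c * complex.Re d.
Proof. by case: c d => a b [a' b'] /=. Qed.

Lemma ReD c d : complex.Re (c + d) = complex.Re c + complex.Re d.
Proof. by case: c d => a b [a' b']. Qed.

Lemma ImD c d : complex.Im (c + d) = complex.Im c + complex.Im d.
Proof. by case: c d => a b [a' b']. Qed.

Lemma ReN c : complex.Re (- c) = - complex.Re c.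
Proof. by case: c. Qed.

Lemma Re_conj c : complex.Re (Num.conj c) = complex.Re c.
Proof. by case: c. Qed.

Lemma ReB c d : complex.Re (c - d) = complex.Re c - complex.Re d.
Proof. by rewrite ReD ReN. Qed.

Lemma normc_conjM c : c * Num.conj c = (normc c ^+ 2)%:C.
Proof. by rewrite -normCK normcE -rmorphXn. Qed.

End ComplexModulus.

Section RealNorm.
Variables (R : realType) (H : completeNormedModType R[i]).
Implicit Types (x y : H) (c : R[i]).

Lemma normE x : `|x| = (rnorm x)%:C.
Proof. by rewrite /rnorm RRe_real// normr_real. Qed.

Lemma rnorm_ge0 x : 0 <= rnorm x.
Proof. by rewrite -lecR -normE normr_ge0. Qed.

Lemma rnorm0 : rnorm (0 : H) = 0.
Proof. by rewrite /rnorm normr0. Qed.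

Lemma rnorm_eq0 x : rnorm x = 0 -> x = 0.
Proof. by move=> x0; apply/eqP; rewrite -normr_eq0 normE x0. Qed.

Lemma rnorm_gt0 x : (0 < rnorm x) = (x != 0).
Proof. by rewrite -ltcR -normE normr_gt0. Qed.

Lemma rnormD x y : rnorm (x + y) <= rnorm x + rnorm y.
Proof. by rewrite -lecR rmorphD/= -!normE ler_normD. Qed.

Lemma rnormN x : rnorm (- x) = rnorm x.
Proof. by rewrite /rnorm normrN. Qed.

Lemma rnormB x y : rnorm (x - y) <= rnorm x + rnorm y.
Proof. by rewrite -(rnormN y) rnormD. Qed.

Lemma rnorm_distC x y : rnorm (x - y) = rnorm (y - x).
Proof. by rewrite -rnormN opprB. Qed.

Lemma rnorm_triangle z x y : rnorm (x - y) <= rnorm (x - z) + rnorm (z - y).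
Proof. by apply: le_trans (rnormD _ _); rewrite addrA subrK. Qed.

Lemma rnormZ c x : rnorm (c *: x) = normc c * rnorm x.
Proof.
by apply: complexI; rewrite -normE normrZ normE normcE -rmorphM.
Qed.

Lemma le_rnorm_eps x y : (forall e, 0 < e -> rnorm (x - y) <= e) -> x = y.
Proof.
move=> h; apply/eqP; rewrite -subr_eq0; apply/eqP/rnorm_eq0/eqP.
rewrite eq_le rnorm_ge0 andbT; apply/ler_addgt0Pl => e e0.
by rewrite addr0 h.
Qed.

(** Norms and radii of balls live in [R[i]]; real radii make the estimates accessible to [lra]. *)
Definition rcvg (u : nat -> H) (l : H) : Prop :=
  forall e, 0 < e -> exists N, forall n, (N <= n)%N -> rnorm (u n - l) <= e.

Lemma rcauchy_cvg (u : nat -> H) :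
  (forall e, 0 < e -> exists N, forall m n, (N <= m)%N -> (N <= n)%N ->
    rnorm (u m - u n) <= e) -> exists l, rcvg u l.
Proof.
move=> cu.
have : cvg (u n @[n --> \oo]).
  apply/cauchy_cvgP/cauchy_ballP => e e0.
  have eE : e = (complex.Re e)%:C by rewrite RRe_real// gtr0_real.
  have e0' : 0 < complex.Re e by rewrite -ltcR -eE.
  have [N HN] := cu _ (divr_gt0 e0' (ltr0Sn R 1)).
  exists (u @` [set n | (N <= n)%N], u @` [set n | (N <= n)%N]) => /=.
    by split; exists N => //= n Nn; exists n.
  move=> [_ _] /= [[m Nm <-] [n Nn <-]].
  rewrite -ball_normE /= normE eE ltcR.
  by apply: le_lt_trans (HN _ _ Nm Nn) _; rewrite ltr_pdivrMr// ltr_pMr// ltr1n.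
move=> /cvg_ex[l ul]; exists l => e e0.
have e0c : 0 < e%:C by rewrite ltcR.
move/cvgrPdist_le: ul => /(_ _ e0c) [N _ HN]; exists N => n /HN.
by rewrite /= normE lecR rnorm_distC.
Qed.

Lemma rcvg_unique u (l l' : H) : rcvg u l -> rcvg u l' -> l = l'.
Proof.
move=> ul ul'; apply: le_rnorm_eps => e e0.
have e2 : 0 < e / 2 by rewrite divr_gt0.
have [N HN] := ul _ e2; have [N' HN'] := ul' _ e2.
apply: le_trans (rnorm_triangle (u (maxn N N')) _ _) _.
rewrite [leRHS]splitr lerD ?HN' ?leq_maxr// rnorm_distC.
by rewrite HN ?leq_maxl.
Qed.

Lemma rcvg_rnorm_le u (l : H) x r : rcvg u l ->
  (exists N, forall n, (N <= n)%N -> rnorm (u n - x) <= r) -> rnorm (l - x) <= r.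
Proof.
move=> ul [N HN]; apply/ler_addgt0Pl => e e0; have [N' HN'] := ul _ e0.
apply: le_trans (rnorm_triangle (u (maxn N N')) _ _) _.
by rewrite lerD ?HN ?leq_maxl// rnorm_distC HN' ?leq_maxr.
Qed.

Lemma rcvgD u v (l m : H) : rcvg u l -> rcvg v m ->
  rcvg (fun n => u n + v n) (l + m).
Proof.
move=> ul vm e e0; have e2 : 0 < e / 2 by rewrite divr_gt0.
have [N HN] := ul _ e2; have [N' HN'] := vm _ e2.
exists (maxn N N') => n; rewrite geq_max => /andP[Nn N'n].
by rewrite opprD addrACA [leRHS]splitr (le_trans (rnormD _ _))// lerD ?HN ?HN'.
Qed.

Lemma rcvgZ c u (l : H) : rcvg u l -> rcvg (fun n => c *: u n) (c *: l).
Proof.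
move=> ul e e0.
have c1 : 0 < normc c + 1 by rewrite ltr_wpDl ?normc_ge0.
have [N HN] := ul _ (divr_gt0 e0 c1); exists N => n /HN le.
rewrite -scalerBr rnormZ.
have c_le : normc c <= normc c + 1 by rewrite lerDl ler01.
apply: le_trans (ler_pM (normc_ge0 c) (rnorm_ge0 _) c_le le) _.
by rewrite mulrC divfK// gt_eqF.
Qed.

End RealNorm.

Lemma linear_continuous_rbound (R : realType) (V W : completeNormedModType R[i])
  (f : {linear V -> W}) : continuous f ->
  exists2 c : R, 0 < c & forall x, rnorm (f x) <= c * rnorm x.
Proof.
move=> fc; have /linear_boundedP[y [yr fb]] := continuous_linear_bounded 0 (fc (0 : V)).
have y1 : y < `|y| + 1 by rewrite (le_lt_trans (real_ler_norm yr))// ltrDl.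
have yE : `|y| + 1 = (normc y + 1)%:C by rewrite normcE rmorphD.
exists (normc y + 1); first by rewrite ltr_wpDl ?normc_ge0.
by move=> x; have := fb _ y1 x; rewrite yE !normE -rmorphM lecR.
Qed.

Lemma rbound_linear_continuous (R : realType) (V W : completeNormedModType R[i])
  (f : {linear V -> W}) (c : R) :
  (forall x, rnorm (f x) <= c * rnorm x) -> continuous f.
Proof.
move=> fb; apply: bounded_linear_continuous; apply/linear_boundedP.
exists c%:C; split; first by rewrite complex_real.
by move=> M cM x; rewrite (le_trans _ (ler_wpM2r _ (ltW cM)))// !normE -rmorphM lecR.
Qed.

(** * Projection theorem, Riesz representation and Lax-Milgram *)

Section HilbertGeometry.
Variables (R : realType) (V : completeNormedModType R[i]).
Variables (dot : {dot V for Num.conj}) (dot_norm : dot_induces_norm dot).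
Implicit Types (x y v w : V) (c : R[i]).

Lemma dotDl x y v : dot (x + y) v = dot x v + dot y v.
Proof. exact: linearDl. Qed.

Lemma dotDr x y v : dot v (x + y) = dot v x + dot v y.
Proof. exact: linearDr. Qed.

Lemma dotZl c x v : dot (c *: x) v = c * dot x v.
Proof. exact: linearZl_LR. Qed.

Lemma dotZr c x v : dot v (c *: x) = Num.conj c * dot v x.
Proof. exact: linearZr_LR. Qed.

Lemma dotBl x y v : dot (x - y) v = dot x v - dot y v.
Proof. exact: linearBl. Qed.

Lemma dotBr x y v : dot v (x - y) = dot v x - dot v y.
Proof. exact: linearBr. Qed.

Lemma dot_conj x y : Num.conj (dot x y) = dot y x.
Proof. by rewrite [in RHS](hermC dot) expr0 mul1r. Qed.

Lemma dot_sqr x : dot x x = (rnorm x ^+ 2)%:C.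
Proof. by rewrite dot_norm normE -rmorphXn. Qed.

Lemma rnorm_sqr x : rnorm x ^+ 2 = complex.Re (dot x x).
Proof. by rewrite dot_sqr. Qed.

Lemma rnorm_sqrB x y :
  rnorm (x - y) ^+ 2 = rnorm x ^+ 2 + rnorm y ^+ 2 - complex.Re (dot x y) *+ 2.
Proof.
rewrite !rnorm_sqr dotBl !dotBr -(dot_conj x y) !ReB Re_conj; lra.
Qed.

Lemma rnorm_sqr_sub_proj x v : v != 0 ->
  rnorm (x - (dot x v / (rnorm v ^+ 2)%:C) *: v) ^+ 2 =
  rnorm x ^+ 2 - normc (dot x v) ^+ 2 / rnorm v ^+ 2.
Proof.
move=> v0; have vn0 : rnorm v != 0 by rewrite gt_eqF// rnorm_gt0.
rewrite rnorm_sqrB dotZr rnormZ exprMn.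
set d := dot x v; set r := rnorm v ^+ 2.
have r0 : 0 < r by rewrite exprn_gt0// rnorm_gt0.
have -> : Num.conj (d / r%:C) * d = (r^-1 * normc d ^+ 2)%:C.
  rewrite -fmorphV normc_sqr; case: (d) => s t; apply/eqP; rewrite eq_complex /=.
  by apply/andP; split; apply/eqP; ring.
rewrite normcM normcV normc_real gtr0_norm// [complex.Re _]/=.
by field; rewrite gt_eqF.
Qed.

(** Subtracting the best multiple of [v] gains exactly [|<x,v>|^2 / |v|^2], and near-minimality caps
    this gain by [e^2]. So an approximate minimiser is approximately orthogonal, with a rate. *)
Lemma near_min_dot x v e : 0 <= e ->
  (forall c, rnorm x ^+ 2 <= rnorm (x - c *: v) ^+ 2 + e ^+ 2) ->
  normc (dot x v) <= e * rnorm v.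
Proof.
move=> e0 xmin; have [->|v0] := eqVneq v 0.
  by rewrite [dot x 0]linear0r normc0 rnorm0 mulr0.
have := xmin (dot x v / (rnorm v ^+ 2)%:C).
rewrite rnorm_sqr_sub_proj// addrAC lerBrDr lerD2l.
rewrite ler_pdivrMr ?exprn_gt0 ?rnorm_gt0// -exprMn ler_sqr// nnegrE.
  exact: normc_ge0.
by rewrite mulr_ge0// rnorm_ge0.
Qed.

Lemma CauchySchwarz_rnorm x y : normc (dot x y) <= rnorm x * rnorm y.
Proof.
by apply: near_min_dot => [|c]; rewrite ?rnorm_ge0// lerDr sqr_ge0.
Qed.

Lemma Re_dot_le x y : complex.Re (dot x y) <= rnorm x * rnorm y.
Proof. exact: le_trans (Re_le_normc _) (CauchySchwarz_rnorm x y). Qed.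

Definition closed_subspace (P : V -> Prop) : Prop :=
  [/\ P 0, forall c x y, P x -> P y -> P (c *: x + y)
    & forall u l, (forall n, P (u n)) -> rcvg u l -> P l].

(** A minimising sequence with error [1/(n+1)^2] has residuals [y - u n] that are orthogonal to [P]
    up to [1/(n+1)]. Writing [u m - u n] as a difference of residuals and pairing it with itself
    shows that the sequence is Cauchy; this replaces the parallelogram law. *)
Lemma orthogonal_projection (P : V -> Prop) y : closed_subspace P ->
  exists2 w, P w & forall v, P v -> dot (y - w) v = 0.
Proof.
move=> [P0 Plin Pcl].
set S := [set r | exists2 v, P v & r = rnorm (y - v) ^+ 2].
have infS : has_inf S.
  split; first by exists (rnorm (y - 0) ^+ 2), 0.
  by exists 0 => _ [v _ ->]; exact: sqr_ge0.
have near n : exists v, P v /\ forall v', P v' ->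
    rnorm (y - v) ^+ 2 <= rnorm (y - v') ^+ 2 + n.+1%:R^-1 ^+ 2.
  have en : 0 < n.+1%:R^-1 ^+ 2 :> R by rewrite exprn_gt0// invr_gt0.
  have [_ [v Pv ->] vlt] := inf_adherent en infS.
  exists v; split => // v' Pv'; apply: le_trans (ltW vlt) _; rewrite lerD2r.
  by apply: ge_inf; [case: infS | exists v'].
have [u Pu] := choice near.
have PB v v' : P v -> P v' -> P (v' - v).
  by move=> Pv Pv'; rewrite addrC -scaleN1r; exact: Plin.
have uorth n v : P v -> normc (dot (y - u n) v) <= n.+1%:R^-1 * rnorm v.
  move=> Pv; apply: near_min_dot => [|c]; first by rewrite invr_ge0.
  by rewrite -addrA -opprD; apply: (Pu n).2; rewrite addrC; apply: Plin; case: (Pu n).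
have udist m n : rnorm (u m - u n) <= n.+1%:R^-1 + m.+1%:R^-1.
  have [->|neq] := eqVneq (u m) (u n).
    by rewrite subrr rnorm0 addr_ge0// invr_ge0.
  have Pv := PB _ _ (Pu n).1 (Pu m).1.
  rewrite -(@ler_pM2r _ (rnorm (u m - u n))) ?rnorm_gt0 ?subr_eq0//.
  rewrite mulrDl -expr2 rnorm_sqr.
  have {1}-> : u m - u n = (y - u n) - (y - u m) by rewrite opprB [RHS]addrC addrA subrK.
  rewrite dotBl ReB -ReN.
  by rewrite lerD// (le_trans (Re_le_normc _))// ?normcN uorth.
have inv_small e : 0 < e -> exists N, forall n, (N <= n)%N -> n.+1%:R^-1 <= e :> R.
  move=> e0; have [N _ HN] := near_infty_natSinv_lt (PosNum e0).
  by exists N => n /HN /ltW.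
have [w uw] : exists w, rcvg u w.
  apply: rcauchy_cvg => e e0; have [N HN] := inv_small _ (divr_gt0 e0 (ltr0Sn R 1)).
  exists N => m n Nm Nn; apply: le_trans (udist m n) _.
  by rewrite [leRHS]splitr lerD ?HN.
exists w; first by apply: (Pcl u) => // n; case: (Pu n).
move=> v Pv; apply: eq0_normc; apply/eqP; rewrite eq_le normc_ge0 andbT.
apply/ler_addgt0Pl => e e0; rewrite addr0.
have v1 : 0 < rnorm v + 1 by rewrite ltr_wpDl ?rnorm_ge0.
have e2 : 0 < e / 2 / (rnorm v + 1) by rewrite !divr_gt0.
have [N HN] := inv_small _ e2; have [N' HN'] := uw _ e2.
pose n := maxn N N'.
have -> : y - w = (y - u n) + (u n - w) by rewrite addrA subrK.
rewrite dotDl (le_trans (le_normcD _ _))// [leRHS]splitr.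
have bnd r : 0 <= r -> r <= e / 2 / (rnorm v + 1) -> r * rnorm v <= e / 2.
  move=> r0 re; rewrite (@le_trans _ _ (r * (rnorm v + 1)))//.
    by rewrite ler_wpM2l// lerDl.
  by rewrite -ler_pdivlMr.
rewrite lerD//.
  by apply: le_trans (uorth n v Pv) _; rewrite bnd ?invr_ge0// HN// leq_maxl.
apply: le_trans (CauchySchwarz_rnorm _ _) _.
by rewrite bnd ?rnorm_ge0// HN'// leq_maxr.
Qed.

Lemma riesz_representation (f : V -> R[i]) (C : R) :
  (forall c x y, f (c *: x + y) = c * f x + f y) ->
  (forall x, normc (f x) <= C * rnorm x) ->
  exists y, forall x, f x = dot x y.
Proof.
move=> flin fbd.
have f0 : f 0 = 0.
  have := flin 1 0 0; rewrite scaler0 addr0 mul1r => /(congr1 (fun t => t - f 0)).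
  by rewrite /= subrr addrK => <-.
have fZ c x : f (c *: x) = c * f x by rewrite -[c *: x]addr0 flin f0 addr0.
have fD x y : f (x + y) = f x + f y by rewrite -[x in LHS]scale1r flin mul1r.
have fN x : f (- x) = - f x by rewrite -scaleN1r fZ mulN1r.
have [fz|/existsNP[x0 fx0]] := pselect (forall x, f x = 0).
  by exists 0 => x; rewrite fz [dot x 0]linear0r.
have [|w fw worth] := @orthogonal_projection (fun x => f x = 0) x0.
  split=> // [c x y fx fy|u l fu ul]; first by rewrite flin fx fy mulr0 addr0.
  apply: eq0_normc; apply/eqP; rewrite eq_le normc_ge0 andbT.
  apply/ler_addgt0Pl => e e0; rewrite addr0.
  have C1 : 0 < `|C| + 1 by rewrite ltr_wpDl.
  have [N /(_ _ (leqnn N)) HN] := ul _ (divr_gt0 e0 C1).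
  have -> : l = - (u N - l) + u N by rewrite opprB subrK.
  rewrite fD fu addr0 fN normcN (le_trans (fbd _))//.
  rewrite (@le_trans _ _ ((`|C| + 1) * rnorm (u N - l)))//.
    by rewrite ler_wpM2r ?rnorm_ge0// (le_trans (ler_norm _))// lerDl.
  by rewrite mulrC -ler_pdivlMr.
set z := x0 - w in worth.
have fz : f z != 0 by rewrite fD fN fw subr0; apply/eqP.
have z0 : z != 0 by apply: contraNneq fz => ->; rewrite f0.
have nz : (rnorm z ^+ 2)%:C != 0.
  rewrite -[0]/(0%:C) (inj_eq (@complexI R)) expf_eq0/=.
  by rewrite gt_eqF// rnorm_gt0.
exists (Num.conj (f z / (rnorm z ^+ 2)%:C) *: z) => x.
have : dot z (x - (f x / f z) *: z) = 0.
  by apply: worth; rewrite fD fN fZ divfK// subrr.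
move/(congr1 Num.conj); rewrite dot_conj dotBl dotZl rmorph0 => /eqP.
rewrite subr_eq0 => /eqP xz.
rewrite dotZr xz conjCK dot_sqr -!mulrA mulrC mulrA.
by move: (rnorm z ^+ 2)%:C nz => r nz; field; rewrite fz nz.
Qed.

(** Coercivity bounds [u] by the vector representing [b u], so these vectors form a closed subspace.
    If [w] is the projection of [y] onto it, the vector representing [b (y - w)] lies in it as well
    and is orthogonal to [y - w]; hence [b (y - w) (y - w) = 0] and [y = w]. *)
Lemma lax_milgram (b : V -> V -> R[i]) (M al : R) :
  (forall c x y v, b (c *: x + y) v = c * b x v + b y v) ->
  (forall c x y v, b v (c *: x + y) = Num.conj c * b v x + b v y) ->
  (forall x y, normc (b x y) <= M * rnorm x * rnorm y) ->
  0 < al -> (forall x, al * rnorm x ^+ 2 <= complex.Re (b x x)) ->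
  forall y, exists u, forall v, b u v = dot y v.
Proof.
move=> bl br bM al0 bal.
have repr u : exists y, forall v, b u v = dot y v.
  have [||y Hy] := @riesz_representation (fun v => Num.conj (b u v)) (M * rnorm u).
  - by move=> c x y; rewrite br rmorphD rmorphM /= conjCK.
  - by move=> x; rewrite normc_conj.
  by exists y => v; rewrite -dot_conj -Hy conjCK.
have bB x y v : b (x - y) v = b x v - b y v.
  by rewrite addrC -scaleN1r bl mulN1r addrC.
have bdist u u' y y' : (forall v, b u v = dot y v) -> (forall v, b u' v = dot y' v) ->
    al * rnorm (u - u') <= rnorm (y - y').
  move=> Hu Hu'; have [->|neq] := eqVneq u u'; first by rewrite subrr rnorm0 mulr0 rnorm_ge0.
  rewrite -(@ler_pM2r _ (rnorm (u - u'))) ?rnorm_gt0 ?subr_eq0//.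
  rewrite -mulrA -expr2 (le_trans (bal _))// bB Hu Hu' -dotBl.
  exact: Re_dot_le.
have Pcl : closed_subspace (fun y => exists u, forall v, b u v = dot y v).
  split=> [|c x y [u Hu] [u' Hu']|y l Hy yl].
  - exists 0 => v; rewrite [dot 0 v]linear0l.
    by have := bB 0 0 v; rewrite subr0 => ->; rewrite subrr.
  - by exists (c *: u + u') => v; rewrite bl Hu Hu' dotDl dotZl.
  have [u Hu] := choice Hy.
  have [w uw] : exists w, rcvg u w.
    apply: rcauchy_cvg => e e0.
    have [N HN] := yl _ (divr_gt0 (mulr_gt0 al0 e0) (ltr0Sn R 1)).
    exists N => m n Nm Nn; rewrite -(ler_pM2l al0) (le_trans (bdist _ _ _ _ (Hu m) (Hu n)))//.
    rewrite (le_trans (rnorm_triangle l _ _))// [leRHS]splitr lerD ?HN//.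
    by rewrite rnorm_distC HN.
  exists w => v; apply/eqP; rewrite -subr_eq0; apply/eqP/eq0_normc/eqP.
  rewrite eq_le normc_ge0 andbT; apply/ler_addgt0Pl => e e0; rewrite addr0.
  have K0 : 0 < `|M| * rnorm v + rnorm v + 1.
    by rewrite ltr_wpDl// addr_ge0 ?mulr_ge0 ?rnorm_ge0.
  have [N HN] := yl _ (divr_gt0 e0 K0); have [N' HN'] := uw _ (divr_gt0 e0 K0).
  pose n := maxn N N'.
  have {HN}yn := HN n (leq_maxl _ _); have {HN'}un := HN' n (leq_maxr _ _).
  have -> : b w v - dot l v = dot (y n - l) v - b (u n - w) v.
    by rewrite bB dotBl Hu; ring.
  rewrite (le_trans (le_normcD _ _))// normcN.
  apply: le_trans (lerD (CauchySchwarz_rnorm _ _) (bM _ _)) _.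
  move: yn un; rewrite !ler_pdivlMr// => yn un.
  set p := rnorm (y n - l) in yn *; set q := rnorm (u n - w) in un *.
  set K := _ + 1 in yn un K0.
  have p0 : 0 <= p by exact: rnorm_ge0.
  have q0 : 0 <= q by exact: rnorm_ge0.
  have v0 := rnorm_ge0 v.
  have ple : p <= e / K by rewrite ler_pdivlMr.
  have qle : q <= e / K by rewrite ler_pdivlMr.
  have MM : M * q * rnorm v <= `|M| * (e / K) * rnorm v.
    rewrite ler_wpM2r// (@le_trans _ _ (`|M| * q))//.
      by rewrite ler_wpM2r// ler_norm.
    by rewrite ler_wpM2l.
  apply: le_trans (lerD (ler_wpM2r v0 ple) MM) _.
  have -> : e / K * rnorm v + `|M| * (e / K) * rnorm v = e / K * (K - 1).
    by rewrite /K; ring.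
  rewrite mulrAC ler_pdivrMr// ler_wpM2l ?(ltW e0)//.
  by rewrite gerBl.
move=> y; have [w [u Hu] worth] := orthogonal_projection y Pcl.
have [y' Hy'] := repr (y - w).
have zz : rnorm (y - w) ^+ 2 <= 0.
  rewrite -(ler_pM2l al0) mulr0 (le_trans (bal _))// Hy' -dot_conj.
  by rewrite worth ?Re_conj//; exists (y - w).
have yw : y = w.
  apply/eqP; rewrite -subr_eq0; apply/eqP/rnorm_eq0/eqP.
  by rewrite -sqrf_eq0 eq_le zz sqr_ge0.
by exists u; rewrite yw.
Qed.

End HilbertGeometry.
(** * Coercivity up to finite rank *)

Section SesquilinearForm.
Variables (R : realType) (V : completeNormedModType R[i]).
Variable a : sesquilinear_form V.
Implicit Types (u v w : V) (c : R[i]).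

Lemma formDl u v w : a (u + v) w = a u w + a v w.
Proof. exact: linearDl. Qed.

Lemma formDr u v w : a w (u + v) = a w u + a w v.
Proof. exact: linearDr. Qed.

Lemma formZl c u w : a (c *: u) w = c * a u w.
Proof. exact: linearZl_LR. Qed.

Lemma formZr c u w : a w (c *: u) = Num.conj c * a w u.
Proof. exact: linearZr_LR. Qed.

Lemma continuous_form_bound : continuous_form a ->
  exists2 M : R, 0 < M & forall u v, normc (a u v) <= M * rnorm u * rnorm v.
Proof.
move=> ac; have a00 : a 0 0 = 0 by rewrite [a 0 0]linear0l.
have [d d0 ad] : exists2 d : R, 0 < d &
    forall u v, rnorm u < d -> rnorm v < d -> normc (a u v) <= 1.
  have /cvgrPdist_le/(_ 1 ltr01)/nbhs_normP[/= e e0 He] := ac (0, 0).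
  have eE : e = (complex.Re e)%:C by rewrite RRe_real// gtr0_real.
  exists (complex.Re e); first by rewrite -ltcR -eE.
  move=> u v ud vd; have /He : ball_ Num.norm (0, 0) e (u, v).
    rewrite /ball_ /= sub0r normrN prod_normE/= !normE eE comparable_gt_max.
      by rewrite !ltcR ud vd.
    by rewrite real_comparable// complex_real.
  by rewrite /= a00 sub0r normrN normcE lecR.
(* Both arguments are rescaled to norm [d / 2], inside the ball on which the form is at most [1]. *)
exists (4 / d ^+ 2); first by rewrite divr_gt0// exprn_gt0.
move=> u v; have [->|u0] := eqVneq u 0.
  by rewrite [a 0 v]linear0l normc0 rnorm0 mulr0 mul0r.
have [->|v0] := eqVneq v 0; first by rewrite [a u 0]linear0r normc0 rnorm0 mulr0.
have un : 0 < rnorm u by rewrite rnorm_gt0.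
have vn : 0 < rnorm v by rewrite rnorm_gt0.
pose s := d / 2 / rnorm u; pose t := d / 2 / rnorm v.
have s0 : 0 < s by rewrite !divr_gt0.
have t0 : 0 < t by rewrite !divr_gt0.
have dd : d / 2 < d by rewrite ltr_pdivrMr// ltr_pMr// ltr1n.
have := ad (s%:C *: u) (t%:C *: v).
rewrite !rnormZ formZl formZr !normcM normc_conj !normc_real !gtr0_norm//.
rewrite /s /t !divfK ?gt_eqF// -/s -/t => /(_ dd dd) le1.
rewrite -(ler_pM2l t0) -(ler_pM2l s0) (le_trans le1)//.
rewrite le_eqVlt; apply/orP; left; apply/eqP; rewrite /s /t.
by field; rewrite !gt_eqF.
Qed.

End SesquilinearForm.

Lemma limn_esup_le0 (R : realType) (u : nat -> R) :
  (forall n, u n <= n.+1%:R^-1) -> (limn_esup (fun n => (u n)%:E) <= 0)%E.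
Proof.
move=> un; apply/lee_addgt0Pr => e e0; rewrite add0e.
have [N _ HN] := near_infty_natSinv_lt (PosNum e0).
apply: (@le_trans _ _ (ereal_sup ((fun n => (u n)%:E) @` [set n | (N <= n)%N]))).
  by apply: ereal_inf_lbound; exists [set n | (N <= n)%N] => //; exists N.
apply: ub_ereal_sup => _ [n Nn <-]; rewrite lee_fin (le_trans (un n))//.
exact/ltW/(HN n Nn).
Qed.

Section FiniteRankCoercivity.
Variables (R : realType) (H V : completeNormedModType R[i]).
Variables (dotH : {dot H for Num.conj}) (dotV : {dot V for Num.conj}).
Hypotheses (dotH_norm : dot_induces_norm dotH) (dotV_norm : dot_induces_norm dotV).
Variables (j : {linear V -> H}) (j_inj : injective j) (j_cont : continuous j).

Lemma adjoint_embedding (h : H) :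
  exists z, forall x, dotH (j x) h = dotV x z.
Proof.
have [c c0 jc] := linear_continuous_rbound j_cont.
apply: (riesz_representation dotV_norm (C := c * rnorm h)) => [b x y|x].
  by rewrite linearP dotDl dotZl.
by rewrite (le_trans (CauchySchwarz_rnorm dotH_norm _ _))// mulrAC ler_wpM2r// rnorm_ge0.
Qed.

(* The vectors [x] with [<u n, x> -> 0] form a closed subspace [W] containing
   all [j* j (u m)].  If [y] is orthogonal to [W], then [j* j y] lies in [W], hence
   [|j y|^2 = <y, j* j y> = 0]. *)
Lemma weakly_to0_pairwise (u : nat -> V) (K : R) :
  (forall n, rnorm (u n) <= K) ->
  (forall m e, 0 < e -> exists N, forall n, (N <= n)%N ->
    normc (dotH (j (u n)) (j (u m))) <= e) ->
  weakly_to0 u.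
Proof.
move=> uK upair.
pose W x := forall e : R, 0 < e -> exists N, forall n, (N <= n)%N -> normc (dotV (u n) x) <= e.
have K0 : 0 <= K by rewrite (le_trans (rnorm_ge0 (u 0%N))).
have Wcl : closed_subspace W.
  split=> [e e0|c x y Wx Wy e e0|v l Wv vl e e0].
  - by exists 0%N => n _; rewrite [dotV _ 0]linear0r normc0 ltW.
  - have c1 : 0 < normc c + 1 by rewrite ltr_wpDl ?normc_ge0.
    have e2 : 0 < e / 2 / (normc c + 1) by rewrite !divr_gt0.
    have [N HN] := Wx _ e2; have [N' HN'] := Wy _ (divr_gt0 e0 (ltr0Sn R 1)).
    exists (maxn N N') => n; rewrite geq_max => /andP[/HN Nn /HN' N'n].
    rewrite dotDr dotZr (le_trans (le_normcD _ _))// [leRHS]splitr lerD//.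
    rewrite normcM normc_conj.
    have cc : normc c <= normc c + 1 by rewrite lerDl.
    apply: le_trans (ler_pM (normc_ge0 _) (normc_ge0 _) cc Nn) _.
    by rewrite mulrC divfK// gt_eqF.
  - have K1 : 0 < K + 1 by rewrite ltr_wpDl.
    have [N /(_ _ (leqnn N)) HN] := vl _ (divr_gt0 (divr_gt0 e0 (ltr0Sn R 1)) K1).
    have [N' HN'] := Wv N _ (divr_gt0 e0 (ltr0Sn R 1)).
    exists N' => n /HN' N'n.
    have -> : l = v N - (v N - l) by rewrite opprB addrC subrK.
    rewrite dotBr (le_trans (le_normcD _ _))// normcN [leRHS]splitr lerD//.
    apply: le_trans (CauchySchwarz_rnorm dotV_norm _ _) _.
    have uK1 : rnorm (u n) <= K + 1 by rewrite (le_trans (uK n))// lerDl.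
    apply: le_trans (ler_pM (rnorm_ge0 _) (rnorm_ge0 _) uK1 HN) _.
    by rewrite mulrC divfK// gt_eqF.
have Wall y : W y.
  have [w Ww worth] := orthogonal_projection dotV_norm y Wcl.
  suff /eqP : y - w = 0 by rewrite subr_eq0 => /eqP ->.
  set z := y - w in worth *.
  have zu m : dotH (j z) (j (u m)) = 0.
    have [zm Hzm] := adjoint_embedding (j (u m)).
    rewrite Hzm worth// => e e0; have [N HN] := upair m _ e0.
    by exists N => n /HN; rewrite Hzm.
  have [z' Hz'] := adjoint_embedding (j z).
  have Wz' : W z'.
    move=> e e0; exists 0%N => n _.
    by rewrite -Hz' -dot_conj zu rmorph0 normc0 ltW.
  have := worth _ Wz'; rewrite -Hz' (dot_sqr dotH_norm) => /(congr1 (@complex.Re R)) /= /eqP.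
  rewrite sqrf_eq0 => /eqP/rnorm_eq0 jz0.
  by apply: j_inj; rewrite jz0 linear0.
move=> f fc.
have [y Hy] : exists y, forall x, f x = dotV x y.
  have /linear_boundedP[b [br fb]] := continuous_linear_bounded 0 (fc (0 : V)).
  have b1 : b < `|b| + 1 by rewrite (le_lt_trans (real_ler_norm br))// ltrDl.
  have bE : `|b| + 1 = (normc b + 1)%:C by rewrite normcE rmorphD.
  apply: (riesz_representation dotV_norm (C := normc b + 1)) => [c x v|x].
    by rewrite linearP.
  by have := fb _ b1 x; rewrite bE !normE normcE -rmorphM lecR.
apply/cvgrPdist_le => e e0.
have eE : e = (complex.Re e)%:C by rewrite RRe_real// gtr0_real.
have e0' : 0 < complex.Re e by rewrite -ltcR -eE.
have [N HN] := Wall y _ e0'; exists N => // n /HN.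
by rewrite /= sub0r normrN normcE Hy eE lecR.
Qed.

Variable a : sesquilinear_form V.
Hypothesis a_cont : continuous_form a.
Hypothesis a_coercive : essentially_positive_coercive a.

(* Otherwise a sequence of unit vectors [u n] would be weakly null with
   [limsup Re a (u n) (u n) <= 0]: choose [u n] as a counterexample for the
   family of the images of the previous vectors. *)
Lemma coercive_up_to_finite_rank : exists (l : seq H) (c al : R),
  [/\ 0 <= c, 0 < al & forall u,
    al * rnorm u ^+ 2 <= complex.Re (a u u) +
      c * \sum_(h <- l) normc (dotH (j u) h) ^+ 2].
Proof.
apply: contrapT => nex.
have [M M0 aM] := continuous_form_bound a_cont.
(* The weight [size l + 1] stands for [c] and its inverse for [al], so both constants degenerate as
   the family grows. *)
have pick l : exists u, rnorm u = 1 /\ complex.Re (a u u) +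
    (size l).+1%:R * \sum_(h <- l) normc (dotH (j u) h) ^+ 2 < (size l).+1%:R^-1.
  apply: contrapT => npick; apply: nex.
  exists l, (size l).+1%:R, (size l).+1%:R^-1; split => // u.
  have [->|u0] := eqVneq u 0.
    rewrite rnorm0 expr0n mulr0 [a 0 0]linear0l add0r mulr_ge0//.
    by apply: sumr_ge0 => h _; rewrite sqr_ge0.
  rewrite leNgt; apply/negP => ult; apply: npick.
  have un : 0 < rnorm u by rewrite rnorm_gt0.
  pose s := (rnorm u)^-1; have s0 : 0 < s by rewrite invr_gt0.
  have s20 : 0 < s ^+ 2 by rewrite exprn_gt0.
  exists (s%:C *: u); split.
    by rewrite rnormZ normc_real gtr0_norm// mulVf// gt_eqF.
  have -> : complex.Re (a (s%:C *: u) (s%:C *: u)) = s ^+ 2 * complex.Re (a u u).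
    rewrite formZl formZr; case: (a u u) => x y /=; ring.
  under eq_bigr do rewrite linearZ dotZl normcM normc_real gtr0_norm// exprMn.
  rewrite -mulr_sumr mulrCA -mulrDr; move: ult; rewrite -(ltr_pM2l s20).
  by rewrite mulrCA -exprMn mulVf ?gt_eqF// expr1n mulr1.
have [g Hg] := choice pick.
pose L n := iter n (fun l => j (g l) :: l) [::].
pose u n := g (L n).
have sizeL n : size (L n) = n by elim: n => //= n ->.
have memL m n : (m < n)%N -> j (u m) \in L n.
  elim: n => // n IH; rewrite ltnS leq_eqVlt => /orP[/eqP->|/IH mn].
    by rewrite /= mem_head.
  by rewrite /= inE mn orbT.
have u1 n : rnorm (u n) = 1 by case: (Hg (L n)).
have ua n : complex.Re (a (u n) (u n)) +
    n.+1%:R * \sum_(h <- L n) normc (dotH (j (u n)) h) ^+ 2 < n.+1%:R^-1.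
  by case: (Hg (L n)); rewrite sizeL.
have sum0 n : 0 <= \sum_(h <- L n) normc (dotH (j (u n)) h) ^+ 2.
  by apply: sumr_ge0 => h _; rewrite sqr_ge0.
(* On unit vectors [Re a >= - M], so the weight [n + 1] leaves at most [(M + 1) / (n + 1)] for the
   whole sum, one summand of which belongs to [j (u m)]. *)
have pair m n : (m < n)%N ->
    normc (dotH (j (u n)) (j (u m))) ^+ 2 <= (M + 1) / n.+1%:R.
  move=> mn; rewrite ler_pdivlMr// mulrC.
  have le1 : normc (dotH (j (u n)) (j (u m))) ^+ 2 <=
      \sum_(h <- L n) normc (dotH (j (u n)) h) ^+ 2.
    rewrite (big_rem _ (memL _ _ mn))/= lerDl.
    by apply: sumr_ge0 => h _; rewrite sqr_ge0.
  rewrite (le_trans (ler_wpM2l _ le1))//.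
  have := ua n; rewrite -ltrBrDl => /ltW/le_trans; apply.
  rewrite addrC lerD//.
    rewrite (le_trans (ler_norm _))// normrN (le_trans (ger_Re_normc _))//.
    by rewrite (le_trans (aM _ _))// !u1 !mulr1.
  by rewrite invf_le1// ler1n.
have /a_coercive : weakly_to0 u.
  apply: (@weakly_to0_pairwise _ 1) => [n|m e e0]; first by rewrite u1.
  have d0 : 0 < e ^+ 2 / (M + 1) by rewrite divr_gt0 ?exprn_gt0// addr_gt0.
  have [N _ HN] := near_infty_natSinv_lt (PosNum d0).
  exists (maxn N m.+1) => n; rewrite geq_max => /andP[/HN/ltW /= Nn mn].
  rewrite -ler_sqr ?nnegrE ?normc_ge0 ?(ltW e0)// (le_trans (pair _ _ mn))//.
  by rewrite -ler_pdivlMl ?addr_gt0// mulrC.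
have usup : (limn_esup (fun n => (complex.Re (a (u n) (u n)))%:E) <= 0)%E.
  apply: limn_esup_le0 => n; apply: le_trans (ltW (ua n)).
  by rewrite lerDl mulr_ge0.
move=> /(_ usup)/cvgrPdist_le/(_ 2^-1).
rewrite invr_gt0 ltr0n => /(_ isT)[N _ /(_ N (leqnn N))] /=.
rewrite u1 sub0r normrN1 => h.
by have := le_trans h (ltW (_ : 2^-1 < 1)); rewrite leNgt invf_lt1 ?ltr1n//; lra.
Qed.

End FiniteRankCoercivity.
(** * The ring of linear operators *)

(** Linear maps without continuity, so that composition makes them a ring and resolvent identities
    become ring identities. Bounds are carried separately by [bd]. *)
Record endo (K : comNzRingType) (H : lmodType K) :=
  Endo { endo_fun :> H -> H; endo_linear : linear endo_fun }.

Section EndoRing.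
Variables (K : comNzRingType) (H : lmodType K).
Implicit Types f g h : endo H.

HB.instance Definition _ f := GRing.isLinear.Build K H H *:%R (endo_fun f) (endo_linear f).

Lemma endoP f g : (forall x, f x = g x) -> f = g.
Proof.
case: f g => [f fl] [g gl] /= /funext fg; subst g.
by congr Endo; exact: Prop_irrelevance.
Qed.

HB.instance Definition _ := gen_eqMixin (endo H).
HB.instance Definition _ := gen_choiceMixin (endo H).

Fact endo0_linear : linear (fun _ : H => 0 : H).
Proof. by move=> c x y; rewrite scaler0 addr0. Qed.

Fact endoN_linear f : linear (fun x => - f x).
Proof. by move=> c x y; rewrite linearP opprD scalerN. Qed.

Fact endoD_linear f g : linear (fun x => f x + g x).
Proof. by move=> c x y; rewrite !linearP scalerDr addrACA. Qed.

Fact endo1_linear : linear (fun x : H => x).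
Proof. by []. Qed.

Fact endoM_linear f g : linear (fun x => f (g x)).
Proof. by move=> c x y; rewrite !linearP. Qed.

Fact endoZ_linear c f : linear (fun x => c *: f x).
Proof. by move=> b x y; rewrite linearP scalerDr !scalerA mulrC. Qed.

Definition endo0 := Endo endo0_linear.
Definition endoN f := Endo (endoN_linear f).
Definition endoD f g := Endo (endoD_linear f g).
Definition endo1 := Endo endo1_linear.
Definition endoM f g := Endo (endoM_linear f g).
Definition endoZ c f := Endo (endoZ_linear c f).

Fact endo_addA : associative endoD.
Proof. by move=> f g h; apply: endoP => x /=; rewrite addrA. Qed.
Fact endo_addC : commutative endoD.
Proof. by move=> f g; apply: endoP => x /=; rewrite addrC. Qed.
Fact endo_add0 : left_id endo0 endoD.
Proof. by move=> f; apply: endoP => x /=; rewrite add0r. Qed.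
Fact endo_addN : left_inverse endo0 endoN endoD.
Proof. by move=> f; apply: endoP => x /=; rewrite addNr. Qed.

HB.instance Definition _ :=
  GRing.isZmodule.Build (endo H) endo_addA endo_addC endo_add0 endo_addN.

Fact endo_mulA : associative endoM.
Proof. by move=> f g h; apply: endoP. Qed.
Fact endo_mul1 : left_id endo1 endoM.
Proof. by move=> f; apply: endoP. Qed.
Fact endo_mulr1 : right_id endo1 endoM.
Proof. by move=> f; apply: endoP. Qed.
Fact endo_mulDl : left_distributive endoM endoD.
Proof. by move=> f g h; apply: endoP. Qed.
Fact endo_mulDr : right_distributive endoM endoD.
Proof. by move=> f g h; apply: endoP => x /=; rewrite linearD. Qed.

(** [H] may be the zero space, in which case [1 = 0]. *)
HB.instance Definition _ := GRing.Zmodule_isPzRing.Build (endo H)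
  endo_mulA endo_mul1 endo_mulr1 endo_mulDl endo_mulDr.

Fact endo_scaleA b c f : endoZ b (endoZ c f) = endoZ (b * c) f.
Proof. by apply: endoP => x /=; rewrite scalerA. Qed.
Fact endo_scale1 : left_id 1 endoZ.
Proof. by move=> f; apply: endoP => x /=; rewrite scale1r. Qed.
Fact endo_scaleDr : right_distributive endoZ +%R.
Proof. by move=> c f g; apply: endoP => x /=; rewrite scalerDr. Qed.
Fact endo_scaleDl f : {morph endoZ^~ f : b c / b + c}.
Proof. by move=> b c; apply: endoP => x /=; rewrite scalerDl. Qed.

HB.instance Definition _ := GRing.Zmodule_isLmodule.Build K (endo H)
  endo_scaleA endo_scale1 endo_scaleDr endo_scaleDl.

Lemma endo_scaleAl c f g : c *: (f * g) = (c *: f) * g.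
Proof. by apply: endoP. Qed.

Lemma endo_scaleAr c f g : c *: (f * g) = f * (c *: g).
Proof. by apply: endoP => x; rewrite /= /endoZ/= /endoM/= linearZ. Qed.

End EndoRing.

Section OperatorBounds.
Variables (R : realType) (H : completeNormedModType R[i]).
Implicit Types (S T U : endo H) (r s : R) (c : R[i]).

(** A relation instead of a number: the supremum [op_norm] is informative only for bounded
    operators, whereas bounds add and multiply directly. *)
Definition bd T r := forall x, rnorm (T x) <= r * rnorm x.

Lemma bd_le T r s : r <= s -> bd T r -> bd T s.
Proof.
by move=> rs Tr x; rewrite (le_trans (Tr x))// ler_wpM2r// rnorm_ge0.
Qed.

Lemma bd0 : bd 0 0.
Proof. by move=> x; rewrite rnorm0 mul0r. Qed.

Lemma bd1 : bd 1 1.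
Proof. by move=> x; rewrite mul1r. Qed.

Lemma bdD S T r s : bd S r -> bd T s -> bd (S + T) (r + s).
Proof. by move=> Sr Ts x; rewrite mulrDl (le_trans (rnormD _ _))// lerD. Qed.

Lemma bdN T r : bd T r -> bd (- T) r.
Proof. by move=> Tr x; rewrite rnormN. Qed.

Lemma bdB S T r s : bd S r -> bd T s -> bd (S - T) (r + s).
Proof. by move=> Sr /bdN; exact: bdD. Qed.

Lemma bd_distC S T r : bd (S - T) r -> bd (T - S) r.
Proof. by move=> /bdN; rewrite opprB. Qed.

Lemma bd_triangle U S T r s : bd (S - U) r -> bd (U - T) s -> bd (S - T) (r + s).
Proof. by move=> h k; have := bdD h k; rewrite addrA subrK. Qed.

Lemma bdM S T r s : 0 <= r -> bd S r -> bd T s -> bd (S * T) (r * s).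
Proof. by move=> r0 Sr Ts x; rewrite (le_trans (Sr _))// -mulrA ler_wpM2l. Qed.

Lemma bdMl S T r : bd S r -> 0 <= r -> bd T 1 -> bd (S * T) r.
Proof. by move=> Sr r0 T1; rewrite -[r]mulr1; exact: bdM. Qed.

Lemma bdMr S T r : bd S 1 -> bd T r -> bd (S * T) r.
Proof. by move=> S1 Tr; rewrite -[r]mul1r; exact: bdM. Qed.

Lemma bdZ c T r : bd T r -> bd (c *: T) (normc c * r).
Proof. by move=> Tr x; rewrite rnormZ -mulrA ler_wpM2l ?normc_ge0. Qed.

Lemma bdX T n : bd T 1 -> bd (T ^+ n) 1.
Proof.
move=> T1; elim: n => [|n IH]; first exact: bd1.
by rewrite exprS; exact: bdMr.
Qed.

Lemma bd_sum n (T : 'I_n -> endo H) r :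
  (forall i, bd (T i) r) -> bd (\sum_i T i) (n%:R * r).
Proof.
move=> Tr; rewrite -[n in n%:R]card_ord mulr_natl -sumr_const.
by elim/big_ind2: _ => [|x1 x2 y1 y2 h1 h2|i _]; [exact: bd0|exact: bdD|exact: Tr].
Qed.

Lemma bd_eps S T : (forall e, 0 < e -> bd (S - T) e) -> S = T.
Proof.
move=> h; apply: endoP => x; apply: le_rnorm_eps => e e0.
have x1 : 0 < rnorm x + 1 by rewrite ltr_wpDl ?rnorm_ge0.
have := h _ (divr_gt0 e0 x1) x; move/le_trans; apply.
rewrite mulrAC ler_pdivrMr// ler_wpM2l ?ltW//.
by rewrite ltrDl.
Qed.

(** The limit is specified by the bounds that pass to it, so that explicit rates of convergence are
    kept. *)
Lemma endo_complete (T : nat -> endo H) :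
  (forall e, 0 < e -> exists N, forall m n, (N <= m)%N -> (N <= n)%N ->
    bd (T m - T n) e) ->
  exists L, forall n r, (exists N, forall m, (N <= m)%N -> bd (T n - T m) r) ->
    bd (T n - L) r.
Proof.
move=> Tc; have cvx x : exists l, rcvg (fun n => T n x) l.
  apply: rcauchy_cvg => e e0.
  have x1 : 0 < rnorm x + 1 by rewrite ltr_wpDl ?rnorm_ge0.
  have [N HN] := Tc _ (divr_gt0 e0 x1); exists N => m n Nm Nn.
  rewrite (le_trans (HN _ _ Nm Nn x))// mulrAC ler_pdivrMr// ler_wpM2l ?ltW//.
  by rewrite ltrDl.
have [L HL] := choice cvx.
have Llin : linear L.
  move=> c x y; apply: rcvg_unique (HL _) _ => e e0.
  have [N HN] := rcvgD (rcvgZ c (HL x)) (HL y) e0.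
  by exists N => n /HN; rewrite /= endo_linear.
exists (Endo Llin) => n r [N HN] x.
rewrite [leLHS]rnorm_distC.
apply: (@rcvg_rnorm_le _ _ (fun m => T m x)); first exact: HL.
by exists N => m /HN; rewrite rnorm_distC => /(_ x).
Qed.

End OperatorBounds.
(** * Euler approximations of holomorphic semigroups *)

Section Cone.
Variables (R : realType) (m : R).
Hypothesis m0 : 0 < m.
Implicit Types (z w : R[i]) (t : R).

(** The sector [|arg z| <= arctan m] together with its vertex [0], in a form suited to linear
    arithmetic. *)
Definition cone z : Prop := `|complex.Im z| <= m * complex.Re z.

Lemma cone0 : cone 0. Proof. by rewrite /cone normr0 mulr0. Qed.

Lemma cone_Re_ge0 z : cone z -> 0 <= complex.Re z.
Proof. by rewrite /cone => h; rewrite -(pmulr_rge0 _ m0) (le_trans _ h). Qed.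

Lemma coneD z w : cone z -> cone w -> cone (z + w).
Proof.
by move=> cz cw; rewrite /cone ReD ImD mulrDr (le_trans (ler_normD _ _))// lerD.
Qed.

Lemma coneZ t z : 0 <= t -> cone z -> cone (t%:C * z).
Proof.
move=> t0; rewrite /cone Re_realM Im_mul /= mul0r addr0 normrM ger0_norm// mulrCA.
exact: ler_wpM2l.
Qed.

Lemma cone_real t : 0 <= t -> cone t%:C.
Proof. by move=> t0; rewrite /cone /= normr0 mulr_ge0// ltW. Qed.

Lemma normc_cone z : cone z -> normc z <= (1 + m) * complex.Re z.
Proof.
move=> cz; have z0 := cone_Re_ge0 cz.
rewrite -ler_sqr ?nnegrE ?normc_ge0 ?mulr_ge0 ?addr_ge0 ?(ltW m0)//.
have : `|complex.Im z| ^+ 2 <= (m * complex.Re z) ^+ 2.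
  by rewrite ler_sqr ?nnegrE ?normr_ge0// mulr_ge0// ltW.
rewrite normc_sqr real_normK ?num_real// => le1.
apply: le_trans (lerD (lexx _) le1) _.
rewrite !exprMn -{1}[complex.Re z ^+ 2]mul1r -mulrDl ler_wpM2r ?sqr_ge0//.
by rewrite sqrrD expr1n mul1r lerD2r lerDl mulrn_wge0// ltW.
Qed.

Lemma cone_addr_eq0 z w : cone z -> cone w -> z + w = 0 -> z = 0.
Proof.
move=> cz cw zw0; have z0 := cone_Re_ge0 cz; have w0 := cone_Re_ge0 cw.
have := congr1 (@complex.Re R) zw0; rewrite ReD /= => /eqP.
rewrite paddr_eq0// => /andP[/eqP zr _]; move: (normc_cone cz).
rewrite zr mulr0 => zn; apply: eq0_normc; apply/eqP.
by rewrite eq_le zn normc_ge0.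
Qed.

End Cone.

(** For two runs of factors that share about [n] powers: the longer one has at least about [n / 2]
    of them, which costs a factor [4]. *)
Lemma ler_inv_sqr (R : realType) (n k : nat) : (0 < n)%N -> (n <= 2 * k)%N ->
  (k%:R ^+ 2)^-1 <= 4 / n%:R ^+ 2 :> R.
Proof.
move=> n0 nk; have k0 : (0 < k)%N by case: k nk => //; rewrite muln0 leqNgt n0.
have n0' : 0 < n%:R :> R by rewrite ltr0n.
have k0' : 0 < k%:R :> R by rewrite ltr0n.
rewrite ler_pdivlMr ?exprn_gt0// mulrC ler_pdivrMr ?exprn_gt0//.
rewrite (_ : 4 * k%:R ^+ 2 = (2 * k%:R) ^+ 2); last by ring.
by rewrite ler_sqr ?nnegrE ?mulr_ge0 ?ler0n// -natrM ler_nat.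
Qed.

Section EulerScheme.
Variables (R : realType) (H : completeNormedModType R[i]) (m C : R).
Hypotheses (m0 : 0 < m) (C0 : 0 <= C).
Variable V : R[i] -> endo H.

(* [V z] plays the role of [(1 + z A)^-1]. *)
Definition resolvent_family : Prop :=
  [/\ V 0 = 1, forall z, cone m z -> bd (V z) 1,
      forall z w, cone m z -> cone m w ->
        w *: V w - z *: V z = (w - z) *: (V z * V w)
    & forall z k, cone m z -> bd ((1 - V z) * V z ^+ k) (C / k.+1%:R)].

Hypothesis HV : resolvent_family.
Implicit Types (z w p q : R[i]) (n k : nat).
Local Notation cone := (cone m).
Local Notation D z := (1 - V z).

Let V0 : V 0 = 1. Proof. by case: HV. Qed.
Let V1 z : cone z -> bd (V z) 1. Proof. by case: HV => _ h _ _; exact: h. Qed.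
Let VX z n : cone z -> bd (V z ^+ n) 1. Proof. by move=> /V1/bdX. Qed.

(** Exchanging [z] and [w] changes the sign of both sides of the resolvent identity and otherwise
    only the order of the product. *)
Lemma resolvent_comm z w : cone z -> cone w -> V z * V w = V w * V z.
Proof.
move=> cz cw; have [->//|zw] := eqVneq z w.
have [_ _ RI _] := HV; have := RI _ _ cw cz.
rewrite -opprB (RI z w)// -scaleNr opprB => /eqP.
rewrite -subr_eq0 -scalerBr => /eqP/(congr1 ( *:%R (z - w)^-1)).
rewrite scalerA mulVf ?subr_eq0// scale1r scaler0 => /eqP.
by rewrite subr_eq0 => /eqP.
Qed.

Lemma resolvent_commD z w : cone z -> cone w -> GRing.comm (D z) (V w).
Proof.
by move=> cz cw; rewrite /GRing.comm mulrBl mulrBr mul1r mulr1 resolvent_comm.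
Qed.

(** Both sides are [z w A V(z) V(w)], since [1 - V(z) = z A V(z)]. This moves a factor [D] from one
    parameter to another. *)
Lemma resolvent_swap z w : cone z -> cone w ->
  w *: (D z * V w) = z *: (D w * V z).
Proof.
move=> cz cw; have [_ _ RI _] := HV; have := RI _ _ cz cw.
rewrite !mulrBl !mul1r !scalerBr scalerBl (resolvent_comm cw cz).
move/eqP; rewrite subr_eq => /eqP ->.
by rewrite addrAC [X in X + _]addrAC subrr add0r addrC.
Qed.

(** Each of the two factors [D z] takes half of the power, which turns the Ritt decay [1/k] into
    [1/k^2]. *)
Lemma bd_D2 z k : cone z -> bd (D z ^+ 2 * V z ^+ k) (4 * C ^+ 2 / k.+1%:R ^+ 2).
Proof.
move=> cz; pose a := k./2; pose b := uphalf k.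
have kab : k = (a + b)%N by rewrite /a /b addnC uphalf_half -addnA addnn odd_double_half.
have -> : D z ^+ 2 * V z ^+ k = (D z * V z ^+ a) * (D z * V z ^+ b).
  rewrite {1}kab exprD expr2 !mulrA; congr (_ * _).
  rewrite -!mulrA; congr (_ * _).
  exact/GRing.commrX/resolvent_commD.
have [_ _ _ ritt] := HV.
have := bdM (divr_ge0 C0 (ler0n _ a.+1)) (ritt z a cz) (ritt z b cz).
apply: bd_le; rewrite mulrACA -expr2 [in leRHS]mulrAC mulrC.
rewrite ler_wpM2r ?sqr_ge0// -invfM.
have ab : a.+1%:R ^+ 2 <= a.+1%:R * b.+1%:R :> R.
  by rewrite expr2 ler_wpM2l// ler_nat ltnS /a /b uphalf_half leq_addl.
apply: (@le_trans _ _ (a.+1%:R ^+ 2)^-1).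
  by rewrite lef_pV2// posrE ?mulr_gt0 ?exprn_gt0.
apply: ler_inv_sqr => //.
by rewrite /a mul2n doubleS -[X in (X < _)%N]odd_double_half; case: (odd k).
Qed.

Lemma bd_DD_prod p q k : cone p -> cone q ->
  bd (D p * D q * (V p * V q) ^+ k) (C ^+ 2 / k.+1%:R ^+ 2).
Proof.
move=> cp cq; rewrite exprMn_comm; last exact: resolvent_comm.
have -> : D p * D q * (V p ^+ k * V q ^+ k) = (D p * V p ^+ k) * (D q * V q ^+ k).
  rewrite !mulrA; congr (_ * _); rewrite -!mulrA; congr (_ * _).
  exact/GRing.commrX/resolvent_commD.
have [_ _ _ ritt] := HV.
have := bdM (divr_ge0 C0 (ler0n _ k.+1)) (ritt p k cp) (ritt q k cq).
by rewrite mulrACA -invfM -!expr2.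
Qed.

(** By [resolvent_swap], [D p V s = (p/s) D s V p] with [s = p + q]. Moving both factors onto [s]
    uses up two powers of [V s] and produces the scalar [p q / s^2], which the hypothesis on [p q]
    keeps in the unit disc. *)
Lemma bd_DD_sum p q k : cone p -> cone q ->
  normc (p * q) <= normc (p + q) ^+ 2 ->
  bd (D p * D q * V (p + q) ^+ k.+2) (4 * C ^+ 2 / k.+1%:R ^+ 2).
Proof.
move=> cp cq pq; have cs := coneD cp cq; set s := p + q in pq cs *.
have K0 : 0 <= 4 * C ^+ 2 / k.+1%:R ^+ 2 by rewrite divr_ge0 ?mulr_ge0 ?sqr_ge0.
have [s0|s0] := eqVneq s 0.
  have p0 := cone_addr_eq0 m0 cp cq s0.
  by rewrite p0 V0 subrr !mul0r; exact: bd_le K0 (@bd0 _ _).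
have DV r : cone r -> D r * V s = (r / s) *: (D s * V r).
  move=> cr; rewrite mulrC -scalerA -resolvent_swap// scalerA mulVf//.
  by rewrite scale1r.
have -> : D p * D q * V s ^+ k.+2 =
    (p * q / s ^+ 2) *: (D s ^+ 2 * V s ^+ k * (V p * V q)).
  have -> : D p * D q * V s ^+ k.+2 = (D p * V s) * (D q * V s) * V s ^+ k.
    rewrite !exprS !mulrA; congr (_ * _ * _); rewrite -!mulrA; congr (_ * _).
    exact: resolvent_commD.
  rewrite !DV// -endo_scaleAr -!endo_scaleAl scalerA.
  congr (_ *: _); first by field.
  have comp : V p * D s = D s * V p by rewrite resolvent_commD.
  have comk r : cone r -> V r * V s ^+ k = V s ^+ k * V r.
    by move=> cr; apply: GRing.commrX; exact: resolvent_comm.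
  rewrite expr2 -!mulrA; congr (_ * _); rewrite !mulrA comp.
  by rewrite -!mulrA; congr (_ * _); rewrite comk// !mulrA comk.
have c0 : normc (p * q / s ^+ 2) <= 1.
  rewrite normcM normcV normcX ler_pdivrMr ?mul1r//.
  by rewrite exprn_gt0// normc_gt0.
apply: bd_le (bdZ _ (bdMl (bd_D2 k cs) K0 (bdMr (V1 cp) (V1 cq)))).
by rewrite ler_piMl.
Qed.

(** Formally [(1 + p A)(1 + q A) - (1 + (p + q) A) = p q A^2], multiplied by the three resolvents.
    The error is of second order in [D], which is what makes the Euler scheme converge in norm. *)
Lemma resolvent_prod_sub p q : cone p -> cone q ->
  V p * V q - V (p + q) = - (D p * D q * V (p + q)).
Proof.
move=> cp cq; have cs := coneD cp cq; set s := p + q in cs *.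
have [s0|s0] := eqVneq s 0.
  have p0 := cone_addr_eq0 m0 cp cq s0.
  have q0 : q = 0 by move: s0; rewrite /s p0 add0r.
  by rewrite s0 q0 p0 V0 subrr !mul0r oppr0 mulr1 subrr.
have [_ _ RI _] := HV.
have RIp : q *: (V p * V s) = s *: V s - p *: V p.
  by rewrite RI// /s addrAC subrr add0r.
have RIq : p *: (V q * V s) = s *: V s - q *: V q.
  by rewrite RI// /s addrK.
have key : V p * V q * V s = (V p + V q) * V s - V p * V q.
  apply: (can_inj (scalerK s0)).
  transitivity (V p * (p *: (V q * V s)) + V q * (q *: (V p * V s))).
    rewrite -!endo_scaleAr !mulrA (resolvent_comm cq cp) -scalerDl.
    by rewrite /s.
  rewrite RIp RIq !mulrBr -!endo_scaleAr (resolvent_comm cq cp).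
  rewrite addrACA -opprD -scalerDl (addrC q) -/s.
  by rewrite scalerBr mulrDl scalerDr.
have -> : D p * D q * V s = V s - (V p + V q) * V s + V p * V q * V s.
  rewrite mulrBl mul1r mulrBr mulr1 !mulrBl mul1r mulrDl.
  by rewrite opprB (addrC (V p * V s)) opprD !addrA addrAC.
by rewrite key addrA subrK opprB.
Qed.

(** Telescoping gives [n] terms, each of size [1/n^2]: the two factors [D] are accompanied by powers
    of [V p V q] and of [V (p + q)], and one of these powers is at least about [n / 2]. *)
Lemma bd_resolvent_prodX p q n : cone p -> cone q ->
  normc (p * q) <= normc (p + q) ^+ 2 -> (0 < n)%N ->
  bd ((V p * V q) ^+ n - V (p + q) ^+ n) (16 * C ^+ 2 / n%:R).
Proof.
move=> cp cq pq n0; have cs := coneD cp cq.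
set s := p + q in pq cs *; set W := V p * V q.
have W1 : bd W 1 by rewrite /W; apply: bdMr; exact: V1.
have WU : GRing.comm W (V s).
  rewrite /GRing.comm /W -mulrA (resolvent_comm cq cs) mulrA.
  by rewrite (resolvent_comm cp cs) !mulrA.
have n0' : 0 < n%:R :> R by rewrite ltr0n.
rewrite (subrXX_comm _ WU) resolvent_prod_sub// -/s mulNr.
rewrite big_distrr /=; apply: bdN.
have -> : 16 * C ^+ 2 / n%:R = n%:R * (16 * C ^+ 2 / n%:R ^+ 2).
  by field; rewrite gt_eqF.
apply: bd_sum => i; set a := (n.-1 - i)%N.
have ina : n = (a + i).+1 by rewrite /a subnK ?prednK// -ltnS prednK.
have sq0 k : 0 <= C ^+ 2 / k.+1%:R ^+ 2 by rewrite divr_ge0 ?sqr_ge0.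
have [na|na] := leqP n (2 * a.+1).
  have -> : D p * D q * V s * (W ^+ a * V s ^+ i) = D p * D q * W ^+ a * V s ^+ i.+1.
    rewrite -!mulrA exprS; congr (_ * (_ * _)); rewrite !mulrA; congr (_ * _).
    exact/GRing.commrX/GRing.commr_sym.
  apply: bd_le (bdMl (bd_DD_prod a cp cq) _ (VX i.+1 cs)) => //.
  have := ler_inv_sqr R n0 na; move/(ler_wpM2l (sqr_ge0 C))/le_trans; apply.
  rewrite mulrCA mulrA ler_wpM2r ?invr_ge0 ?sqr_ge0// ler_wpM2r ?sqr_ge0//.
  by rewrite ler_nat.
(* For index [0] the exponent [a] is [n - 1], which belongs to the case just treated. Otherwise the
   single [V s] of [resolvent_prod_sub] joins [V s ^+ i.+1] to form the power [i.+2] of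
   [bd_DD_sum]. *)
case: i @a ina na => -[|i] /= lti.
  by move: (n.-1 - 0)%N => a ina na; exfalso; lia.
set a := (n.-1 - i.+1)%N => ina na.
have -> : D p * D q * V s * (W ^+ a * V s ^+ i.+1) = D p * D q * V s ^+ i.+2 * W ^+ a.
  rewrite [V s ^+ i.+2]exprS -!mulrA; congr (_ * (_ * (_ * _))).
  exact/GRing.commrX/GRing.commr_sym/GRing.commrX.
apply: bd_le (bdMl (bd_DD_sum i cp cq pq) _ (bdX a W1)).
  have ni : (n <= 2 * i.+1)%N by lia.
  have := ler_inv_sqr R n0 ni; rewrite -/s => /(ler_wpM2l (_ : 0 <= 4 * C ^+ 2)).
  rewrite mulr_ge0 ?sqr_ge0// => /(_ isT)/le_trans; apply.
  rewrite [leLHS]mulrA ler_wpM2r ?invr_ge0 ?sqr_ge0//.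
  by rewrite le_eqVlt; apply/orP; left; apply/eqP; ring.
by rewrite -mulrA mulr_ge0.
Qed.

End EulerScheme.

(** * Increments of resolvent powers and dyadic Euler approximations *)

Section EulerLimit.
Variables (R : realType) (H : completeNormedModType R[i]) (m C : R).
Hypotheses (m0 : 0 < m) (C0 : 0 <= C).
Variable V : R[i] -> endo H.
Hypothesis HV : resolvent_family m C V.
Implicit Types (z w p q : R[i]) (n k : nat) (s t : R).
Local Notation cone := (cone m).
Local Notation D z := (1 - V z).

Let V1 z : cone z -> bd (V z) 1. Proof. by case: HV => _ h _ _; exact: h. Qed.
Let VX z n : cone z -> bd (V z ^+ n) 1. Proof. by move=> /V1/bdX. Qed.

(** Formally [V(q) - V(p) = (p - q) A V(p) V(q)], where [A V(p) = D p / p]. *)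
Lemma resolvent_sub p q : cone p -> cone q -> p != 0 ->
  V q - V p = ((p - q) / p) *: (D p * V q).
Proof.
move=> cp cq p0; apply: (can_inj (scalerK p0)).
rewrite scalerA mulrCA mulfV// mulr1 scalerBr.
have [_ _ RI _] := HV; have := RI _ _ cp cq.
move/eqP; rewrite subr_eq => /eqP qq.
have -> : p *: V q = (p - q) *: V q + q *: V q by rewrite -scalerDl subrK.
rewrite qq addrA addrK mulrBl mul1r scalerBr.
by congr (_ + _); rewrite -scaleNr opprB.
Qed.

(** If [e] is at least about [n / 2], both factors [D p] decay along [V p ^+ e]. Otherwise
    [resolvent_swap] moves them onto [q], at the price of the scalar [(p/q)^2] of modulus at most
    [4]. The two cases give [16] and [64], so the constant [256] is generous. *)
Lemma bd_D2_pair p q n e : cone p -> cone q -> q != 0 ->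
  normc p <= 2 * normc q -> (e < n)%N ->
  bd (D p ^+ 2 * V q ^+ (n - e) * V p ^+ e) (256 * C ^+ 2 / n%:R ^+ 2).
Proof.
move=> cp cq q0 pq en; have n0 : (0 < n)%N by apply: leq_trans en.
have n0' : 0 < n%:R :> R by rewrite ltr0n.
have K0 k : 0 <= 4 * C ^+ 2 / k.+1%:R ^+ 2 by rewrite !mulr_ge0 ?invr_ge0 ?sqr_ge0.
have comXX a b : V q ^+ a * V p ^+ b = V p ^+ b * V q ^+ a.
  apply: GRing.commrX; apply: GRing.commr_sym; apply: GRing.commrX.
  exact: (resolvent_comm HV).
have [ne|ne] := leqP n (2 * e.+1).
  have -> : D p ^+ 2 * V q ^+ (n - e) * V p ^+ e = D p ^+ 2 * V p ^+ e * V q ^+ (n - e).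
    by rewrite -mulrA comXX mulrA.
  apply: bd_le (bdMl (bd_D2 C0 HV e cp) (K0 e) (VX (n - e) cq)).
  have := ler_inv_sqr R n0 ne; move=> /(ler_wpM2l (_ : 0 <= 4 * C ^+ 2)).
  rewrite mulr_ge0 ?sqr_ge0// => /(_ isT)/le_trans; apply.
  rewrite [leLHS]mulrA ler_wpM2r ?invr_ge0 ?sqr_ge0// mulrAC ler_wpM2r ?sqr_ge0//.
  by rewrite -natrM ler_nat.
have [k nk] : exists k, (n - e = k.+2)%N by exists (n - e - 2)%N; lia.
have swap : D p * V q = (p / q) *: (D q * V p).
  rewrite mulrC -scalerA -(resolvent_swap HV)// scalerA mulVf//.
  by rewrite scale1r.
have -> : D p ^+ 2 * V q ^+ (n - e) * V p ^+ e =
    ((p / q) ^+ 2) *: (D q ^+ 2 * V q ^+ k * (V p ^+ 2 * V p ^+ e)).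
  have -> : D p ^+ 2 * V q ^+ (n - e) = (D p * V q) * (D p * V q) * V q ^+ k.
    rewrite nk !exprS expr0 mulr1 !mulrA; congr (_ * _ * _); rewrite -!mulrA; congr (_ * _).
    exact: (resolvent_commD HV).
  rewrite swap -endo_scaleAr -!endo_scaleAl scalerA -expr2; congr (_ *: _).
  have comp : V p * D q = D q * V p.
    by rewrite (resolvent_commD HV).
  rewrite [in RHS]mulrA; congr (_ * _); rewrite -[RHS]mulrA comXX [RHS]mulrA; congr (_ * _).
  by rewrite !expr2 mulrA -(mulrA _ (V p)) comp !mulrA.
have c4 : normc ((p / q) ^+ 2) <= 4.
  rewrite normcX normcM normcV (_ : 4 = 2 ^+ 2); last by ring.
  rewrite ler_sqr ?nnegrE ?divr_ge0 ?normc_ge0//.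
  by rewrite ler_pdivrMr// normc_gt0.
apply: bd_le (bdZ _ (bdMl (bd_D2 C0 HV k cq) (K0 k) (bdMr (VX 2 cp) (VX e cp)))).
apply: le_trans (ler_wpM2r (K0 k) c4) _.
have nk1 : (n <= 2 * k.+1)%N by lia.
have := ler_inv_sqr R n0 nk1 => /(ler_wpM2l (_ : 0 <= 16 * C ^+ 2)).
rewrite mulr_ge0 ?sqr_ge0// => /(_ isT) le1.
have -> : 4 * (4 * C ^+ 2 / k.+1%:R ^+ 2) = 16 * C ^+ 2 / k.+1%:R ^+ 2 by rewrite !mulrA -natrM.
apply: le_trans le1 _; rewrite [leLHS]mulrA ler_wpM2r ?invr_ge0 ?sqr_ge0//.
rewrite mulrAC ler_wpM2r ?sqr_ge0//.
by rewrite -natrM ler_nat.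
Qed.

(* The remainder is a double telescoping sum of [n ^ 2] terms of the form
   bounded by [bd_D2_pair]. *)
Lemma bd_derivative_remainder p q n : cone p -> cone q -> p != 0 -> q != 0 ->
  normc p <= 2 * normc q -> (0 < n)%N ->
  let c := (p - q) / p in
  bd (V q ^+ n - V p ^+ n - (c * n%:R) *: (D p * V p ^+ n))
     (normc c ^+ 2 * (256 * C ^+ 2)).
Proof.
move=> cp cq p0 q0 pq n0 c.
have comqp : GRing.comm (V q) (V p) by exact: (resolvent_comm HV).
have n0' : 0 < n%:R :> R by rewrite ltr0n.
pose K := 256 * C ^+ 2 / n%:R ^+ 2.
have K0 : 0 <= K by rewrite /K !mulr_ge0 ?invr_ge0 ?sqr_ge0.
have tele k : V q ^+ k - V p ^+ k = c *: \sum_(i < k) D p * V q ^+ (k - i) * V p ^+ i.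
  rewrite (subrXX_comm _ comqp) resolvent_sub// -endo_scaleAl; congr (_ *: _).
  rewrite big_distrr /=; apply: eq_bigr => i _.
  rewrite !mulrA -(mulrA (D p) (V q)) -exprS; congr (_ * _ ^+ _ * _).
  by rewrite -subn1 subnAC subn1 prednK// subn_gt0.
rewrite tele -scalerA -scalerBr.
have -> : n%:R *: (D p * V p ^+ n) = \sum_(i < n) D p * V p ^+ n.
  by rewrite sumr_const card_ord scaler_nat.
rewrite -sumrB expr2 -mulrA; apply: bdZ.
have -> : normc c * (256 * C ^+ 2) = n%:R * (normc c * (n%:R * K)).
  by rewrite /K; field; rewrite gt_eqF.
apply: bd_sum => i.
have -> : D p * V q ^+ (n - i) * V p ^+ i - D p * V p ^+ n =
    D p * (V q ^+ (n - i) - V p ^+ (n - i)) * V p ^+ i.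
  rewrite [in RHS]mulrBr [RHS]mulrBl -(mulrA _ (V p ^+ (n - i))) -exprD subnK//.
  exact/ltnW.
rewrite tele -endo_scaleAr -endo_scaleAl; apply: bdZ.
rewrite big_distrr big_distrl /=.
apply: (@bd_le _ _ _ ((n - i)%:R * K)).
  by rewrite ler_wpM2r// ler_nat leq_subr.
apply: bd_sum => l.
have -> : D p * (D p * V q ^+ (n - i - l) * V p ^+ l) * V p ^+ i =
    D p ^+ 2 * V q ^+ (n - (i + l)) * V p ^+ (i + l).
  by rewrite expr2 -subnDA (addnC i l) exprD !mulrA.
by apply: bd_D2_pair => //; rewrite -ltn_subRL.
Qed.

(** Along powers of two, passing from [k] to [k + 1] replaces each factor [V (p + p)] by
    [V p * V p]; this is an instance of [bd_resolvent_prodX], and the errors form a geometric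
    series. *)
Definition euler k z : endo H := V ((2 ^+ k)^-1%:C * z) ^+ (2 ^ k).

Let half k z : cone z -> cone ((2 ^+ k)^-1%:C * z).
Proof. by apply: coneZ; rewrite invr_ge0 exprn_ge0. Qed.

Lemma bd_euler k z : cone z -> bd (euler k z) 1.
Proof. by move=> cz; exact/VX/half. Qed.

Lemma bd_euler_step k z : cone z ->
  bd (euler k.+1 z - euler k z) (16 * C ^+ 2 / 2 ^+ k).
Proof.
move=> cz; set p := (2 ^+ k.+1)^-1%:C * z.
have cp : cone p by exact: half.
have pp : p + p = (2 ^+ k)^-1%:C * z.
  rewrite /p -mulrDl -rmorphD; congr ((_)%:C * _).
  by rewrite exprS invfM; field; rewrite expf_neq0.
rewrite /euler -/p -pp expnS exprM expr2 -natrX.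
apply: (bd_resolvent_prodX m0 C0 HV) => //; last by rewrite expn_gt0.
rewrite -mulr2n -mulr_natl !normcM exprMn -expr2 ler_peMl ?sqr_ge0//.
have -> : normc (2 : R[i]) = 2 by rewrite -(rmorph_nat (real_complex R)) normc_real ger0_norm.
by rewrite expr2; lra.
Qed.

Lemma bd_euler_dist k l z : cone z -> (k <= l)%N ->
  bd (euler k z - euler l z) (32 * C ^+ 2 / 2 ^+ k).
Proof.
move=> cz kl; apply: bd_distC.
(* The induction needs the difference of the two tails, since [32/2^k - 32/2^(k+1) = 16/2^k] is
   exactly the bound of one step. *)
have : bd (euler l z - euler k z) (32 * C ^+ 2 / 2 ^+ k - 32 * C ^+ 2 / 2 ^+ l).
  rewrite -(subnK kl) addnC; elim: (l - k)%N => [|d IH].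
    by rewrite addn0 !subrr; exact: bd0.
  rewrite addnS.
  have := bd_triangle (bd_euler_step (k + d) cz) IH; apply: bd_le.
  rewrite le_eqVlt; apply/orP; left; apply/eqP.
  by rewrite (exprS 2 (k + d)); field; rewrite !expf_neq0.
apply: bd_le; rewrite lerBlDr lerDl !mulr_ge0 ?invr_ge0 ?sqr_ge0//.
Qed.

End EulerLimit.
Section OperatorLimits.
Variables (R : realType) (H : completeNormedModType R[i]).
Implicit Types (F : nat -> endo H) (T : endo H) (r K e : R).

Lemma exp2_small K e : 0 < e -> exists N, forall k, (N <= k)%N -> K / 2 ^+ k <= e.
Proof.
move=> e0.
have [N HN] : exists N : nat, `|K| / e <= N%:R.
  by exists (Num.bound (`|K| / e)); rewrite ltW// archi_boundP// divr_ge0// ltW.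
exists N => k Nk; rewrite ler_pdivrMr ?exprn_gt0// mulrC -ler_pdivrMr//.
apply: (@le_trans _ _ (`|K| / e)).
  by rewrite ler_wpM2r ?invr_ge0 ?(ltW e0)// ler_norm.
apply: le_trans HN _; rewrite -natrX ler_nat.
by apply: leq_trans Nk (ltnW _); rewrite ltn_expl.
Qed.

Lemma bd_addgt0 T r : (forall e, 0 < e -> bd T (r + e)) -> bd T r.
Proof.
move=> h x; apply/ler_addgt0Pl => e e0.
have x1 : 0 < rnorm x + 1 by rewrite ltr_wpDl ?rnorm_ge0.
apply: le_trans (h _ (divr_gt0 e0 x1) x) _; rewrite mulrDl addrC lerD2r.
rewrite mulrAC ler_pdivrMr// ler_wpM2l// ?(ltW e0)//.
by rewrite lerDl.
Qed.

Lemma bd_limit F T S K r : (forall k, bd (F k - S) r) ->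
  (forall k, bd (F k - T) (K / 2 ^+ k)) -> bd (T - S) r.
Proof.
move=> Fr FT; apply: bd_addgt0 => e e0; have [N /(_ _ (leqnn N)) HN] := exp2_small K e0.
rewrite [r + e]addrC; apply: (bd_triangle _ (Fr N)).
exact/bd_distC/(bd_le HN).
Qed.

End OperatorLimits.

(** * The limit: semigroup law and complex derivative *)

Section EulerSemigroup.
Variables (R : realType) (H : completeNormedModType R[i]) (m C : R).
Hypotheses (m0 : 0 < m) (C0 : 0 <= C).
Variable V : R[i] -> endo H.
Hypothesis HV : resolvent_family m C V.
Implicit Types (z w h p q : R[i]) (n k : nat) (s t e : R).
Local Notation cone := (cone m).
Local Notation D z := (1 - V z).

Let V1 z : cone z -> bd (V z) 1. Proof. by case: HV => _ h _ _; exact: h. Qed.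
Let VX z n : cone z -> bd (V z ^+ n) 1. Proof. by move=> /V1/bdX. Qed.
Let half k z : cone z -> cone ((2 ^+ k)^-1%:C * z).
Proof. by apply: coneZ; rewrite invr_ge0 exprn_ge0. Qed.

(** The rate determines [T] on the cone and is the form in which the later sections receive it. *)
Lemma euler_limit : exists T : R[i] -> endo H,
  forall z, cone z -> forall k, bd (euler V k z - T z) (32 * C ^+ 2 / 2 ^+ k).
Proof.
suff lim z : exists L, cone z -> forall k, bd (euler V k z - L) (32 * C ^+ 2 / 2 ^+ k).
  by have [T HT] := choice lim; exists T => z; exact: HT.
have [cz|] := pselect (cone z); last by exists 0.
have [|L HL] := @endo_complete _ _ (fun k => euler V k z).
  move=> e e0; have [N HN] := exp2_small (32 * C ^+ 2 + 32 * C ^+ 2) e0.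
  exists N => k l Nk Nl.
  have := bd_triangle (bd_distC (bd_euler_dist m0 C0 HV cz Nk)) (bd_euler_dist m0 C0 HV cz Nl).
  by apply: bd_le; rewrite -mulrDl HN.
exists L => _ k; apply: HL; exists k => l kl; exact: (bd_euler_dist m0 C0 HV cz).
Qed.

Variable T : R[i] -> endo H.
Hypothesis HT : forall z, cone z -> forall k, bd (euler V k z - T z) (32 * C ^+ 2 / 2 ^+ k).

Lemma bd_semigroup z : cone z -> bd (T z) 1.
Proof.
move=> cz; rewrite -[T z]subr0; apply: bd_limit (HT cz) => k.
by rewrite subr0; exact: (bd_euler HV).
Qed.

Lemma semigroup0 : T 0 = 1.
Proof.
apply: bd_eps => e e0; apply: (bd_le (ltW e0)); apply: bd_limit (HT (cone0 m)) => k.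
have [V0 _ _ _] := HV.
by rewrite /euler mulr0 V0 expr1n subrr; exact: bd0.
Qed.

Lemma semigroupD z w : cone z -> cone w -> normc (z * w) <= normc (z + w) ^+ 2 ->
  T (z + w) = T z * T w.
Proof.
move=> cz cw zw; apply: bd_eps => e e0.
(* Three replacements of an Euler approximation by its limit cost [32] each, and the defect of the
   product costs [16]. *)
have [N /(_ _ (leqnn N)) HN] := exp2_small (112 * C ^+ 2) e0.
apply: (bd_le HN); set a := C ^+ 2 / 2 ^+ N.
have a32 : 32 * C ^+ 2 / 2 ^+ N = 32 * a by rewrite -mulrA.
have -> : 112 * C ^+ 2 / 2 ^+ N = 32 * a + (16 * a + (32 * a + 32 * a)).
  by rewrite -mulrA -/a; move: (a) => b; rewrite -!mulrDl -!natrD.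
have a0 : 0 <= 32 * a by rewrite mulr_ge0 ?divr_ge0 ?sqr_ge0 ?exprn_ge0.
apply: (bd_triangle (U := euler V N (z + w))).
  by apply: bd_distC; rewrite -a32; exact/HT/coneD.
apply: (bd_triangle (U := euler V N z * euler V N w)).
  apply: bd_distC; rewrite /euler mulrDr -exprMn_comm; last first.
    by apply: (resolvent_comm HV); exact: half.
  have -> : 16 * a = 16 * C ^+ 2 / (2 ^ N)%:R by rewrite natrX mulrA.
  apply: (bd_resolvent_prodX m0 C0 HV); rewrite ?expn_gt0//; try exact: half.
  rewrite -mulrDr mulrACA !normcM -expr2 exprMn ler_wpM2l ?sqr_ge0//.
  by rewrite -normcM.
have -> : euler V N z * euler V N w - T z * T w =
    (euler V N z - T z) * euler V N w + T z * (euler V N w - T w).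
  by rewrite mulrBl mulrBr addrA subrK.
apply: bdD.
  by apply: bdMl => //; [rewrite -a32; exact: HT|exact: (bd_euler HV)].
by apply: bdMr; [exact: bd_semigroup|rewrite -a32; exact: HT].
Qed.

(** The Euler approximations have a second-order Taylor remainder whose constant does not depend on
    [k]. Together with their uniform convergence this makes the derivatives Cauchy, and the Taylor
    estimate passes to the limit. *)
Lemma semigroup_derivative z : cone z -> z != 0 -> exists G : endo H, forall h,
  cone (z + h) -> normc h <= normc z / 2 ->
  bd (T (z + h) - T z - h *: G) (256 * C ^+ 2 / normc z ^+ 2 * normc h ^+ 2).
Proof.
move=> cz z0; have nz0 : 0 < normc z by rewrite normc_gt0.
pose p k := (2 ^+ k)^-1%:C * z.
pose F k := euler V k.
(* The derivative at [z] of [V (z/2^k) ^+ (2^k)]: here [V' (p) = - D p V(p) / p], and the inner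
   factor [1/2^k] turns [p] into [z]. *)
pose G k : endo H := (- ((2 ^ k)%:R / z)) *: (D (p k) * V (p k) ^+ (2 ^ k)).
pose K := 256 * C ^+ 2 / normc z ^+ 2.
have K0 : 0 <= K by rewrite /K !mulr_ge0 ?invr_ge0 ?sqr_ge0.
have rem k h : cone (z + h) -> normc h <= normc z / 2 ->
    bd (F k (z + h) - F k z - h *: G k) (K * normc h ^+ 2).
  move=> czh hz; pose q := (2 ^+ k)^-1%:C * (z + h).
  have k0 : ((2 ^+ k)^-1 : R)%:C != 0.
    by rewrite -normc_gt0 normc_real normr_gt0 invr_eq0 expf_neq0.
  have zh : normc z <= 2 * normc (z + h).
    have : normc z <= normc (z + h) + normc h.
      by rewrite -(normcN h) (le_trans _ (le_normcD _ _))// addrK.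
    by lra.
  have zh0 : z + h != 0 by rewrite -normc_gt0; lra.
  have := bd_derivative_remainder m0 C0 HV (half k cz) (half k czh).
  rewrite -/(p k) -/q => /(_ (2 ^ k)%N) main.
  have pq : (p k - q) / p k = - (h / z).
    rewrite /p /q; move: ((2 ^+ k)^-1%:C) k0 => r r0.
    by field; apply/andP; split.
  have Kh : K * normc h ^+ 2 = normc (- (h / z)) ^+ 2 * (256 * C ^+ 2).
    by rewrite normcN normcM normcV /K; field; rewrite gt_eqF.
  rewrite Kh -pq scalerA mulrN mulrCA -mulNr.
  rewrite (_ : - (2 ^ k)%:R * (h / z) = (p k - q) / p k * (2 ^ k)%:R); last first.
    by rewrite pq; ring.
  apply: main; rewrite ?mulf_neq0 ?expn_gt0// !normcM mulrCA ler_wpM2l//.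
  exact: normc_ge0.
(* One increment [h = t z] suffices, and it stays in the cone. A small [t] makes the two remainders
   [K |h|^2] small compared with [|h|]; for this fixed [t] a large [N] then does the same for the
   errors of the approximations. *)
have cau e : 0 < e -> exists N, forall k l, (N <= k)%N -> (N <= l)%N ->
    bd (G k - G l) e.
  move=> e0; pose B := 2 * K * normc z + 1.
  have B0 : 0 < B by rewrite /B ltr_wpDl// mulr_ge0 ?normc_ge0// mulr_ge0.
  pose t := Num.min 2^-1 (e / 2 / B).
  have t0 : 0 < t by rewrite lt_min invr_gt0 ltr0n !divr_gt0.
  have tle : t <= e / 2 / B by rewrite ge_min lexx orbT.
  pose h := t%:C * z; have nh : normc h = t * normc z.
    by rewrite normcM normc_real gtr0_norm.
  have czh : cone (z + h) by apply: coneD => //; apply: coneZ => //; exact: ltW.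
  have hz : normc h <= normc z / 2.
    by rewrite nh mulrC ler_wpM2l ?(ltW nz0)// ge_min lexx.
  have e' : 0 < e / 2 * (t * normc z) by rewrite !mulr_gt0.
  have [N HN] := exp2_small (128 * C ^+ 2) e'.
  exists N => k l Nk Nl.
  have h0 : h != 0 by rewrite -normc_gt0 nh mulr_gt0.
  have FF x : cone x -> bd (F k x - F l x) (64 * C ^+ 2 / 2 ^+ N).
    move=> cx; have := bd_triangle (bd_distC (bd_euler_dist m0 C0 HV cx Nk))
      (bd_euler_dist m0 C0 HV cx Nl).
    by apply: bd_le; rewrite -!mulrDl -natrD.
  have hG : bd (h *: G k - h *: G l) (e * (t * normc z)).
    apply: (@bd_le _ _ _ (K * normc h ^+ 2 +
        (64 * C ^+ 2 / 2 ^+ N + 64 * C ^+ 2 / 2 ^+ N + K * normc h ^+ 2))).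
      have {HN} := HN N (leqnn N).
      have -> : 128 * C ^+ 2 / 2 ^+ N = 64 * C ^+ 2 / 2 ^+ N + 64 * C ^+ 2 / 2 ^+ N.
        by rewrite -!mulrDl -natrD.
      move: (64 * C ^+ 2 / 2 ^+ N) => y yle; rewrite nh.
      have tB : t * B <= e / 2 by rewrite -ler_pdivlMr.
      have tK : 2 * K * (t * normc z) <= e / 2.
        by apply: le_trans tB; rewrite /B; move: t0; nra.
      have tz0 : 0 <= t * normc z by rewrite ltW// mulr_gt0.
      have := ler_wpM2r tz0 tK.
      by move: yle; rewrite expr2; lra.
    apply: (bd_triangle (U := F k (z + h) - F k z)); first exact/bd_distC/rem.
    apply: (bd_triangle (U := F l (z + h) - F l z)); last exact: rem.
    by rewrite opprD addrACA -opprD; apply: bdB; apply: FF.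
  have -> : G k - G l = h^-1 *: (h *: G k - h *: G l).
    by rewrite -scalerBr scalerA mulVf// scale1r.
  apply: bd_le (bdZ _ hG); rewrite normcV nh mulrC -mulrA mulfV ?mulr1//.
  by rewrite gt_eqF// mulr_gt0.
have [L HL] := endo_complete cau; exists L => h czh hz.
apply: bd_addgt0 => e e0.
have e2 : 0 < e / 2 by rewrite divr_gt0.
have h1 : 0 < normc h + 1 by rewrite ltr_wpDl ?normc_ge0.
have [N HN] := cau _ (divr_gt0 e2 h1).
have [N' HN'] := exp2_small (64 * C ^+ 2) e2.
pose k := maxn N N'.
have GL : bd (h *: G k - h *: L) (e / 2).
  rewrite -scalerBr; apply: (@bd_le _ _ _ (normc h * (e / 2 / (normc h + 1)))).
    rewrite mulrC mulrAC ler_pdivrMr// ler_wpM2l ?(ltW e2)//.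
    by rewrite lerDl.
  apply: bdZ; apply: HL; exists N => l Nl; apply: HN => //.
  exact: leq_maxl.
have -> : T (z + h) - T z - h *: L =
    (T (z + h) - T z - (F k (z + h) - F k z)) +
    ((F k (z + h) - F k z - h *: G k) + (h *: G k - h *: L)).
  move: (T (z + h) - T z) (F k (z + h) - F k z) (h *: G k) (h *: L) => a b c d.
  by rewrite !addrA !subrK.
have -> : K * normc h ^+ 2 + e = e / 2 + (K * normc h ^+ 2 + e / 2) by lra.
apply: bdD; last by apply: bdD => //; exact: rem.
rewrite opprD addrACA -opprD.
apply: bd_le (bdB (bd_distC (HT czh k)) (bd_distC (HT cz k))).
rewrite -!mulrDl -natrD; apply: HN'.
exact: leq_maxr.
Qed.

(** On the range of [V s], which plays the role of the domain of [A], one factor moves a vector by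
    [O(t)], because [D t V s = (t/s) D s V t]. The bound depends on [n] and [t] only through
    [n t]. *)
Lemma bd_resolvent_powB s t n : 0 <= t -> 0 < s ->
  bd ((V t%:C ^+ n - 1) * V s%:C) (n%:R * (2 * t / s)).
Proof.
move=> t0 s0; have ct := cone_real m0 t0; have cs := cone_real m0 (ltW s0).
rewrite subrX1 -opprB !mulNr; apply: bdN.
have comDV i : D t%:C * V t%:C ^+ i = V t%:C ^+ i * D t%:C.
  exact/GRing.commrX/(resolvent_commD HV).
have -> : D t%:C * (\sum_(i < n) V t%:C ^+ i) * V s%:C =
    \sum_(i < n) V t%:C ^+ i * (D t%:C * V s%:C).
  by rewrite big_distrr big_distrl /=; apply: eq_bigr => i _; rewrite comDV mulrA.
apply: bd_sum => i; apply: bdMr; first exact: VX.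
have s0' : s%:C != 0 by rewrite -normc_gt0 normc_real normr_gt0 gt_eqF.
have -> : D t%:C * V s%:C = (t / s)%:C *: (D s%:C * V t%:C).
  apply: (can_inj (scalerK s0')); rewrite (resolvent_swap HV)// scalerA.
  by rewrite -rmorphM mulrCA mulfV ?mulr1// gt_eqF.
have -> : 2 * t / s = normc (t / s)%:C * ((1 + 1) * 1).
  by rewrite normc_real ger0_norm ?divr_ge0 ?(ltW s0)//; lra.
apply: bdZ; apply: bdM => //; last exact: V1.
exact: bdB (@bd1 _ _) (V1 cs).
Qed.

End EulerSemigroup.

(** * Strong continuity at zero and the derivative on the domain *)

Section EulerGenerator.
Variables (R : realType) (H : completeNormedModType R[i]) (m C : R).
Hypotheses (m0 : 0 < m) (C0 : 0 <= C).
Variable V : R[i] -> endo H.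
Hypothesis HV : resolvent_family m C V.
Hypothesis V_dense : forall x e, 0 < e ->
  exists (s : R) (y : H), 0 < s /\ rnorm (x - V s%:C y) <= e.
Variable T : R[i] -> endo H.
Hypothesis HT : forall z, cone m z -> forall k,
  bd (euler V k z - T z) (32 * C ^+ 2 / 2 ^+ k).
Implicit Types (n k : nat) (s t e : R) (x y g : H).
Local Notation D z := (1 - V z).

Let VX z n : cone m z -> bd (V z ^+ n) 1.
Proof. by case: HV => _ V1 _ _ /V1/bdX. Qed.

Lemma euler_rcvg z x : cone m z -> rcvg (fun k => euler V k z x) (T z x).
Proof.
move=> cz e e0; have x1 : 0 < rnorm x + 1 by rewrite ltr_wpDl ?rnorm_ge0.
have [N HN] := exp2_small (32 * C ^+ 2) (divr_gt0 e0 x1); exists N => k /HN Nk.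
apply: le_trans (bd_le Nk (HT cz k) x) _.
rewrite mulrAC ler_pdivrMr// ler_wpM2l// ?(ltW e0)//.
by rewrite lerDl.
Qed.

Lemma euler_real k t : euler V k t%:C = V (t / 2 ^+ k)%:C ^+ (2 ^ k).
Proof. by rewrite /euler -rmorphM mulrC. Qed.

(** Approximating [g] from the range of some [V s] reduces this to [bd_resolvent_powB]. Uniformity
    in [n] for small [n t] lets the estimate pass to the Euler limit, where [n = 2^k] and [n t] is
    the time. *)
Lemma resolvent_pow_near1 g e : 0 < e -> exists2 d, 0 < d & forall t n,
  0 <= t -> n%:R * t <= d -> rnorm ((V t%:C ^+ n - 1) g) <= e.
Proof.
move=> e0; have e4 : 0 < e / 4 by rewrite divr_gt0.
have [s [y [s0 gy]]] := V_dense g e4.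
have y1 : 0 < rnorm y + 1 by rewrite ltr_wpDl ?rnorm_ge0.
exists (e / 4 * s / (rnorm y + 1)); first by rewrite divr_gt0// mulr_gt0.
move=> t n t0; rewrite ler_pdivlMr// => nt.
have -> : (V t%:C ^+ n - 1) g = (V t%:C ^+ n - 1) (g - V s%:C y) +
    ((V t%:C ^+ n - 1) * V s%:C) y by rewrite linearB/= subrK.
have -> : e = 2 * (e / 4) + e / 2 by lra.
apply: le_trans (rnormD _ _) _; apply: lerD.
  apply: le_trans (bdB (VX n (cone_real m0 t0)) (@bd1 _ _) _) _.
  by rewrite ler_wpM2l.
apply: le_trans (bd_resolvent_powB m0 HV n t0 s0 y) _.
have -> : n%:R * (2 * t / s) * rnorm y = 2 * (n%:R * t * rnorm y) / s.
  by field; rewrite gt_eqF.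
rewrite ler_pdivrMr//.
have : n%:R * t * rnorm y <= n%:R * t * (rnorm y + 1).
  by rewrite ler_wpM2l ?mulr_ge0// lerDl.
by lra.
Qed.

Lemma semigroup_near1 g e : 0 < e -> exists2 d, 0 < d & forall t,
  0 <= t -> t <= d -> rnorm (T t%:C g - g) <= e.
Proof.
move=> e0; have [d d0 Hd] := resolvent_pow_near1 g e0; exists d => // t t0 td.
apply: rcvg_rnorm_le (euler_rcvg g (cone_real m0 t0)) _.
exists 0%N => k _; rewrite euler_real; apply: Hd.
  by rewrite divr_ge0// exprn_ge0.
by rewrite natrX mulrC divfK// expf_neq0.
Qed.

(** Telescoping gives [(V t ^+ n - 1) V s = - (t/s) sum V t ^+ i.+1 D s]. Replacing each power by
    [1] yields the linear term, and what remains is small by [resolvent_pow_near1]. *)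
Lemma resolvent_pow_taylor s t n : 0 <= t -> 0 < s ->
  (V t%:C ^+ n - 1) * V s%:C + (n%:R * t / s)%:C *: D s%:C =
  (t / s)%:C *: \sum_(i < n) (1 - V t%:C ^+ i.+1) * D s%:C.
Proof.
move=> t0 s0; have ct := cone_real m0 t0; have cs := cone_real m0 (ltW s0).
have s0' : s%:C != 0 by rewrite -normc_gt0 normc_real normr_gt0 gt_eqF.
have step i : V t%:C ^+ i * D t%:C * V s%:C =
    (t / s)%:C *: (V t%:C ^+ i.+1 * D s%:C).
  apply: (can_inj (scalerK s0')); rewrite scalerA -rmorphM mulrCA mulfV ?gt_eqF//.
  rewrite mulr1 -mulrA endo_scaleAr (resolvent_swap HV)// -endo_scaleAr.
  by rewrite (resolvent_commD HV)// exprSr mulrA.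
have -> : (V t%:C ^+ n - 1) * V s%:C =
    - ((t / s)%:C *: \sum_(i < n) V t%:C ^+ i.+1 * D s%:C).
  rewrite subrX1 -opprB !mulNr; congr (- _).
  rewrite big_distrr big_distrl scaler_sumr /=; apply: eq_bigr => i _.
  by rewrite -step; congr (_ * _); exact/GRing.commrX/(resolvent_commD HV).
have -> : (n%:R * t / s)%:C *: D s%:C = (t / s)%:C *: \sum_(i < n) D s%:C.
  rewrite sumr_const card_ord -[D s%:C *+ n]scaler_nat scalerA; congr (_ *: _).
  by rewrite -(rmorph_nat (real_complex R)) -rmorphM; congr (_%:C); ring.
rewrite addrC -scalerBr -sumrB; congr (_ *: _); apply: eq_bigr => i _.
by rewrite mulrBl mul1r.
Qed.

(** For [x = V s y] one has [y = x + s A x], so [(y - x)/s] is [A x] and the claim says that the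
    right derivative of [T x] at [0] is [- A x]. *)
Lemma semigroup_taylor s y e : 0 < s -> 0 < e -> exists2 d, 0 < d & forall t,
  0 <= t -> t <= d ->
  rnorm (T t%:C (V s%:C y) - (V s%:C y - (t / s)%:C *: (y - V s%:C y))) <= e * t.
Proof.
move=> s0 e0; have [d d0 Hd] := resolvent_pow_near1 (D s%:C y) (mulr_gt0 e0 s0).
exists d => // t t0 td.
apply: rcvg_rnorm_le (euler_rcvg _ (cone_real m0 t0)) _.
exists 0%N => k _; rewrite euler_real; set n := (2 ^ k)%N; set p := t / 2 ^+ k.
have p0 : 0 <= p by rewrite divr_ge0// exprn_ge0.
have np : n%:R * p = t by rewrite /p /n natrX mulrC divfK// expf_neq0.
have -> : (V p%:C ^+ n) (V s%:C y) - (V s%:C y - (t / s)%:C *: (y - V s%:C y)) =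
    ((V p%:C ^+ n - 1) * V s%:C + (t / s)%:C *: D s%:C) y.
  by rewrite opprB addrA addrAC.
rewrite -np (resolvent_pow_taylor n p0 s0).
have -> : ((p / s)%:C *: \sum_(i < n) (1 - V p%:C ^+ i.+1) * D s%:C) y =
  (p / s)%:C *: \sum_(i < n) (1 - V p%:C ^+ i.+1) (D s%:C y).
  congr (_ *: _); elim/big_rec2: _ => // i _ b _ <-; by [].
rewrite rnormZ normc_real ger0_norm ?divr_ge0 ?(ltW s0)//.
have -> : e * (n%:R * p) = p / s * (n%:R * (e * s)) by field; rewrite gt_eqF.
rewrite ler_wpM2l ?divr_ge0 ?(ltW s0)//.
have : forall i : 'I_n, rnorm ((1 - V p%:C ^+ i.+1) (D s%:C y)) <= e * s.
  move=> i; rewrite -opprB rnormN; apply: Hd => //.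
  by apply: le_trans td; rewrite -np ler_wpM2r// ler_nat.
move: (fun i : 'I_n => (1 - V p%:C ^+ i.+1) (D s%:C y)) => u.
rewrite -[n in n%:R]card_ord mulr_natl -sumr_const => Hu.
elim/big_ind2: _ => [|x1 x2 y1 y2 h1 h2|i _]; first by rewrite rnorm0.
  by rewrite (le_trans (rnormD _ _))// lerD.
exact: Hu.
Qed.

End EulerGenerator.
(** * Resolvents of coercive forms *)

(** Raising the weight from [n^2] to [(n+1)^2] costs [(2n+1) X2 <= 3n X2], which the dissipation
    [2 be (la Y + n^2 Z)] has to pay for. It is at least [4 be n sqrt(la Y Z)], hence at least
    [(4 be sqrt(la) / M) n X2] when [M > 0]; this [la] makes the factor equal to [3]. *)
Lemma lyapunov_step (R : realType) (M be n E1 E2 X1 X2 Y Z : R) :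
  0 < be -> 0 <= M -> 1 <= n -> 0 <= Y -> 0 <= Z -> 0 <= X2 ->
  E2 + 2 * be * Y <= E1 -> X2 + 2 * be * Z <= X1 -> X2 ^+ 2 <= M ^+ 2 * (Y * Z) ->
  let la := 9 * M ^+ 2 / (16 * be ^+ 2) in
  la * E2 + (n + 1) ^+ 2 * X2 <= la * E1 + n ^+ 2 * X1.
Proof.
move=> be0 M0 n1 Y0 Z0 X0 hE hX hYZ /=; set la := 9 * M ^+ 2 / _.
have la0 : 0 <= la by rewrite /la divr_ge0 ?(mulr_ge0 (ler0n _ _) (sqr_ge0 _)).
have n0 : 0 <= n by apply: le_trans n1.
(* AM-GM, sharp for this value of [la] *)
suff key : 3 * n * X2 <= 2 * be * (la * Y + n ^+ 2 * Z).
  have h1 := ler_wpM2l la0 hE; have h2 := ler_wpM2l (sqr_ge0 n) hX.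
  have h3 : (2 * n + 1) * X2 <= 3 * n * X2 by rewrite ler_wpM2r//; lra.
  have -> : (n + 1) ^+ 2 * X2 = n ^+ 2 * X2 + (2 * n + 1) * X2 by ring.
  by lra.
have la_be : 16 * be ^+ 2 * la = 9 * M ^+ 2.
  by rewrite /la; field; rewrite gt_eqF.
have n2Z : 0 <= n ^+ 2 * Z by exact: mulr_ge0 (sqr_ge0 n) Z0.
have rhs0 : 0 <= 2 * be * (la * Y + n ^+ 2 * Z).
  apply: mulr_ge0; first by rewrite mulr_ge0// ltW.
  exact: addr_ge0 (mulr_ge0 la0 Y0) n2Z.
have lhs0 : 0 <= 3 * n * X2 by rewrite mulr_ge0// mulr_ge0.
rewrite -ler_sqr ?nnegrE//.
apply: (@le_trans _ _ (16 * be ^+ 2 * (la * Y * (n ^+ 2 * Z)))).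
  have -> : 16 * be ^+ 2 * (la * Y * (n ^+ 2 * Z)) = (3 * n) ^+ 2 * (M ^+ 2 * (Y * Z)).
    transitivity (16 * be ^+ 2 * la * (Y * (n ^+ 2 * Z))); first by ring.
    by rewrite la_be; ring.
  by rewrite exprMn ler_wpM2l ?sqr_ge0.
rewrite -subr_ge0.
have -> : (2 * be * (la * Y + n ^+ 2 * Z)) ^+ 2 - 16 * be ^+ 2 * (la * Y * (n ^+ 2 * Z)) =
  (2 * be * (la * Y - n ^+ 2 * Z)) ^+ 2 by ring.
exact: sqr_ge0.
Qed.

Section FormResolvent.
Variables (R : realType) (H V : completeNormedModType R[i]).
Variables (dotH : {dot H for Num.conj}) (dotV : {dot V for Num.conj}).
Hypotheses (dotH_norm : dot_induces_norm dotH) (dotV_norm : dot_induces_norm dotV).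
Variables (j : {linear V -> H}) (j_inj : injective j) (j_cont : continuous j).
Variables (a : V -> V -> R[i]) (M al m : R).
Hypothesis a_linl : forall c x y v, a (c *: x + y) v = c * a x v + a y v.
Hypothesis a_linr : forall c x y v, a v (c *: x + y) = Num.conj c * a v x + a v y.
Hypothesis a_bound : forall u v, normc (a u v) <= M * rnorm u * rnorm v.
Hypotheses (M0 : 0 < M) (al0 : 0 < al) (m0 : 0 < m) (mM : m * M <= al / 2).
Hypothesis a_coercive : forall u, al * rnorm u ^+ 2 <= complex.Re (a u u).
Implicit Types (z w c : R[i]) (f g h : H) (u v : V) (t : R).

(** The weak form of [j u + z A (j u) = f], with [A] the operator of the form [a]. *)
Definition solves z f u : Prop :=
  forall v, dotH (j u) (j v) + z * a u v = dotH f (j v).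

(** On the cone, [|Im z Im a(u,u)|] uses up at most half of [al] because [m M <= al / 2]; the factor
    [1 + m] converts [Re z] into [|z|]. *)
Let be : R := al / 2 / (1 + m).

Let be0 : 0 < be. Proof. by rewrite !divr_gt0// addr_gt0. Qed.

Lemma a_subl u u' v : a (u - u') v = a u v - a u' v.
Proof. by rewrite addrC -scaleN1r a_linl mulN1r addrC. Qed.

Lemma a_0l v : a 0 v = 0.
Proof. by rewrite -(subrr (0 : V)) a_subl subrr. Qed.

Lemma cone_coercive z u : cone m z ->
  be * normc z * rnorm u ^+ 2 <= complex.Re (z * a u u).
Proof.
move=> cz; have z0 := cone_Re_ge0 m0 cz.
rewrite Re_mul.
have u2 : 0 <= rnorm u ^+ 2 by rewrite sqr_ge0.
have im : complex.Im z * complex.Im (a u u) <= m * complex.Re z * (M * rnorm u ^+ 2).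
  apply: le_trans (ler_norm _) _; rewrite normrM ler_pM//.
  by rewrite (le_trans (ger_Im_normc _))// (le_trans (a_bound _ _))// -mulrA -expr2.
have re : complex.Re z * (al * rnorm u ^+ 2) <= complex.Re z * complex.Re (a u u).
  by rewrite ler_wpM2l.
have bz : be * normc z <= al / 2 * complex.Re z.
  rewrite /be mulrAC ler_pdivrMr ?addr_gt0// -[leRHS]mulrA ler_wpM2l ?divr_ge0 ?(ltW al0)//.
  by rewrite mulrC normc_cone.
have mz : m * M * complex.Re z <= al / 2 * complex.Re z by rewrite ler_wpM2r.
have := ler_wpM2r u2 bz; have := ler_wpM2r u2 mz.
move: im re; set x := rnorm u ^+ 2; nra.
Qed.

Lemma solvesP z c f g u v : solves z f u -> solves z g v ->
  solves z (c *: f + g) (c *: u + v).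
Proof.
move=> fu gv w; rewrite linearP !dotDl !dotZl a_linl -fu -gv; ring.
Qed.

(** The equation is tested with [u] and [2 Re <f, j u>] is completed to a square. Besides
    contractivity this gives the dissipation term on which the Ritt estimate rests. *)
Lemma solves_energy z f u : cone m z -> solves z f u ->
  rnorm (j u) ^+ 2 + 2 * be * (normc z * rnorm u ^+ 2) <= rnorm f ^+ 2.
Proof.
move=> cz /(_ u)/(congr1 (@complex.Re R)); rewrite ReD -(rnorm_sqr dotH_norm) => E.
have := cone_coercive u cz; have := sqr_ge0 (rnorm (f - j u)).
rewrite (rnorm_sqrB dotH_norm) -E; lra.
Qed.

Lemma solves_uniq z f u v : cone m z -> z != 0 ->
  solves z f u -> solves z f v -> u = v.
Proof.
move=> cz z0 fu fv; have := solvesP (-1) fu fv.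
rewrite !scaleN1r addNr => /(solves_energy cz).
rewrite rnorm0 expr0n /= => le0.
apply/eqP; rewrite -subr_eq0 -opprB oppr_eq0 addrC; apply/eqP/rnorm_eq0/eqP.
rewrite -sqrf_eq0 eq_le sqr_ge0 andbT.
have nz : 0 < 2 * be * normc z by rewrite mulr_gt0 ?normc_gt0// mulr_gt0.
rewrite -(ler_pM2l nz) mulr0.
by apply: le_trans le0; rewrite -[leLHS]mulrA lerDr sqr_ge0.
Qed.

Lemma solves_exists z f : cone m z -> z != 0 -> exists u, solves z f u.
Proof.
move=> cz z0; have [c c0 jc] := linear_continuous_rbound j_cont.
have [y Hy] := adjoint_embedding dotH_norm dotV_norm j_cont f.
pose b u v := dotH (j u) (j v) + z * a u v.
have [|||||u Hu] := lax_milgram dotV_norm (b := b) (M := c ^+ 2 + normc z * M)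
    (al := be * normc z) _ _ _ _ _ y.
- by move=> d x x' v; rewrite /b linearP dotDl dotZl a_linl; ring.
- by move=> d x x' v; rewrite /b linearP dotDr dotZr a_linr; ring.
- move=> u v; rewrite /b (le_trans (le_normcD _ _))// -mulrA mulrDl lerD//.
    apply: le_trans (CauchySchwarz_rnorm dotH_norm _ _) _.
    by rewrite expr2 mulrACA ler_pM ?rnorm_ge0.
  by rewrite normcM -mulrA ler_wpM2l ?normc_ge0// mulrA.
- by rewrite mulr_gt0// normc_gt0.
- move=> u; rewrite /b ReD -(rnorm_sqr dotH_norm) (le_trans (cone_coercive u cz))//.
  by rewrite lerDr sqr_ge0.
by exists u => v; rewrite -[LHS]/(b u v) Hu -dot_conj -Hy dot_conj.
Qed.

Lemma form_resolvent_exists : exists W : R[i] -> endo H, W 0 = 1 /\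
  forall z f, cone m z -> z != 0 -> exists u, W z f = j u /\ solves z f u.
Proof.
have ex z : exists W : endo H, (z = 0 -> W = 1) /\
    forall f, cone m z -> z != 0 -> exists u, W f = j u /\ solves z f u.
  have [->|z0] := eqVneq z 0; first by exists 1; split.
  have [cz|ncz] := pselect (cone m z); last first.
    by exists 0; split=> [/eqP|//]; rewrite (negbTE z0).
  have [U HU] := choice (fun f => solves_exists f cz z0).
  have Wlin : linear (fun f => j (U f)).
    move=> c f g; rewrite -linearP; congr (j _).
    by apply: (solves_uniq cz z0 (HU _)); exact: solvesP.
  exists (Endo Wlin); split=> [/eqP|f _ _]; first by rewrite (negbTE z0).
  by exists (U f).
have [W HW] := choice ex; exists W; split; first by case: (HW 0) => ->.
by move=> z f; case: (HW z) => _; exact.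
Qed.

Variable W : R[i] -> endo H.
Hypotheses (W0 : W 0 = 1)
  (HW : forall z f, cone m z -> z != 0 -> exists u, W z f = j u /\ solves z f u).

Lemma form_resolvent_solves z f u : cone m z -> z != 0 -> solves z f u -> W z f = j u.
Proof.
move=> cz z0 fu; have [v [-> fv]] := HW f cz z0.
by congr (j _); exact: solves_uniq fv fu.
Qed.

Lemma bd_form_resolvent z : cone m z -> bd (W z) 1.
Proof.
move=> cz; have [->|z0] := eqVneq z 0; first by rewrite W0; exact: bd1.
move=> f; have [u [-> /(solves_energy cz) le]] := HW f cz z0.
rewrite mul1r -ler_sqr ?nnegrE ?rnorm_ge0//; apply: le_trans le.
by rewrite lerDl mulr_ge0 ?(mulr_ge0 (normc_ge0 _) (sqr_ge0 _))// mulr_ge0// ltW.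
Qed.

(** For nonzero parameters both sides are images under [j], and the difference of the preimages
    solves the homogeneous equation at [z]. *)
Lemma form_resolvent_identity z w : cone m z -> cone m w ->
  w *: W w - z *: W z = (w - z) *: (W z * W w).
Proof.
move=> cz cw; have [->|z0] := eqVneq z 0.
  by rewrite W0 scale0r !subr0 mul1r.
have [->|w0] := eqVneq w 0.
  by rewrite W0 scale0r !sub0r mulr1 scaleNr.
apply: endoP => f /=.
have [u [wu fu]] := HW f cw w0; have [u' [zu' fu']] := HW f cz z0.
have [s [zs us]] := HW (j u) cz z0.
rewrite /endoD /endoN /endoZ /endoM /= wu zu' zs -!linearZ/= -linearN -linearD/=.
congr (j _); apply/eqP; rewrite -subr_eq0; apply/eqP.
apply: (solves_uniq cz z0 (f := 0)).
  move=> v; rewrite [RHS]linear0l.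
  have aZ c x : a (c *: x) v = c * a x v by rewrite -[c *: x]addr0 a_linl a_0l addr0.
  have jZ c x : j (c *: x) = c *: j x by rewrite linearZ.
  rewrite !(raddfB j) /= !jZ !dotBl !dotZl !a_subl !aZ.
  have E1 := fu v; have E2 := fu' v; have E3 := us v.
  transitivity (w * dotH (j u) (j v) - z * dotH (j u') (j v) - (w - z) * dotH (j s) (j v)
    + (z * (w * a u v) - z * (z * a u' v) - (w - z) * (z * a s v))); first by ring.
  have -> : w * a u v = dotH f (j v) - dotH (j u) (j v) by rewrite -E1 addrAC subrr add0r.
  have -> : z * a u' v = dotH f (j v) - dotH (j u') (j v) by rewrite -E2 addrAC subrr add0r.
  have -> : z * a s v = dotH (j u) (j v) - dotH (j s) (j v) by rewrite -E3 addrAC subrr add0r.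
  ring.
move=> v; rewrite linear0 [dotH 0 _]linear0l.
by rewrite a_0l mulr0 addr0.
Qed.


(** Its square bounds the initial value of the Lyapunov function: [la |W f|^2 + |(1 - W) f|^2 <= (la
    + 4) |f|^2], as [1 - W] has norm at most [2]. *)
Definition ritt_constant : R := Num.sqrt (9 * M ^+ 2 / (16 * be ^+ 2) + 4).

(** The dissipation is available twice: [u'] solves the equation for [W z g], and [u - u'] solves it
    for [(1 - W z) g]. Testing the equation of [u'] with [u - u'] gives
    [|j (u - u')|^2 = z a(u', u - u')], which couples the two dissipation terms. *)
Lemma ritt_step z g n : cone m z -> z != 0 -> 1 <= n ->
  let la := 9 * M ^+ 2 / (16 * be ^+ 2) in
  la * rnorm (W z (W z g)) ^+ 2 + (n + 1) ^+ 2 * rnorm ((1 - W z) (W z g)) ^+ 2 <=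
  la * rnorm (W z g) ^+ 2 + n ^+ 2 * rnorm ((1 - W z) g) ^+ 2.
Proof.
move=> cz z0 n1; have [u [Wg gu]] := HW g cz z0.
have [u' [Wu uu']] := HW (j u) cz z0.
have D1 : (1 - W z) (W z g) = j (u - u') by rewrite [LHS]/= Wg linearB/= -Wu.
have gD : solves z ((1 - W z) g) (u - u').
  rewrite [(1 - W z) g]/= Wg => v.
  by rewrite a_subl linearB mulrBr !dotBl -gu -uu'; ring.
apply: (lyapunov_step (Y := normc z * rnorm u' ^+ 2) (Z := normc z * rnorm (u - u') ^+ 2)) => //.
- exact: ltW.
- by rewrite mulr_ge0 ?normc_ge0 ?sqr_ge0.
- by rewrite mulr_ge0 ?normc_ge0 ?sqr_ge0.
- exact: sqr_ge0.
- by rewrite Wg Wu; exact: (solves_energy cz uu').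
- by rewrite D1; exact: (solves_energy cz gD).
rewrite D1 (rnorm_sqr dotH_norm).
have -> : dotH (j (u - u')) (j (u - u')) = z * a u' (u - u').
  have := uu' (u - u'); rewrite linearB/= dotBl -linearB => <-.
  by rewrite addrAC subrr add0r.
have -> : M ^+ 2 * (normc z * rnorm u' ^+ 2 * (normc z * rnorm (u - u') ^+ 2)) =
  (normc z * (M * rnorm u' * rnorm (u - u'))) ^+ 2 by ring.
rewrite -real_normK ?num_real// ler_sqr ?nnegrE ?normr_ge0//; last first.
  by rewrite !mulr_ge0 ?normc_ge0 ?rnorm_ge0 ?ltW.
by rewrite (le_trans (ger_Re_normc _))// normcM ler_wpM2l ?normc_ge0.
Qed.

Lemma form_ritt z k : cone m z ->
  bd ((1 - W z) * W z ^+ k) (ritt_constant / k.+1%:R).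
Proof.
move=> cz; have [->|z0] := eqVneq z 0.
  rewrite W0 subrr mul0r; apply: bd_le (@bd0 _ _).
  by rewrite divr_ge0 ?sqrtr_ge0.
move=> f; set la := 9 * M ^+ 2 / (16 * be ^+ 2).
have la0 : 0 <= la by rewrite /la divr_ge0 ?(mulr_ge0 (ler0n _ _) (sqr_ge0 _)).
have W1 := bd_form_resolvent cz.
have potential : la * rnorm (W z ((W z ^+ k) f)) ^+ 2 +
    k.+1%:R ^+ 2 * rnorm ((1 - W z) ((W z ^+ k) f)) ^+ 2 <= (la + 4) * rnorm f ^+ 2.
  elim: k => [|k IH].
    rewrite expr0 expr1n mul1r mulrDl lerD//.
      rewrite ler_wpM2l// ler_sqr ?nnegrE ?rnorm_ge0//.
      by have := W1 f; rewrite mul1r.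
    rewrite (_ : 4 = 2 ^+ 2); last by ring.
    rewrite -exprMn ler_sqr ?nnegrE ?mulr_ge0 ?rnorm_ge0//.
    exact: (bdB (@bd1 _ _) W1).
  apply: le_trans IH; rewrite [in W z ^+ k.+1]exprS -[k.+2]addn1 natrD.
  by apply: ritt_step => //; rewrite ler1n.
have k0 : 0 < k.+1%:R :> R by [].
rewrite mulrAC ler_pdivlMr// -ler_sqr ?nnegrE ?mulr_ge0 ?sqrtr_ge0 ?rnorm_ge0//.
rewrite !exprMn sqr_sqrtr ?addr_ge0// -/la; apply: le_trans potential.
rewrite mulrC lerDr mulr_ge0//.
exact: sqr_ge0.
Qed.

Lemma form_resolvent_family : resolvent_family m ritt_constant W.
Proof.
split => //; [exact: bd_form_resolvent|exact: form_resolvent_identity|].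
by move=> z k; exact: form_ritt.
Qed.

(** The equation tested with [u - w] leaves [t (M |u| r - al r^2)] with [r = |u - w|]; its maximum
    over [r] is [t M^2 |u|^2 / (4 al)]. *)
Lemma form_resolvent_near1 t u : 0 < t ->
  rnorm (j u - W t%:C (j u)) ^+ 2 <= t * (M ^+ 2 * rnorm u ^+ 2 / (4 * al)).
Proof.
move=> t0; have t0' : t%:C != 0 by rewrite -normc_gt0 normc_real normr_gt0 gt_eqF.
have [w [-> uw]] := HW (j u) (cone_real m0 (ltW t0)) t0'.
have E : dotH (j (u - w)) (j (u - w)) + t%:C * a (u - w) (u - w) = t%:C * a u (u - w).
  have := uw (u - w); rewrite linearB/= dotBl -linearB => <-.
  by rewrite a_subl; ring.
have := congr1 (@complex.Re R) E.
rewrite ReD !Re_realM -(rnorm_sqr dotH_norm) linearB => E'.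
have h1 := a_coercive (u - w).
have h2 : complex.Re (a u (u - w)) <= M * rnorm u * rnorm (u - w).
  exact: le_trans (Re_le_normc _) (a_bound _ _).
have -> : rnorm (j u - j w) ^+ 2 = t * (complex.Re (a u (u - w)) - complex.Re (a (u - w) (u - w))).
  by rewrite mulrBr -E' addrK.
rewrite ler_pM2l// ler_pdivlMr ?mulr_gt0//.
have := sqr_ge0 (M * rnorm u - 2 * al * rnorm (u - w)).
have := ler_wpM2l (ltW al0) (lerB h2 h1).
set p := complex.Re _ - _; nra.
Qed.

Hypothesis j_dense : dense (range j).

Lemma form_resolvent_dense x e : 0 < e ->
  exists (s : R) (y : H), 0 < s /\ rnorm (x - W s%:C y) <= e.
Proof.
move=> e0; have e2 : 0 < e / 2 by rewrite divr_gt0.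
have [u xu] : exists u, rnorm (x - j u) <= e / 2.
  have e2c : 0 < (e / 2)%:C by rewrite ltcR.
  have := @j_dense (ball x (e / 2)%:C).
  case=> [||y [xy [u _ uy]]].
  - by exists x; exact: ballxx.
  - exact: ball_open.
  by exists u; rewrite uy; move: xy; rewrite -ball_normE /= normE ltcR => /ltW.
pose K := M ^+ 2 * rnorm u ^+ 2 / (4 * al).
have K0 : 0 <= K.
  exact: divr_ge0 (mulr_ge0 (sqr_ge0 _) (sqr_ge0 _)) (mulr_ge0 (ler0n _ 4) (ltW al0)).
have K1 : 0 < K + 1 by rewrite ltr_wpDl.
pose s := (e / 2) ^+ 2 / (K + 1).
have s0 : 0 < s by rewrite divr_gt0// exprn_gt0.
exists s, (j u); split=> //.
apply: le_trans (rnorm_triangle (j u) _ _) _; rewrite [leRHS]splitr lerD//.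
rewrite -ler_sqr ?nnegrE ?rnorm_ge0 ?(ltW e2)//.
apply: le_trans (form_resolvent_near1 u s0) _; rewrite -/K /s.
rewrite mulrAC ler_pdivrMr// ler_wpM2l ?sqr_ge0//.
by rewrite lerDl.
Qed.

End FormResolvent.
(** * Compact perturbations *)

Section TotallyBounded.
Variables (R : realType) (H : completeNormedModType R[i]).
Implicit Types (X Y : set H) (S T : endo H) (e r : R) (x y g : H).

(** Finite nets pass directly through sums, products and norm limits of operators;
    [tb_operator_compact] returns to [precompact]. *)
Definition totally_bounded X : Prop := forall e, 0 < e ->
  exists s : seq H, forall x, X x -> exists2 c, c \in s & rnorm (x - c) <= e.

Lemma totally_boundedS X Y : X `<=` Y -> totally_bounded Y -> totally_bounded X.
Proof. by move=> XY tY e /tY[s Hs]; exists s => x /XY/Hs. Qed.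

Lemma totally_boundedD X Y : totally_bounded X -> totally_bounded Y ->
  totally_bounded [set z | exists x y, [/\ X x, Y y & z = x + y]].
Proof.
move=> tX tY e e0; have e2 : 0 < e / 2 by rewrite divr_gt0.
have [s Hs] := tX _ e2; have [t Ht] := tY _ e2.
exists [seq c + d | c <- s, d <- t] => _ [x [y [Xx Yy ->]]].
have [c cs xc] := Hs _ Xx; have [d dt yd] := Ht _ Yy.
exists (c + d); first exact: allpairs_f.
by rewrite opprD addrACA [leRHS]splitr (le_trans (rnormD _ _))// lerD.
Qed.

Lemma totally_bounded_segment (K : R) g : 0 <= K ->
  totally_bounded [set (t%:C *: g) | t in [set t : R | `|t| <= K]].
Proof.
move=> K0 e e0; have g1 : 0 < rnorm g + 1 by rewrite ltr_wpDl ?rnorm_ge0.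
pose d := e / (rnorm g + 1); have d0 : 0 < d by rewrite divr_gt0.
have [N HN] : exists N, (Num.truncn (2 * K / d) < N)%N by eexists.
exists [seq ((- K + k%:R * d)%:C *: g) | k <- iota 0 N] => _ [t /= tK <-].
move: tK; rewrite ler_norml => /andP[Kt tK].
have tKd0 : 0 <= (t + K) / d by rewrite divr_ge0 ?(ltW d0)//; lra.
have /andP[lo hi] := truncn_itv tKd0; set k := Num.truncn ((t + K) / d) in lo hi.
exists ((- K + k%:R * d)%:C *: g).
  apply/mapP; exists k => //; rewrite mem_iota /= add0n.
  apply: leq_ltn_trans HN; apply: le_truncn.
  by rewrite ler_pM2r ?invr_gt0//; lra.
rewrite -scalerBl -rmorphB rnormZ normc_real.
have td : `|t - (- K + k%:R * d)| <= d.
  move: lo hi; rewrite ler_pdivlMr// ltr_pdivrMr// -natr1 mulrDl mul1r => lo hi.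
  by rewrite ler_norml; apply/andP; split; lra.
apply: le_trans (ler_wpM2r (rnorm_ge0 g) td) _.
by rewrite /d mulrAC ler_pdivrMr// ler_wpM2l ?(ltW e0)// lerDl.
Qed.

(** An ultrafilter that contains a finite union of balls contains one of them. It is therefore
    Cauchy and converges by completeness. *)
Lemma totally_bounded_precompact X : totally_bounded X -> precompact X.
Proof.
move=> tX; rewrite precompactE compact_ultra => F FU FX.
have split_union e (s : seq H) :
    F [set y | exists2 c, c \in s & rnorm (y - c) <= e] ->
    exists c, F [set y | rnorm (y - c) <= e].
  elim: s => [|c s IH] Fs.
    by have [y [? ?]] := filter_ex Fs.
  have [Fc|Fc] := in_ultra_setVsetC [set y | rnorm (y - c) <= e] FU.
    by exists c.
  apply: IH; apply: filterS (filterI Fs Fc) => y [[c' + yc'] yc].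
  rewrite inE => /orP[/eqP cc'|c's]; last by exists c'.
  by case: yc; rewrite /= -cc'.
have Fcauchy : cauchy F.
  apply: cauchy_exP => e e0.
  have eE : e = (complex.Re e)%:C by rewrite RRe_real// gtr0_real.
  have e0' : 0 < complex.Re e by rewrite -ltcR -eE.
  (* One quarter is for the net, one for passing from [X] to its closure, and the rest makes the
     final inequality strict. *)
  have e4 : 0 < complex.Re e / 4 by rewrite divr_gt0.
  have [s Hs] := tX _ e4.
  have [|c Fc] := split_union (complex.Re e / 2) s.
    apply: filterS FX => y Xy.
    have [x [Xx xy]] : X `&` ball y (complex.Re e / 4)%:C !=set0.
      by apply: Xy; apply: nbhsx_ballx; rewrite ltcR.
    have [c cs xc] := Hs _ Xx; exists c => //.
    apply: le_trans (rnorm_triangle x _ _) _.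
    rewrite (_ : complex.Re e / 2 = complex.Re e / 4 + complex.Re e / 4); last by lra.
    rewrite lerD//; move: xy; rewrite -ball_normE /= normE ltcR => /ltW //.
  exists c; apply: filterS Fc => y yc.
  rewrite -ball_normE /= normE eE ltcR rnorm_distC (le_lt_trans yc)//.
  by rewrite ltr_pdivrMr// ltr_pMr// ltr1n.
have /cvg_ex[p Fp] : cvg F by exact: cauchy_cvg.
exists p; split=> //; rewrite (closure_id (closure X)).1; last exact: closed_closure.
by move=> B Bp; have [y [? ?]] := filter_ex (filterI FX (Fp _ Bp)); exists y.
Qed.

Definition unit_image T : set H := [set T x | x in [set x | rnorm x <= 1]].

Definition tb_operator T : Prop := totally_bounded (unit_image T).

Lemma tb_operatorD S T : tb_operator S -> tb_operator T -> tb_operator (S + T).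
Proof.
move=> tS tT; apply: totally_boundedS (totally_boundedD tS tT).
by move=> _ [x x1 <-]; exists (S x), (T x); split => //; exists x.
Qed.

Lemma tb_operatorMl S T r : 0 <= r -> bd S r -> tb_operator T -> tb_operator (S * T).
Proof.
move=> r0 Sr tT e e0; have r1 : 0 < r + 1 by rewrite ltr_wpDl.
have [s Hs] := tT _ (divr_gt0 e0 r1); exists (map S s) => _ [x x1 <-].
have [|c cs Txc] := Hs (T x); first by exists x.
exists (S c); first exact: map_f.
rewrite [_ x]/= -linearB (le_trans (Sr _))//.
have rr : r <= r + 1 by rewrite lerDl.
apply: le_trans (ler_pM r0 (rnorm_ge0 _) rr Txc) _.
by rewrite mulrC divfK// gt_eqF.
Qed.

Lemma tb_operatorMr S T r : 0 <= r -> bd S r -> tb_operator T -> tb_operator (T * S).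
Proof.
move=> r0 Sr tT e e0; have r1 : 0 < r + 1 by rewrite ltr_wpDl.
have r1c : (r + 1)%:C != 0 by rewrite -normc_gt0 normc_real normr_gt0 gt_eqF.
have [s Hs] := tT _ (divr_gt0 e0 r1).
exists (map ( *:%R (r + 1)%:C) s) => _ [x x1 <-].
(* Division by [r + 1] instead of [r] brings [S x] into the unit ball even when [r = 0]. *)
pose y := ((r + 1)^-1)%:C *: S x.
have Sxy : S x = (r + 1)%:C *: y by rewrite scalerA -rmorphM mulfV ?gt_eqF// scale1r.
have [|c cs Tyc] := Hs (T y).
  exists y => //; rewrite /= rnormZ normc_real gtr0_norm ?invr_gt0//.
  rewrite mulrC ler_pdivrMr// mul1r (le_trans (Sr _))//.
  have := ler_wpM2l r0 x1; rewrite mulr1 => /le_trans; apply.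
  by rewrite lerDl.
exists ((r + 1)%:C *: c); first exact: map_f.
rewrite [_ x]/= /endoM/= Sxy linearZ -scalerBr rnormZ normc_real gtr0_norm//.
by rewrite mulrC -ler_pdivlMr.
Qed.

Lemma tb_operatorZ c T : tb_operator T -> tb_operator (c *: T).
Proof.
move=> tT; rewrite -[T]mul1r endo_scaleAl.
by apply: tb_operatorMl (normc_ge0 c) _ tT; rewrite -[normc c]mulr1; apply: bdZ; exact: bd1.
Qed.

Lemma tb_operator0 : tb_operator 0.
Proof.
move=> e e0; exists [:: 0] => _ [x _ <-]; exists 0; first by rewrite inE.
by rewrite subr0 rnorm0 ltW.
Qed.

Lemma tb_operator_limit T : (forall e, 0 < e -> exists2 S, tb_operator S & bd (T - S) e) ->
  tb_operator T.
Proof.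
move=> h e e0; have e2 : 0 < e / 2 by rewrite divr_gt0.
have [S tS TS] := h _ e2; have [s Hs] := tS _ e2; exists s => _ [x x1 <-].
have [|c cs Sxc] := Hs (S x); first by exists x.
exists c => //; rewrite (le_trans (rnorm_triangle (S x) _ _))// [leRHS]splitr lerD//.
by rewrite (le_trans (TS x))// ler_piMr// ltW.
Qed.

(** The real and imaginary parts of [f x] place the image in the sum of two real segments, along [g]
    and along [i g]. *)
Lemma tb_operator_rank1 T (f : H -> R[i]) K g : 0 <= K ->
  (forall x, normc (f x) <= K * rnorm x) -> (forall x, T x = f x *: g) -> tb_operator T.
Proof.
move=> K0 fK Tf; apply: totally_boundedS (totally_boundedD
  (totally_bounded_segment g K0) (totally_bounded_segment ('i%C *: g) K0)).
move=> _ [x /= x1 <-].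
have fx : normc (f x) <= K by rewrite (le_trans (fK x))// ler_piMr.
exists ((complex.Re (f x))%:C *: g), ((complex.Im (f x))%:C *: ('i%C *: g)); split.
- by exists (complex.Re (f x)) => //=; rewrite (le_trans (ger_Re_normc _)).
- by exists (complex.Im (f x)) => //=; rewrite (le_trans (ger_Im_normc _)).
by rewrite scalerA -scalerDl Tf [in LHS](complexE (f x)) mulrC.
Qed.

Lemma tb_operator_compact T : tb_operator T -> compact_operator T.
Proof.
move=> /totally_bounded_precompact; apply: precompact_subset.
by move=> _ [x /= x1 <-]; exists x => //=; move: x1; rewrite normE -[1]/(1%:C) lecR.
Qed.

End TotallyBounded.

(** * Compact differences of semigroups and exponential decay *)

Section EulerPerturbation.
Variables (R : realType) (H : completeNormedModType R[i]) (m Ca Cb : R).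
Variables Va Vb Ta Tb : R[i] -> endo H.
Hypotheses (HVa : resolvent_family m Ca Va) (HVb : resolvent_family m Cb Vb).
Hypothesis HTa : forall z, cone m z -> forall k,
  bd (euler Va k z - Ta z) (32 * Ca ^+ 2 / 2 ^+ k).
Hypothesis HTb : forall z, cone m z -> forall k,
  bd (euler Vb k z - Tb z) (32 * Cb ^+ 2 / 2 ^+ k).
Hypothesis tbV : forall z, cone m z -> tb_operator (Va z - Vb z).

Lemma tb_resolvent_pow z n : cone m z -> tb_operator (Va z ^+ n - Vb z ^+ n).
Proof.
move=> cz; have [[_ a1 _ _] [_ b1 _ _]] := (HVa, HVb).
elim: n => [|n IH]; first by rewrite subrr; exact: tb_operator0.
have -> : Va z ^+ n.+1 - Vb z ^+ n.+1 =
    Va z * (Va z ^+ n - Vb z ^+ n) + (Va z - Vb z) * Vb z ^+ n.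
  by rewrite !exprS mulrBr mulrBl addrA subrK.
apply: tb_operatorD; first exact: tb_operatorMl ler01 (a1 _ cz) IH.
exact: tb_operatorMr ler01 (bdX n (b1 _ cz)) (tbV cz).
Qed.

Lemma tb_semigroup_sub z : cone m z -> tb_operator (Ta z - Tb z).
Proof.
move=> cz; apply: tb_operator_limit => e e0.
have [N /(_ _ (leqnn N)) HN] := exp2_small (32 * Ca ^+ 2 + 32 * Cb ^+ 2) e0.
exists (euler Va N z - euler Vb N z).
  by apply: tb_resolvent_pow; apply: coneZ; rewrite // invr_ge0 exprn_ge0.
rewrite opprD addrACA -opprD; apply: (bd_le HN); rewrite mulrDl.
exact: bdB (bd_distC (HTa cz N)) (bd_distC (HTb cz N)).
Qed.

End EulerPerturbation.

Section EulerDecay.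
Variables (R : realType) (H : completeNormedModType R[i]) (m C ka : R).
Variables V T : R[i] -> endo H.
Hypotheses (m0 : 0 < m) (ka0 : 0 <= ka).
Hypothesis HT : forall z, cone m z -> forall k,
  bd (euler V k z - T z) (32 * C ^+ 2 / 2 ^+ k).
Hypothesis HV : forall t : R, 0 <= t -> bd (V t%:C) (1 + ka * t)^-1.

Lemma bd_semigroup_decay t : 0 <= t -> bd (T t%:C) (expR (- (ka * t))).
Proof.
move=> t0; apply: bd_addgt0 => e e0; have e2 : 0 < e / 2 by rewrite divr_gt0.
set x := ka * t; have x0 : 0 <= x by rewrite mulr_ge0.
(* With [w = x^2/n], the bound [1/2] allows [exp w <= 1 + 2 w], and [e/4] makes the excess at most
   [e/2]. *)
have e3 : 0 < Num.min (e / 4) 2^-1 by rewrite lt_min divr_gt0//= invr_gt0.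
have [N HN] := exp2_small (32 * C ^+ 2) e2.
have [N' HN'] := exp2_small (x ^+ 2) e3.
pose k := maxn N N'; pose n : R := 2 ^+ k; have n0 : 0 < n by rewrite exprn_gt0.
have {HN}hT := bd_le (HN k (leq_maxl _ _)) (HT (cone_real m0 t0) k).
have {HN'} : x ^+ 2 / n <= Num.min (e / 4) 2^-1 by apply: HN'; exact: leq_maxr.
rewrite le_min => /andP[xe x2].
have pw : bd (euler V k t%:C) (expR (- x) + e / 2).
  have tn0 : 0 <= t / n by rewrite divr_ge0// ltW.
  have hk : bd (V (t / n)%:C ^+ (2 ^ k)) ((1 + ka * (t / n))^-1 ^+ (2 ^ k)).
    elim: (2 ^ k)%N => [|i IH]; first exact: bd1.
    rewrite !exprS; apply: bdM => //; last exact: HV.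
    by rewrite invr_ge0 addr_ge0// mulr_ge0.
  rewrite /euler -rmorphM mulrC; apply: bd_le hk.
  have -> : ka * (t / n) = x / n by rewrite mulrA.
  pose y := x / n; have y0 : 0 <= y by rewrite divr_ge0// ltW.
  have y1 : 0 < 1 + y by rewrite addrC ltr_wpDl.
  (* [(1 + y)^-1 = 1 - y/(1+y) <= exp(- y/(1+y))] and [y/(1+y) >= y - y^2]. The power [n] then gives
     [exp(- x + x^2/n)], a quantitative form of [(1 + x/n)^-n -> exp(- x)]. *)
  have step : (1 + y)^-1 <= expR (- (y - y ^+ 2)).
    have h : (1 + y)^-1 = 1 + - (y / (1 + y)) by field; rewrite gt_eqF.
    rewrite h (le_trans (expR_ge1Dx _))// ler_expR lerN2 ler_pdivlMr//.
    have : 0 <= y ^+ 3 by rewrite exprn_ge0.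
    by lra.
  rewrite -/y; apply: (@le_trans _ _ (expR (- (y - y ^+ 2)) ^+ (2 ^ k))).
    by rewrite lerXn2r ?nnegrE ?invr_ge0 ?(ltW y1) ?expR_ge0.
  rewrite -expRM_natl natrX -/n.
  have -> : n * - (y - y ^+ 2) = - x + x ^+ 2 / n.
    by rewrite /y; field; rewrite gt_eqF.
  rewrite expRD; move: xe x2; set w := x ^+ 2 / n => we w2.
  have w0 : 0 <= w by rewrite divr_ge0 ?sqr_ge0 ?ltW.
  have ew : expR w <= 1 + 2 * w.
    have w1 : 0 < 1 - w by lra.
    have := expR_ge1Dx (- w); rewrite expRN => h.
    have hw : (1 - w) * expR w <= 1 by rewrite -ler_pdivlMr ?expR_gt0// mul1r.
    by rewrite -(ler_pM2l w1); apply: le_trans hw _; nra.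
  have ex1 : expR (- x) <= 1 by rewrite -[leRHS]expR0 ler_expR oppr_le0.
  have ex0 := expR_ge0 (- x).
  have := ler_wpM2l ex0 ew; nra.
have := bd_triangle (U := euler V k t%:C) (S := T t%:C) (T := 0) (bd_distC hT).
rewrite !subr0 => /(_ _ pw); apply: bd_le; lra.
Qed.

End EulerDecay.
(** * The rescaled semigroup and its generator *)

Section ComplexExponential.
Variable R : realType.
Implicit Types (z w h : R[i]) (x y e : R).

Definition cexp z : R[i] :=
  (expR (complex.Re z) * cos (complex.Im z)) +i* (expR (complex.Re z) * sin (complex.Im z)).

Lemma cexpD z w : cexp (z + w) = cexp z * cexp w.
Proof.
case: z w => x y [x' y']; rewrite /cexp /= expRD cosD sinD.
by apply/eqP; rewrite eq_complex /=; apply/andP; split; apply/eqP; ring.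
Qed.

Lemma cexp_real x : cexp x%:C = (expR x)%:C.
Proof. by rewrite /cexp /= cos0 sin0 mulr1 mulr0. Qed.

Lemma normc_cexp z : normc (cexp z) = expR (complex.Re z).
Proof.
rewrite /cexp /= !exprMn -mulrDr cos2Dsin2 mulr1 sqrtr_sqr.
by rewrite ger0_norm// expR_ge0.
Qed.

Lemma is_derive0_taylor (f : R -> R) df e : is_derive (0 : R) 1 f df -> 0 < e ->
  exists2 d, 0 < d & forall x, `|x| <= d -> `|f x - f 0 - x * df| <= e * `|x|.
Proof.
move=> [fd <-] e0.
have /cvgrPdist_le/(_ _ e0)/nbhs_normP[/= d d0 Hd] := fd.
have d2 : 0 < d / 2 by rewrite divr_gt0.
exists (d / 2) => // x xd; have [->|x0] := eqVneq x 0.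
  by rewrite subrr mul0r subr0 normr0 mulr0.
have xb : `|0 - x| < d.
  by rewrite sub0r normrN (le_lt_trans xd)// ltr_pdivrMr// ltr_pMr// ltr1n.
have /(_ x0) := Hd x xb.
rewrite /shift /= /GRing.scale/= mulr1 addr0.
rewrite -(ler_pM2r (_ : 0 < `|x|)) ?normr_gt0// => h; apply: le_trans h.
rewrite -normrM mulrBl mulrAC mulVf// mul1r.
by rewrite -[leRHS]normrN opprB mulrC.
Qed.

Lemma cexp_taylor e : 0 < e -> exists2 d, 0 < d & forall h, normc h <= d ->
  normc (cexp h - 1 - h) <= e * normc h.
Proof.
(* The real and the imaginary part contribute at most [3 e1 |h|] each, and [6 e1 <= e]. *)
move=> e0; pose e1 := Num.min (e / 8) 1.
have e10 : 0 < e1 by rewrite lt_min ltr01 divr_gt0.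
have e1e : e1 <= e / 8 by rewrite ge_min lexx.
have e11 : e1 <= 1 by rewrite ge_min lexx orbT.
have [d1 d10 H1] := is_derive0_taylor (is_derive_expR 0) e10.
have [d2 d20 H2] := is_derive0_taylor (is_derive_sin 0) e10.
have [d3 d30 H3] := is_derive0_taylor (is_derive_cos 0) e10.
pose d := Num.min (Num.min (Num.min d1 d2) d3) (e1 / 4).
have d0 : 0 < d by rewrite !lt_min d10 d20 d30 divr_gt0.
have dd1 : d <= d1 by rewrite !ge_min lexx.
have dd2 : d <= d2 by rewrite !ge_min lexx !orbT.
have dd3 : d <= d3 by rewrite !ge_min lexx !orbT.
have dd4 : d <= e1 / 4 by rewrite !ge_min lexx !orbT.
exists d => // h hd; set x := complex.Re h; set y := complex.Im h.
have xh : `|x| <= normc h by exact: ger_Re_normc.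
have yh : `|y| <= normc h by exact: ger_Im_normc.
have := H1 x (le_trans xh (le_trans hd dd1)).
have := H2 y (le_trans yh (le_trans hd dd2)).
have := H3 y (le_trans yh (le_trans hd dd3)).
rewrite expR0 sin0 cos0 subr0 oppr0 mulr0 subr0 !mulr1 => cosy siny expx.
have ex1 : `|expR x - 1| <= 2 * `|x|.
  rewrite -[expR x - 1](subrK x) (le_trans (ler_normD _ _))//.
  have := ler_wpM2r (normr_ge0 x) e11; move: expx; lra.
have ex2 : `|expR x| <= 2.
  rewrite -[expR x](subrK 1) (le_trans (ler_normD _ _))// normr1.
  by move: ex1; lra.
have hE : cexp h - 1 - h = (expR x * (cos y - 1) + (expR x - 1 - x)) +i*
    (expR x * (sin y - y) + (expR x - 1) * y).
  rewrite /cexp -/x -/y [in LHS](_ : h = x +i* y); last by rewrite /x /y; case: (h).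
  by apply/eqP; rewrite eq_complex /=; apply/andP; split; apply/eqP; ring.
have normc_le (u v : R) : normc (u +i* v) <= `|u| + `|v|.
  have -> : u +i* v = u%:C + (0 +i* v).
    by apply/eqP; rewrite eq_complex /= addr0 add0r !eqxx.
  by rewrite (le_trans (le_normcD _ _))// normc_real lerD2l /= expr0n add0r sqrtr_sqr.
rewrite hE (le_trans (normc_le _ _))//.
have b1 : `|expR x * (cos y - 1) + (expR x - 1 - x)| <= 3 * (e1 * normc h).
  rewrite (le_trans (ler_normD _ _))// normrM.
  have c1 : `|expR x| * `|cos y - 1| <= 2 * (e1 * `|y|) by rewrite ler_pM.
  have := ler_wpM2l (ltW e10) yh; have := ler_wpM2l (ltW e10) xh.
  by move: c1 expx; lra.
have b2 : `|expR x * (sin y - y) + (expR x - 1) * y| <= 3 * (e1 * normc h).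
  rewrite (le_trans (ler_normD _ _))// !normrM.
  have c1 : `|expR x| * `|sin y - y| <= 2 * (e1 * `|y|) by rewrite ler_pM.
  have x4 : 2 * `|x| <= e1 by move: (le_trans xh (le_trans hd dd4)); lra.
  have c2 : `|expR x - 1| * `|y| <= e1 * normc h.
    by rewrite ler_pM// (le_trans ex1).
  have := ler_wpM2l (ltW e10) yh.
  by move: c1 c2; lra.
have := ler_wpM2r (normc_ge0 h) e1e; move: b1 b2 (mulr_ge0 (ltW e0) (normc_ge0 h)); lra.
Qed.

End ComplexExponential.

(** * From operator bounds to limits, operator norm and essential norm *)

Section Bridges.
Variables (R : realType) (H : completeNormedModType R[i]).
Implicit Types (f : R -> H) (l x : H) (r e t : R).

Lemma cvg_at_right0P f l : (f t @[t --> 0^'+] --> l) <->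
  (forall e, 0 < e -> exists2 d, 0 < d & forall t, 0 < t -> t <= d -> rnorm (f t - l) <= e).
Proof.
split=> [fl e e0|h].
  have e0c : 0 < e%:C by rewrite ltcR.
  have /cvgrPdist_le/(_ _ e0c)/nbhs_normP[/= d d0 Hd] := fl.
  exists (d / 2); first by rewrite divr_gt0.
  move=> t t0 td; have tb : `|0 - t| < d.
    by rewrite sub0r normrN gtr0_norm// (le_lt_trans td)// ltr_pdivrMr// ltr_pMr// ltr1n.
  by have := Hd t tb t0; rewrite normE lecR rnorm_distC.
apply/cvgrPdist_le => e e0.
have eE : e = (complex.Re e)%:C by rewrite RRe_real// gtr0_real.
have e0' : 0 < complex.Re e by rewrite -ltcR -eE.
have [d d0 Hd] := h _ e0'.
apply/nbhs_normP; exists d => //= t /=; rewrite sub0r normrN => td t0.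
by rewrite normE eE lecR rnorm_distC Hd// ltW// (le_lt_trans (ler_norm t)).
Qed.

Lemma op_norm_le (g : H -> H) r : 0 <= r -> (forall x, rnorm (g x) <= r * rnorm x) ->
  op_norm g <= r.
Proof.
move=> r0 gr; apply: ge_sup; first by exists (rnorm (g 0)), 0; rewrite //= normr0 ler01.
move=> _ [x /= x1 <-]; rewrite (le_trans (gr x))// ler_piMr//.
by move: x1; rewrite normE -[1]/(1%:C) lecR.
Qed.

Lemma op_norm_ge0 (g : H -> H) : 0 <= op_norm g.
Proof.
rewrite /op_norm; set S := [set _ | _ in _].
(* A set without supremum has [sup] equal to [0] by convention. *)
have [hs|hs] := pselect (has_sup S); last by rewrite sup_out.
have [[s Ss] ub] := hs.
have s0 : 0 <= s by case: Ss => x _ <-; exact: rnorm_ge0.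
by apply: le_trans s0 _; exact: ub_le_sup.
Qed.

Lemma bd_continuous (T : endo H) r : bd T r -> continuous T.
Proof. exact: rbound_linear_continuous. Qed.

Lemma bd_op_differentiable (T : R[i] -> endo H) (D : endo H) z r : bd D r ->
  (forall e, 0 < e -> exists2 d, 0 < d & forall h, h != 0 -> normc h <= d ->
     bd (h^-1 *: (T (z + h) - T z) - D) e) ->
  op_differentiable T z.
Proof.
move=> Dr hT; exists D; first exact: bd_continuous Dr.
apply/cvgrPdist_le => e e0; have [d d0 Hd] := hT e e0.
have : nbhs (0 : R[i]^o) [set h : R[i]^o | normc h < d].
  have d0c : 0 < d%:C by rewrite ltcR.
  apply: filterS (@nbhs0_lt R[i] R[i]^o _ d0c) => h /=.
  by rewrite normcE ltcR.
apply: filterS => h /= hd h0.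
rewrite sub0r normrN ger0_norm ?op_norm_ge0//.
by apply: op_norm_le; [exact: ltW|exact: Hd h0 (ltW hd)].
Qed.

Lemma ess_norm_le (T K : endo H) r : 0 <= r -> tb_operator K -> bd (T - K) r ->
  ess_norm T <= r.
Proof.
move=> r0 tK TK; apply: (@le_trans _ _ (op_norm (fun x => T x - K x))).
  apply: ge_inf; first by exists 0 => _ [L _ <-]; exact: op_norm_ge0.
  by exists (endo_fun K) => //; exact: tb_operator_compact.
exact: op_norm_le.
Qed.

End Bridges.
(** Half of the opening [m] is kept in reserve, so that every point of the sector has a whole disc
    inside the cone. Near angle [0] one has [cos > 1/2] and [|sin| < m/4]. *)
Lemma sector_in_cone (R : realType) (m : R) : 0 < m ->
  exists2 theta : R, 0 < theta <= pi / 2 & forall z : R[i], sector theta z ->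
    0 < complex.Re z /\ `|complex.Im z| <= m / 2 * complex.Re z.
Proof.
move=> m0; have h2 : 0 < 2^-1 :> R by rewrite invr_gt0.
have m4 : 0 < m / 4 by rewrite divr_gt0.
have /cvgrPdist_lt/(_ _ h2)/nbhs_normP[/= d d0 Hd] := @continuous_cos R 0.
have /cvgrPdist_lt/(_ _ m4)/nbhs_normP[/= d' d'0 Hd'] := @continuous_sin R 0.
pose theta := Num.min (Num.min d d') (pi / 2 : R).
have pi2 : 0 < pi / 2 :> R by rewrite divr_gt0// pi_gt0.
exists theta; first by rewrite !lt_min d0 d'0 pi2/= ge_min lexx orbT.
move=> _ [r [phi [r0 phit ->]]] /=.
have := Hd phi; have := Hd' phi; rewrite /ball_ /= !sub0r !normrN.
move: phit; rewrite !lt_min => /andP[/andP[pd pd'] _] /(_ pd') + /(_ pd).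
rewrite cos0 sin0 sub0r normrN => s c.
have {c} : 2^-1 < cos phi by move: c; rewrite ltr_norml => /andP[]; lra.
move=> c; split; first by rewrite mulr_gt0//; lra.
rewrite normrM gtr0_norm// mulrCA ler_wpM2l ?(ltW r0)//.
by apply: le_trans (ltW s) _; move: c m0; nra.
Qed.

(** The product rule for the exponential times [T]: [A] and [B] are the values of [T] at [z + h] and
    [z], [G] is its derivative, [e] the growth factor of [h]. Each of the three terms on the right
    tends to [0] with [h]. *)
Lemma difference_quotient_split (K : fieldType) (E : lmodType K) (h e om : K) (A B G : E) :
  h != 0 -> h^-1 *: (e *: A - B) - (om *: B + G) =
  e *: (h^-1 *: (A - B - h *: G)) + (e - 1) *: G + (h^-1 * (e - 1 - om * h)) *: B.
Proof.
move=> h0; have -> : h^-1 * (e - 1 - om * h) = e * h^-1 - h^-1 - om by field.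
rewrite !scalerBr !scalerBl !scalerA -!mulrA mulVf// mulr1 scale1r (mulrC h^-1 e).
move: ((e * h^-1) *: A) ((e * h^-1) *: B) (h^-1 *: B) (e *: G) (om *: B) => a b c g o.
rewrite opprD !addrA subrK (addrAC (a - b)) subrK.
by rewrite (addrAC a (- G)) (addrAC (a - c)).
Qed.

Section RescaledSemigroup.
Variables (R : realType) (H : completeNormedModType R[i]) (m C om : R).
Hypotheses (m0 : 0 < m) (C0 : 0 <= C) (om0 : 0 <= om).
Variable V : R[i] -> endo H.
Hypothesis HV : resolvent_family m C V.
Hypothesis V_dense : forall x e, 0 < e ->
  exists (s : R) (y : H), 0 < s /\ rnorm (x - V s%:C y) <= e.
Variable T : R[i] -> endo H.
Hypothesis HT : forall z, cone m z -> forall k,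
  bd (euler V k z - T z) (32 * C ^+ 2 / 2 ^+ k).
Implicit Types (z w h : R[i]) (s t e r : R) (x y : H).

Definition growth z : R[i] := cexp (om%:C * z).

Definition rescaled z : endo H := growth z *: T z.

Lemma growthD z w : growth (z + w) = growth z * growth w.
Proof. by rewrite /growth mulrDr cexpD. Qed.

Lemma growth_real t : growth t%:C = (expR (om * t))%:C.
Proof. by rewrite /growth -rmorphM cexp_real. Qed.

Lemma normc_growth z : normc (growth z) = expR (om * complex.Re z).
Proof. by rewrite normc_cexp Re_realM. Qed.

Lemma growth_taylor e : 0 < e -> exists2 d, 0 < d & forall h, normc h <= d ->
  normc (growth h - 1 - om%:C * h) <= e * normc h.
Proof.
move=> e0; have om1 : 0 < om + 1 by rewrite ltr_wpDl.
have [d d0 Hd] := @cexp_taylor R _ (divr_gt0 e0 om1).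
exists (d / (om + 1)); first by rewrite divr_gt0.
move=> h; rewrite ler_pdivlMr// => hd.
have nh := normc_ge0 h.
have omh : normc (om%:C * h) <= (om + 1) * normc h.
  by rewrite normcM normc_real ger0_norm// ler_wpM2r// lerDl.
apply: le_trans (Hd _ _) _; first by apply: le_trans omh _; rewrite mulrC.
apply: (@le_trans _ _ (e / (om + 1) * ((om + 1) * normc h))).
  by rewrite ler_wpM2l// divr_ge0 ?ltW.
by rewrite mulrA divfK// gt_eqF.
Qed.

Lemma growth_sub1 : exists2 d, 0 < d & forall h, normc h <= d ->
  normc (growth h - 1) <= (om + 1) * normc h.
Proof.
have [d d0 Hd] := growth_taylor ltr01; exists d => // h /Hd; rewrite mul1r => le1.
rewrite -[growth h - 1](subrK (om%:C * h)) (le_trans (le_normcD _ _))//.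
by rewrite normcM normc_real ger0_norm//; lra.
Qed.

Lemma bd_rescaled z : cone m z -> bd (rescaled z) (expR (om * complex.Re z)).
Proof.
move=> cz; rewrite -normc_growth -[normc _]mulr1.
exact: bdZ (bd_semigroup HV HT cz).
Qed.

Lemma bd_rescaled_real t : 0 <= t -> bd (rescaled t%:C) (expR (om * t)).
Proof. by move=> t0; exact: bd_rescaled (cone_real m0 t0). Qed.

Lemma rescaledD s t x : 0 <= s -> 0 <= t ->
  rescaled (s + t)%:C x = rescaled s%:C (rescaled t%:C x).
Proof.
move=> s0 t0; rewrite /rescaled rmorphD/= growthD.
rewrite (semigroupD m0 C0 HV HT (cone_real m0 s0) (cone_real m0 t0)).
  by rewrite /endoZ /endoM /= linearZ scalerA.
rewrite -rmorphM -rmorphD !normc_real real_normK ?num_real//.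
by rewrite ger0_norm ?mulr_ge0//; nra.
Qed.

Lemma rescaled_near1 x e : 0 < e -> exists2 d, 0 < d & forall t,
  0 < t -> t <= d -> rnorm (rescaled t%:C x - x) <= e.
Proof.
move=> e0; have e2 : 0 < e / 2 by rewrite divr_gt0.
have [d d0 Hd] := semigroup_near1 m0 HV V_dense HT x e2.
have [d' d'0 Hd'] := growth_sub1.
have K0 : 0 < (om + 1) * (rnorm x + 1).
  by rewrite mulr_gt0 ?ltr_wpDl ?rnorm_ge0.
exists (Num.min (Num.min d d') (e / 2 / ((om + 1) * (rnorm x + 1)))).
  by rewrite !lt_min d0 d'0 divr_gt0.
move=> t t0; rewrite !le_min => /andP[/andP[td td'] te].
have nt : normc t%:C = t by rewrite normc_real gtr0_norm.
have -> : rescaled t%:C x - x =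
    (growth t%:C - 1) *: T t%:C x + (T t%:C x - x).
  by rewrite scalerBl scale1r addrA subrK.
rewrite (le_trans (rnormD _ _))// [leRHS]splitr lerD ?Hd ?(ltW t0)//.
rewrite rnormZ; have := Hd' t%:C; rewrite nt => /(_ td') g1.
have Tx := bd_semigroup HV HT (cone_real m0 (ltW t0)) x; rewrite mul1r in Tx.
apply: le_trans (ler_pM (normc_ge0 _) (rnorm_ge0 _) g1 Tx) _.
move: te; rewrite ler_pdivlMr//; apply: le_trans.
rewrite (mulrC (om + 1) t) -mulrA ler_wpM2l ?(ltW t0)//.
by rewrite ler_wpM2l ?addr_ge0// lerDl.
Qed.

Lemma rescaled_C0 : C0_semigroup (fun t => rescaled t%:C).
Proof.
split.
- by move=> t t0; exact: bd_continuous (bd_rescaled_real t0).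
- move=> x; rewrite /rescaled (semigroup0 HV HT) growth_real mulr0 expR0.
  by rewrite /= /endoZ/= scale1r.
- by move=> s t x s0 t0; exact: rescaledD.
- by move=> x; apply/cvg_at_right0P => e e0; exact: rescaled_near1.
Qed.

Lemma rescaled_differentiable z rho : cone m z -> z != 0 -> 0 < rho ->
  (forall h, normc h <= rho -> cone m (z + h)) -> op_differentiable rescaled z.
Proof.
move=> cz z0 rho0 czh; have nz0 : 0 < normc z by rewrite normc_gt0.
have [G HG] := semigroup_derivative m0 C0 HV HT cz z0.
set K := 256 * C ^+ 2 / normc z ^+ 2 in HG.
have K0 : 0 <= K by rewrite /K divr_ge0 ?(mulr_ge0 (ler0n _ _) (sqr_ge0 _)) ?sqr_ge0.
(* The derivative is so far only a linear map. Its bound is read off from the Taylor estimate at a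
   single nonzero increment. *)
have [g g0 Gg] : exists2 g, 0 <= g & bd G g.
  pose t : R := Num.min rho (normc z / 2) / normc z.
  have t0 : 0 < t by rewrite divr_gt0// lt_min rho0 divr_gt0.
  pose h := t%:C * z; have nh : normc h = t * normc z by rewrite normcM normc_real gtr0_norm.
  have hm : normc h = Num.min rho (normc z / 2) by rewrite nh divfK// gt_eqF.
  have h0 : h != 0 by rewrite -normc_gt0 nh mulr_gt0.
  have czh' : cone m (z + h) by apply: czh; rewrite hm ge_min lexx.
  have hz : normc h <= normc z / 2 by rewrite hm ge_min lexx orbT.
  exists (normc h^-1 * (1 + 1 + K * normc h ^+ 2)).
    by rewrite mulr_ge0 ?normc_ge0// !addr_ge0// mulr_ge0// sqr_ge0.
  have -> : G = h^-1 *: ((T (z + h) - T z) - (T (z + h) - T z - h *: G)).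
    by rewrite subKr scalerA mulVf// scale1r.
  apply: bdZ; apply: bdB; last exact: HG.
  by apply: bdB; [exact: (bd_semigroup HV HT czh')|exact: (bd_semigroup HV HT cz)].
have q0 : 0 < normc (growth z) by rewrite normc_growth expR_gt0.
set q := normc (growth z) in q0.
have Tz1 := bd_semigroup HV HT cz.
pose D : endo H := growth z *: (om%:C *: T z + G).
apply: (@bd_op_differentiable _ _ rescaled D z (q * (om * 1 + g))).
  apply: bdZ; apply: bdD => //; rewrite -[om in om * 1](ger0_norm om0) -normc_real.
  exact: bdZ.
move=> e e0; have e1 : 0 < e / 2 / q by rewrite !divr_gt0.
have [d d0 Hd] := growth_taylor e1.
have [d' d'0 Hd'] := growth_sub1.
pose B := 2 * K + (om + 1) * g + 1.
have B0 : 0 < B by rewrite ltr_wpDl// addr_ge0// mulr_ge0// addr_ge0.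
have om1 : 0 < om + 1 by rewrite ltr_wpDl.
(* The bounds by [rho] and [normc z / 2] admit [h] in [semigroup_derivative], the one by
   [(om + 1)^-1] gives [|growth h| <= 2], and [B] collects the coefficients of [|h|] in the
   error. *)
pose d0' := Num.min (Num.min (Num.min d d') (Num.min rho (normc z / 2)))
  (Num.min ((om + 1)^-1) (e / 2 / q / B)).
exists d0'.
  by rewrite !lt_min d0 d'0 rho0 invr_gt0 om1 !divr_gt0.
move=> h h0; rewrite !le_min => /andP[/andP[/andP[hd hd'] /andP[hr hz]] /andP[ho hB]].
have nh0 : 0 < normc h by rewrite normc_gt0.
set eh := growth h.
have eh1 : normc (eh - 1) <= (om + 1) * normc h by exact: Hd'.
have eh2 : normc eh <= 2.
  rewrite -[eh](subrK 1) (le_trans (le_normcD _ _))// normc1.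
  have : (om + 1) * normc h <= 1 by rewrite mulrC -ler_pdivlMr// mul1r.
  by move: eh1; lra.
have -> : h^-1 *: (rescaled (z + h) - rescaled z) - D =
    growth z *: (eh *: (h^-1 *: (T (z + h) - T z - h *: G)) + (eh - 1) *: G +
      (h^-1 * (eh - 1 - om%:C * h)) *: T z).
  have swap (x : endo H) : h^-1 *: (growth z *: x) = growth z *: (h^-1 *: x).
    by rewrite !scalerA mulrC.
  rewrite /rescaled /D growthD -/eh -[(growth z * eh) *: _]scalerA -scalerBr swap -scalerBr.
  by congr (_ *: _); exact: difference_quotient_split.
have hA : bd (h^-1 *: (T (z + h) - T z - h *: G)) (K * normc h).
  have := bdZ h^-1 (HG h (czh _ hr) hz); apply: bd_le.
  by rewrite normcV expr2 [leLHS]mulrC -!mulrA mulfV ?gt_eqF// mulr1.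
have hB' : bd ((h^-1 * (eh - 1 - om%:C * h)) *: T z) (e / 2 / q * 1).
  have hle : normc (h^-1 * (eh - 1 - om%:C * h)) <= e / 2 / q.
    by rewrite normcM normcV mulrC ler_pdivrMr// Hd.
  apply: bd_le (bdZ _ Tz1); rewrite !mulr1; exact: hle.
have main := bdZ (growth z) (bdD (bdD (bdZ eh hA) (bdZ (eh - 1) Gg)) hB').
apply: bd_le main; rewrite -/q mulr1.
have s1 : normc eh * (K * normc h) <= 2 * (K * normc h).
  by rewrite ler_wpM2r// mulr_ge0// ltW.
have s2 : normc (eh - 1) * g <= (om + 1) * normc h * g by rewrite ler_wpM2r.
have s3 : B * normc h <= e / 2 / q by rewrite mulrC -ler_pdivlMr.
have : normc eh * (K * normc h) + normc (eh - 1) * g + e / 2 / q <= e / q.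
  have -> : e / q = e / 2 / q + e / 2 / q by field; rewrite gt_eqF.
  rewrite lerD2r; apply: le_trans s3; rewrite /B.
  by move: s1 s2 nh0; lra.
by rewrite ler_pdivlMr// mulrC.
Qed.

Lemma rescaled_holomorphic : holomorphic_C0_semigroup (fun t => rescaled t%:C).
Proof.
split; first exact: rescaled_C0.
have [theta th0 thcone] := sector_in_cone m0.
have in_cone z : sector theta z -> cone m z.
  move=> /thcone[z0 zm]; rewrite /cone (le_trans zm)// ler_wpM2r ?(ltW z0)//.
  by rewrite ler_pdivrMr// ler_peMr ?(ltW m0)// ler1n.
exists theta, rescaled; split => //.
- by move=> z /in_cone cz; exact: bd_continuous (bd_rescaled cz).
- move=> z sz; have [z0 zm] := thcone _ sz.
  (* Adding [h] changes [|Im z| - m Re z] by at most [(1 + m) |h|], and the smaller sector leaves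
     the slack [(m/2) Re z]. *)
  have rho0 : 0 < m / 2 * complex.Re z / (1 + m).
    by rewrite divr_gt0 ?addr_gt0// mulr_gt0// divr_gt0.
  apply: rescaled_differentiable rho0 _; first exact: in_cone.
    by apply: contraTneq z0 => ->; rewrite ltxx.
  move=> h; rewrite ler_pdivlMr ?addr_gt0// => hz.
  rewrite /cone ImD ReD (le_trans (ler_normD _ _))// mulrDr.
  have h1 := ger_Im_normc h; have h2 := ger_Re_normc h.
  have : - normc h <= complex.Re h by move: h2; rewrite ler_norml => /andP[].
  by move=> /(ler_wpM2l (ltW m0)); lra.
move=> theta' /andP[th0' th']; exists (expR om) => z [r [phi [r0 pt zE]]] z1.
have sz : sector theta z by exists r, phi; split => //; exact: lt_trans th'.
apply: op_norm_le => [|x]; first exact: expR_ge0.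
apply: bd_le (bd_rescaled (in_cone _ sz)) x; rewrite ler_expR ler_piMr//.
by move: z1; rewrite normcE -[1]/(1%:C) lecR; apply: le_trans; exact: Re_le_normc.
Qed.

End RescaledSemigroup.

(** * Identification of the generator *)

Section RescaledGenerator.
Variables (R : realType) (H : completeNormedModType R[i]) (m C om : R).
Hypotheses (m0 : 0 < m) (om0 : 0 <= om).
Variable V : R[i] -> endo H.
Hypothesis HV : resolvent_family m C V.
Hypothesis V_dense : forall x e, 0 < e ->
  exists (s : R) (y : H), 0 < s /\ rnorm (x - V s%:C y) <= e.
Variable T : R[i] -> endo H.
Hypothesis HT : forall z, cone m z -> forall k,
  bd (euler V k z - T z) (32 * C ^+ 2 / 2 ^+ k).
Implicit Types (t e : R) (w x y : H).
Local Notation S t := (rescaled om T t%:C).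

Definition derivative_at0 x y : Prop := forall e, 0 < e -> exists2 d, 0 < d &
  forall t, 0 < t -> t <= d -> rnorm (S t x - x - t%:C *: y) <= e * t.

Lemma generatorP x y : generator (fun t => S t) (x, y) <-> derivative_at0 x y.
Proof.
have quotient t : 0 < t -> rnorm ((t^-1)%:C *: (S t x - x) - y) =
    t^-1 * rnorm (S t x - x - t%:C *: y).
  move=> t0; have -> : (t^-1)%:C *: (S t x - x) - y =
      (t^-1)%:C *: (S t x - x - t%:C *: y).
    rewrite [RHS]scalerBr; congr (_ - _); rewrite scalerA -rmorphM.
    by rewrite mulVf ?gt_eqF// scale1r.
  by rewrite rnormZ normc_real gtr0_norm ?invr_gt0.
split.
  move=> /(cvg_at_right0P (fun t => (t^-1)%:C *: (S t x - x))) h e /h[d d0 Hd].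
  exists d => // t t0 /(Hd t t0); rewrite quotient// mulrC ler_pdivrMr//.
move=> h; apply/(cvg_at_right0P (fun t => (t^-1)%:C *: (S t x - x))) => e /h[d d0 Hd].
exists d => // t t0 /(Hd t t0); rewrite quotient// => le1.
by rewrite mulrC ler_pdivrMr.
Qed.

Lemma derivative_at0B x y x' y' : derivative_at0 x y -> derivative_at0 x' y' ->
  derivative_at0 (x - x') (y - y').
Proof.
move=> hx hx' e e0; have e2 : 0 < e / 2 by rewrite divr_gt0.
have [d d0 Hd] := hx _ e2; have [d' d'0 Hd'] := hx' _ e2.
exists (Num.min d d'); first by rewrite lt_min d0.
move=> t t0; rewrite le_min => /andP[td td'].
have -> : S t (x - x') - (x - x') - t%:C *: (y - y') =
    (S t x - x - t%:C *: y) - (S t x' - x' - t%:C *: y').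
  have -> : S t (x - x') = S t x - S t x' by rewrite linearB.
  rewrite scalerBr.
  have sub2 (p q u v : H) : (p - q) - (u - v) = (p - u) - (q - v).
    by rewrite opprD addrACA -opprD.
  by rewrite (sub2 (S t x)) [LHS]sub2.
rewrite (le_trans (rnormB _ _))// [e]splitr mulrDl lerD//.
  exact: Hd.
exact: Hd'.
Qed.

(** As [V 1] stands for [(1 + A)^-1], the vector [x = V 1 w] satisfies [A x = w - x]; the factor
    [exp(om t)] adds [om x] to the derivative [- A x]. *)
Lemma derivative_at0_resolvent w :
  derivative_at0 (V 1 w) (om%:C *: V 1 w - (w - V 1 w)).
Proof.
set x := V 1 w; set g := w - x => e e0.
have x1 : 0 < rnorm x + 1 by rewrite ltr_wpDl ?rnorm_ge0.
have g1 : 0 < rnorm g + 1 by rewrite ltr_wpDl ?rnorm_ge0.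
have om1 : 0 < om + 1 by rewrite ltr_wpDl.
pose e1 := e / 4 / (rnorm x + 1); have e10 : 0 < e1 by rewrite !divr_gt0.
have [d d0 Hd] := semigroup_taylor m0 HV V_dense HT w (ltr01 : 0 < 1 :> R) e10.
have [d' d'0 Hd'] := growth_taylor om0 e10.
have [d'' d''0 Hd''] := growth_sub1 om0.
pose d3 := Num.min (om + 1)^-1 (e / 2 / ((om + 1) * (rnorm g + 1))).
have d30 : 0 < d3 by rewrite lt_min invr_gt0 om1 !divr_gt0// mulr_gt0.
exists (Num.min (Num.min d d') (Num.min d'' d3)).
  by rewrite !lt_min d0 d'0 d''0 -lt_min.
move=> t t0; rewrite !le_min => /andP[/andP[td td'] /and3P[td'' to tg]].
have nt : normc t%:C = t by rewrite normc_real gtr0_norm.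
have := Hd t (ltW t0) td; rewrite divr1 -[(1 : R)%:C]/(1 : R[i]) -/x -/g => h1.
have := Hd' t%:C; rewrite nt => /(_ td') h2.
have := Hd'' t%:C; rewrite nt => /(_ td'') h3.
set E := growth om t%:C in h2 h3 *; clearbody g.
have -> : S t x - x - t%:C *: (om%:C *: x - g) =
    E *: (T t%:C x - (x - t%:C *: g)) + (E - 1 - om%:C * t%:C) *: x - (E - 1) *: (t%:C *: g).
  rewrite [S t x]/= /endoZ /= -/E.
  rewrite !scalerBr !scalerBl !scale1r !scalerA (mulrC t%:C om%:C).
  move: (E *: T t%:C x) (E *: x) ((E * t%:C) *: g) ((om%:C * t%:C) *: x) (t%:C *: g) => a b c o f.
  rewrite !opprB !addrA subrK [LHS]addrAC (addrC a c).
  by rewrite -!(addrA c) (addrC c) subrK.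
have E2 : normc E <= 2.
  rewrite -[E](subrK 1) (le_trans (le_normcD _ _))// normc1.
  have : (om + 1) * t <= 1 by rewrite mulrC -ler_pdivlMr// mul1r.
  by move: h3; lra.
have b1 : rnorm (E *: (T t%:C x - (x - t%:C *: g))) <= 2 * (e1 * t).
  by rewrite rnormZ ler_pM ?normc_ge0 ?rnorm_ge0.
have b2 : rnorm ((E - 1 - om%:C * t%:C) *: x) <= e1 * t * rnorm x.
  by rewrite rnormZ ler_wpM2r ?rnorm_ge0.
have b3 : rnorm ((E - 1) *: (t%:C *: g)) <= (om + 1) * t * (t * rnorm g).
  by rewrite !rnormZ nt ler_wpM2r// mulr_ge0 ?rnorm_ge0// ltW.
apply: le_trans (rnormB _ _) _; apply: le_trans (lerD (rnormD _ _) b3) _.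
apply: le_trans (lerD (lerD b1 b2) (lexx _)) _.
have e1E : e1 * (rnorm x + 1) = e / 4 by rewrite /e1 divfK// gt_eqF.
have x0 := rnorm_ge0 x; have g0 := rnorm_ge0 g.
have b4 : 2 * (e1 * t) + e1 * t * rnorm x <= e / 2 * t.
  have -> : e / 2 = 2 * (e1 * (rnorm x + 1)) by rewrite e1E; lra.
  by have := mulr_ge0 (mulr_ge0 (ltW e10) (ltW t0)) x0; lra.
have b5 : (om + 1) * t * (t * rnorm g) <= e / 2 * t.
  have -> : (om + 1) * t * (t * rnorm g) = t * ((om + 1) * rnorm g) * t by ring.
  rewrite ler_wpM2r ?(ltW t0)//.
  move: tg; rewrite ler_pdivlMr ?mulr_gt0//; apply: le_trans.
  by rewrite ler_wpM2l ?(ltW t0)// ler_wpM2l ?(ltW om1)// lerDl.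
by move: b4 b5; lra.
Qed.

(** Comparison with [x' = V 1 w], whose derivative is known, gives a vector [d = x - x'] with
    derivative [(1 + om) d] at [0]. Since the semigroup grows at most like [exp(om t)], this forces
    [d = 0]. *)
Lemma resolvent_of_derivative_at0 x y : derivative_at0 x y ->
  x = V 1 (x + (om%:C *: x - y)).
Proof.
set w := x + _ => hxy; set x' := V 1 w.
have om1 : 0 < om + 1 by rewrite ltr_wpDl.
have := derivative_at0B hxy (derivative_at0_resolvent w); rewrite -/x'.
have -> : y - (om%:C *: x' - (w - x')) = (1 + om)%:C *: (x - x').
  rewrite rmorphD scalerDl scale1r scalerBr /w.
  move: (om%:C *: x) (om%:C *: x') => a b.
  rewrite opprB (addrAC x) -(addrA (x - x')) (addrCA y); congr (_ + _).
  by rewrite (addrAC a) addrC subrK.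
set d := x - x' => hd; apply/eqP; rewrite -subr_eq0; apply/eqP.
apply: contrapT => /eqP d0; have dn : 0 < rnorm d by rewrite rnorm_gt0.
have d1 : 0 < rnorm d + 1 by rewrite addr_gt0.
(* The comparison yields [|d| <= e (|d| + 1)], which for this [e] reads [|d| <= |d| / 2]. *)
pose e := rnorm d / 2 / (rnorm d + 1); have e0 : 0 < e by rewrite !divr_gt0.
have [r r0 Hr] := hd _ e0; have [r' r'0 Hr'] := growth_taylor om0 e0.
pose t := Num.min r r'; have t0 : 0 < t by rewrite lt_min r0.
have tr : t <= r by rewrite ge_min lexx.
have nt : normc t%:C = t by rewrite normc_real gtr0_norm.
have := Hr' t%:C; rewrite nt ge_min lexx orbT => /(_ isT).
rewrite growth_real -rmorphM -[1]/(1%:C) -!rmorphB normc_real => hE.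
have hS := bd_rescaled_real om m0 HV HT (ltW t0) d.
have : (1 + t * (1 + om)) * rnorm d <= rnorm (S t d) + e * t.
  have -> : (1 + t * (1 + om)) * rnorm d = rnorm (d + t%:C *: ((1 + om)%:C *: d)).
    have -> : d + t%:C *: ((1 + om)%:C *: d) = (1 + t * (1 + om))%:C *: d.
      by rewrite scalerA [in RHS]rmorphD rmorphM scalerDl scale1r.
    by rewrite rnormZ normc_real ger0_norm// addr_ge0// mulr_ge0 ?ltW// addrC.
  have -> : d + t%:C *: ((1 + om)%:C *: d) = S t d - (S t d - d - t%:C *: ((1 + om)%:C *: d)).
    have subKD (p q v : H) : v + q = p - (p - v - q) by rewrite -addrA -opprD subKr.
    exact: subKD.
  by rewrite (le_trans (rnormB _ _))// lerD2l Hr.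
have hE' : expR (om * t) <= 1 + om * t + e * t.
  by move: hE => /(le_trans (ler_norm _)); lra.
have hS' : rnorm (S t d) <= (1 + om * t + e * t) * rnorm d.
  by apply: le_trans hS _; rewrite ler_wpM2r// ltW.
move=> h; have : t * rnorm d <= t * (e * (rnorm d + 1)) by move: h hS'; nra.
rewrite ler_pM2l// /e divfK ?gt_eqF//.
by rewrite ler_pdivlMr//; move: dn; lra.
Qed.

(** The equation is [(1 + A) x = x + om x - y] in resolvent form, that is, [y = om x - A x];
    membership of [x] in the domain is built in. *)
Lemma rescaled_generator x y :
  generator (fun t => S t) (x, y) <-> x = V 1 (x + (om%:C *: x - y)).
Proof.
split; first by move=> /generatorP/resolvent_of_derivative_at0.
set w := x + _ => xE; apply/generatorP.
have := derivative_at0_resolvent w; rewrite -xE.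
suff -> : om%:C *: x - (w - x) = y by [].
by rewrite /w addrAC subrr add0r subKr.
Qed.

End RescaledGenerator.
(** * Asymptotic compactness *)

Section FiniteRankPerturbation.
Variables (R : realType) (H : completeNormedModType R[i]).
Variables (dotH : {dot H for Num.conj}) (dotH_norm : dot_induces_norm dotH).
Implicit Types (l : seq H) (x y h : H).

Lemma finite_rank_endo l (c : R[i]) : exists K : endo H,
  tb_operator K /\
  forall x y, dotH (K x) y = c * \sum_(h <- l) dotH x h * dotH h y.
Proof.
elim: l => [|h l [K [tK HK]]].
  exists 0; split=> [|x y]; first exact: tb_operator0.
  by rewrite big_nil mulr0 [dotH _ y]linear0l.
have rlin : linear (fun x => (c * dotH x h) *: h).
  by move=> d x y; rewrite dotDl dotZl scalerA -scalerDl mulrDr mulrCA.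
exists (Endo rlin + K); split=> [|x y].
  apply: tb_operatorD => //.
  apply: (@tb_operator_rank1 _ _ _ (fun x => c * dotH x h) (normc c * rnorm h) h) => //.
    by rewrite mulr_ge0 ?normc_ge0 ?rnorm_ge0.
  move=> x; rewrite normcM -mulrA ler_wpM2l ?normc_ge0// mulrC.
  exact: (CauchySchwarz_rnorm dotH_norm).
by rewrite big_cons mulrDr dotDl HK dotZl mulrA.
Qed.

End FiniteRankPerturbation.

Section ResolventComparison.
Variables (R : realType) (H V : completeNormedModType R[i]).
Variables (dotH : {dot H for Num.conj}) (dotH_norm : dot_induces_norm dotH).
Variables (j : {linear V -> H}).
Variables (a b : V -> V -> R[i]) (m : R) (K : endo H).
Hypothesis abK : forall u v, b u v = a u v + dotH (K (j u)) (j v).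
Variables Va Vb : R[i] -> endo H.
Hypotheses (Va0 : Va 0 = 1) (Vb0 : Vb 0 = 1).
Hypothesis Va_solves : forall z f u, cone m z -> z != 0 ->
  solves dotH j a z f u -> Va z f = j u.
Hypothesis HVb : forall z f, cone m z -> z != 0 ->
  exists u, Vb z f = j u /\ solves dotH j b z f u.
Hypotheses (Va1 : forall z, cone m z -> bd (Va z) 1)
  (Vb1 : forall z, cone m z -> bd (Vb z) 1).
Hypothesis tK : tb_operator K.

Lemma tb_resolvent_sub z : cone m z -> tb_operator (Va z - Vb z).
Proof.
move=> cz; have [->|z0] := eqVneq z 0.
  by rewrite Va0 Vb0 subrr; exact: tb_operator0.
(* The second resolvent identity: the solution [u] of the [b]-equation for [f] solves the
   [a]-equation for [f - z K (j u)]. *)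
have -> : Va z - Vb z = z *: (Va z * K * Vb z).
  apply: endoP => f; have [u [fu su]] := HVb f cz z0.
  have : Va z (f - z *: K (j u)) = j u.
    apply: (Va_solves cz z0) => v; have := su v; rewrite abK dotBl dotZl => <-.
    by ring.
  rewrite linearB linearZ/= => E.
  by rewrite /endoZ /endoM /= fu -[X in _ - X]E subKr.
apply: tb_operatorZ; apply: tb_operatorMr ler01 (Vb1 cz) _.
exact: tb_operatorMl ler01 (Va1 cz) tK.
Qed.

End ResolventComparison.

Section ResolventDecay.
Variables (R : realType) (H V : completeNormedModType R[i]).
Variables (dotH : {dot H for Num.conj}) (dotH_norm : dot_induces_norm dotH).
Variables (j : {linear V -> H}) (b : V -> V -> R[i]) (m ka : R).
Hypotheses (m0 : 0 < m) (ka0 : 0 <= ka).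
Hypothesis b_ka : forall u, ka * rnorm (j u) ^+ 2 <= complex.Re (b u u).
Variable W : R[i] -> endo H.
Hypothesis W0 : W 0 = 1.
Hypothesis HW : forall z f, cone m z -> z != 0 ->
  exists u, W z f = j u /\ solves dotH j b z f u.

(** Testing the equation with its solution gives [(1 + ka t) |j u|^2 <= Re <f, j u>]. *)
Lemma bd_resolvent_decay t : 0 <= t -> bd (W t%:C) (1 + ka * t)^-1.
Proof.
move=> t0; have [->|tn0] := eqVneq t 0.
  by rewrite W0 mulr0 addr0 invr1 => x; rewrite mul1r.
have tc : t%:C != 0 by rewrite -normc_gt0 normc_real normr_gt0.
move=> f; have [u [-> su]] := HW f (cone_real m0 t0) tc.
have kt : 0 < 1 + ka * t by rewrite ltr_wpDr ?mulr_ge0.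
rewrite mulrC ler_pdivlMr//; have [u0|u0] := eqVneq (rnorm (j u)) 0.
  by rewrite u0 mul0r rnorm_ge0.
have un : 0 < rnorm (j u) by rewrite lt_neqAle eq_sym u0 rnorm_ge0.
rewrite -(ler_pM2r un); apply: le_trans (Re_dot_le dotH_norm f (j u)).
rewrite -su ReD Re_realM -(rnorm_sqr dotH_norm).
by have := ler_wpM2l t0 (b_ka u); lra.
Qed.

End ResolventDecay.

Theorem theorem1p2 (R : realType) (H V : completeNormedModType R[i])
    (dotH : {dot H for Num.conj}) (dotV : {dot V for Num.conj})
    (dotH_norm : dot_induces_norm dotH) (dotV_norm : dot_induces_norm dotV)
    (j : {linear V -> H}) (j_inj : injective j) (j_cont : continuous j)
    (j_dense : dense (range j))
    (a : sesquilinear_form V) (a_cont : continuous_form a)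
    (a_coercive : essentially_positive_coercive a) :
  exists S : R -> {linear H -> H},
    [/\ holomorphic_C0_semigroup S,
        generator S = opp_operator (form_operator dotH j a)
      & asymptotically_compact S].
Proof.
have [l [c [al [c0 al0 acoer]]]] :=
  coercive_up_to_finite_rank dotH_norm dotV_norm j_inj j_cont a_cont a_coercive.
have [cj cj0 jc] := linear_continuous_rbound j_cont.
have [M M0 aM] := continuous_form_bound a_cont.
pose om := c * \sum_(h <- l) rnorm h ^+ 2.
have om0 : 0 <= om by rewrite mulr_ge0// sumr_ge0// => h _; rewrite sqr_ge0.
have [K [tK HK]] := finite_rank_endo dotH_norm l c%:C.
pose a1 u v := a u v + om%:C * dotH (j u) (j v).
pose b1 u v := a1 u v + dotH (K (j u)) (j v).
(* The shift and the finite-rank term add at most [om cj^2] each. As [a1] and [b1] share [M1] and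
   [al], they also share the cone and the Ritt constant, and their resolvents can be compared at
   every [z]. *)
pose M1 := M + 2 * om * cj ^+ 2.
have M10 : 0 < M1 by rewrite ltr_wpDr// mulr_ge0 ?sqr_ge0// mulr_ge0.
pose m := al / 2 / M1.
have m0 : 0 < m by rewrite !divr_gt0.
have mM : m * M1 <= al / 2 by rewrite /m divfK// gt_eqF.
have jj u v : rnorm (j u) * rnorm (j v) <= cj ^+ 2 * (rnorm u * rnorm v).
  by rewrite expr2 mulrACA ler_pM ?rnorm_ge0.
have om_bound u v : om * normc (dotH (j u) (j v)) <= om * (cj ^+ 2 * (rnorm u * rnorm v)).
  rewrite ler_wpM2l// (le_trans _ (jj u v))//.
  exact: (CauchySchwarz_rnorm dotH_norm).
have K_bound u v : normc (dotH (K (j u)) (j v)) <= om * (cj ^+ 2 * (rnorm u * rnorm v)).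
  rewrite (le_trans _ (ler_wpM2l om0 (jj u v)))// HK normcM normc_real ger0_norm//.
  rewrite /om -mulrA ler_wpM2l//.
  elim: (l) => [|h l' IH]; first by rewrite !big_nil normc0 mul0r.
  rewrite !big_cons (le_trans (le_normcD _ _))// mulrDl lerD// normcM.
  apply: le_trans (ler_pM (normc_ge0 _) (normc_ge0 _) (CauchySchwarz_rnorm dotH_norm _ _)
    (CauchySchwarz_rnorm dotH_norm _ _)) _.
  by rewrite le_eqVlt; apply/orP; left; apply/eqP; ring.
have a1_l d x y v : a1 (d *: x + y) v = d * a1 x v + a1 y v.
  by rewrite /a1 formDl formZl (linearP j) dotDl dotZl; ring.
have a1_r d x y v : a1 v (d *: x + y) = Num.conj d * a1 v x + a1 v y.
  by rewrite /a1 formDr formZr (linearP j) dotDr dotZr; ring.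
have b1_l d x y v : b1 (d *: x + y) v = d * b1 x v + b1 y v.
  by rewrite /b1 a1_l !linearP dotDl dotZl; ring.
have b1_r d x y v : b1 v (d *: x + y) = Num.conj d * b1 v x + b1 v y.
  by rewrite /b1 a1_r linearP dotDr dotZr; ring.
have a1_n u v : normc (a1 u v) <= M * rnorm u * rnorm v + om * (cj ^+ 2 * (rnorm u * rnorm v)).
  rewrite (le_trans (le_normcD _ _))// lerD// normcM normc_real ger0_norm//.
have a1_M u v : normc (a1 u v) <= M1 * rnorm u * rnorm v.
  apply: le_trans (a1_n u v) _; rewrite /M1.
  have := mulr_ge0 om0 (mulr_ge0 (sqr_ge0 cj) (mulr_ge0 (rnorm_ge0 u) (rnorm_ge0 v))).
  lra.
have b1_M u v : normc (b1 u v) <= M1 * rnorm u * rnorm v.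
  rewrite (le_trans (le_normcD _ _))// (le_trans (lerD (a1_n u v) (K_bound u v)))//.
  by rewrite /M1 le_eqVlt; apply/orP; left; apply/eqP; ring.
have KK u : complex.Re (dotH (K (j u)) (j u)) = c * \sum_(h <- l) normc (dotH (j u) h) ^+ 2.
  rewrite HK Re_realM; congr (_ * _).
  elim: (l) => [|h l' IH]; first by rewrite !big_nil.
  by rewrite !big_cons ReD IH -[dotH h _]dot_conj normc_conjM.
have KKom u : c * \sum_(h <- l) normc (dotH (j u) h) ^+ 2 <= om * rnorm (j u) ^+ 2.
  rewrite /om -mulrA ler_wpM2l// mulr_suml ler_sum// => h _.
  rewrite -exprMn ler_sqr ?nnegrE ?mulr_ge0 ?normc_ge0 ?rnorm_ge0// mulrC.
  exact: (CauchySchwarz_rnorm dotH_norm).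
have a1_re u : complex.Re (a1 u u) = complex.Re (a u u) + om * rnorm (j u) ^+ 2.
  by rewrite ReD Re_realM -(rnorm_sqr dotH_norm).
have a1_c u : al * rnorm u ^+ 2 <= complex.Re (a1 u u).
  by rewrite a1_re (le_trans (acoer u))// lerD2l.
have b1_c0 u : al * rnorm u ^+ 2 + om * rnorm (j u) ^+ 2 <= complex.Re (b1 u u).
  by rewrite ReD a1_re KK addrAC lerD2r.
have b1_c u : al * rnorm u ^+ 2 <= complex.Re (b1 u u).
  by apply: le_trans (b1_c0 u); rewrite lerDl mulr_ge0// sqr_ge0.
(* The coercivity in [V] is traded for a lower bound in [H] through [|j u| <= cj |u|]. *)
pose de := al / cj ^+ 2; have de0 : 0 < de by rewrite divr_gt0// exprn_gt0.
have b1_ka u : (om + de) * rnorm (j u) ^+ 2 <= complex.Re (b1 u u).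
  apply: le_trans (b1_c0 u); rewrite mulrDl addrC lerD2r /de mulrAC ler_pdivrMr ?exprn_gt0//.
  rewrite -mulrA ler_wpM2l ?(ltW al0)// mulrC -exprMn.
  by rewrite ler_sqr ?nnegrE ?mulr_ge0 ?rnorm_ge0// ltW.
have [Va [Va0 HVa]] := form_resolvent_exists dotH_norm dotV_norm j_cont a1_l a1_r a1_M al0 m0 mM a1_c.
have [Vb [Vb0 HVb]] := form_resolvent_exists dotH_norm dotV_norm j_cont b1_l b1_r b1_M al0 m0 mM b1_c.
pose C := ritt_constant M1 al m.
have C0 : 0 <= C by exact: sqrtr_ge0.
have Va_fam : resolvent_family m C Va := form_resolvent_family dotH_norm a1_l a1_M M10 al0 m0 mM a1_c Va0 HVa.
have Vb_fam : resolvent_family m C Vb := form_resolvent_family dotH_norm b1_l b1_M M10 al0 m0 mM b1_c Vb0 HVb.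
have Va_dense := form_resolvent_dense dotH_norm a1_l a1_M al0 m0 a1_c HVa j_dense.
have [Ta HTa] := euler_limit m0 C0 Va_fam.
have [Tb HTb] := euler_limit m0 C0 Vb_fam.
have Va_solves z f u (cz : cone m z) (z0 : z != 0) : solves dotH j a1 z f u -> Va z f = j u.
  exact: (form_resolvent_solves dotH_norm a1_l a1_M al0 m0 mM a1_c HVa cz z0).
exists (fun t => rescaled om Ta t%:C : {linear H -> H}); split.
- exact: (rescaled_holomorphic m0 C0 om0 Va_fam Va_dense HTa).
- apply/predeqP => -[x y].
  have one : cone m (1 : R[i]) by exact: (cone_real m0 ler01).
  have one0 : (1 : R[i]) != 0 by exact: oner_neq0.
  split.
    (* In weak form the resolvent equation is [<x, j v> + a1 u v = <x + om x - y, j v>]; the terms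
       [<x, j v>] and [om <x, j v>] cancel and leave [a u v = <- y, j v>]. *)
    move=> /(rescaled_generator m0 om0 Va_fam Va_dense HTa) xE.
    have [u [Vu su]] := HVa _ (x + (om%:C *: x - y)) one one0.
    have xu : x = j u by rewrite {1}xE Vu.
    exists u => //= v; have := su v; rewrite mul1r /a1 dotDl dotBl dotZl -xu => /addrI E.
    apply: (addIr (om%:C * dotH x (j v))); rewrite E addrC; congr (_ + _).
    by rewrite -[- y]scaleN1r dotZl mulN1r.
  move=> [u /= xu ax]; apply/(rescaled_generator m0 om0 Va_fam Va_dense HTa).
  rewrite [LHS]xu; apply/esym; apply: (Va_solves _ _ _ one one0) => v.
  rewrite mul1r /a1 ax -xu dotDl dotBl dotZl -[- y]scaleN1r dotZl.
  by ring.
exists 1, de; split => // t t0; rewrite mul1r.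
have ct := cone_real m0 t0.
(* Subtracting this compact operator leaves [exp(om t) Tb(t)], of norm at most
   [exp(om t - (om + de) t) = exp(- de t)]. *)
apply: (ess_norm_le (K := growth om t%:C *: (Ta t%:C - Tb t%:C))).
- exact: expR_ge0.
- apply/tb_operatorZ/(tb_semigroup_sub Va_fam Vb_fam HTa HTb) => // z cz.
  apply: (tb_resolvent_sub _ Va0 Vb0 Va_solves HVb) => //.
  + by move=> w; case: Va_fam => _ h _ _; exact: h.
  + by move=> w; case: Vb_fam => _ h _ _; exact: h.
have -> : rescaled om Ta t%:C - growth om t%:C *: (Ta t%:C - Tb t%:C) =
    growth om t%:C *: Tb t%:C by rewrite /rescaled scalerBr subKr.
have ka0 : 0 <= om + de by rewrite addr_ge0// ltW.
have Vb_decay := bd_resolvent_decay dotH_norm m0 ka0 b1_ka Vb0 HVb.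
have := bdZ (growth om t%:C) (bd_semigroup_decay m0 ka0 HTb Vb_decay t0).
apply: bd_le; rewrite growth_real normc_real ger0_norm ?expR_ge0// -expRD ler_expR.
by rewrite le_eqVlt; apply/orP; left; apply/eqP; ring.
Qed.
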